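(* Let $\mathfrak g$ be simple of rank $r$ with highest root $\theta$ and Coxeter number $h$. Then $$\sum_{\mu}\mathfrak m_\theta^\mu(q)=\mathfrak m_\theta^0(q)\bigl(\mathfrak m_\theta^0(q)-r+1\bigr)+\frac{\mathfrak m_\theta^0(q)}{q}\cdot\frac{1-q^h}{1-q},$$ where the sum is over the distinct weights $\mu\in\Delta\cup\{0\}$ of $\mathfrak g=V_\theta$; equivalently, $$\sum_{\mu} m_\theta^\mu\,\mathfrak m_\theta^\mu(q)=\mathfrak m_\theta^0(q)^2+\frac{\mathfrak m_\theta^0(q)}{q}\cdot\frac{1-q^h}{1-q},$$ where $m_\theta^\mu=\dim\mathfrak g^\mu$ (so $m_\theta^\mu=1$ for $\mu\in\Delta$ and $m_\theta^0=r$).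
   Context: Let $\mathfrak g$ be a semisimple Lie algebra over an algebraically closed field of characteristic zero, with Cartan subalgebra $\mathfrak t$, root system $\Delta$, positive roots $\Delta^+$, simple roots $\Pi=\{\alpha_1,\dots,\alpha_r\}$, $\rho=\frac12\sum_{\gamma\in\Delta^+}\gamma$, integral weight lattice $\mathfrak X$, dominant weights $\mathfrak X_+$, root lattice $Q$, and $Q_+$ the monoid generated by $\Pi$. The Weyl group is $W$, with length function $\ell$ and sign $\varepsilon(w)=(-1)^{\ell(w)}$. Define polynomials $\mathcal P_q(\mu)\in\mathbb Z[q]$ by $\prod_{\alpha\in\Delta^+}(1-qe^{\alpha})^{-1}=\sum_{\mu\in Q_+}\mathcal P_q(\mu)e^\mu$, and $\mathcal P_q(\mu)=0$ for $\mu\notin Q_+$. For $\lambda\in\mathfrak X_+$ and any $\mu\in\mathfrak X$, Lusztig's $q$-analogue of weight multiplicity is $\mathfrak m_\lambda^\mu(q)=\sum_{w\in W}\varepsilon(w)\mathcal P_q(w(\lambda+\rho)-(\mu+\rho))$; $m_\lambda^\mu$ denotes the dimension of the $\mu$-weight space of the simple module $V_\lambda$. $h$ is the Coxeter number of $\mathfrak g$ ($h-1=\mathrm{ht}(\theta)$). *)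

(* Defs.v *)
(* Root-system data of a simple Lie algebra, encoded via its
   (indecomposable, finite-type) Cartan matrix; all weights are written in
   coordinates w.r.t. the simple roots (row vectors over rat). *)
From HB Require Import structures.
From mathcomp Require Import all_boot all_order all_algebra.
From Stdlib Require Import ClassicalEpsilon.
Set Implicit Arguments.
Unset Strict Implicit.
Unset Printing Implicit Defensive.
Import Order.TTheory GRing.Theory Num.Theory.
Local Open Scope ring_scope.

(* A i j = < alpha_i^vee , alpha_j >  (Kac's convention). *)
Definition is_finite_cartan (r : nat) (A : 'M[int]_r) : Prop :=
  [/\ (forall i, A i i = 2),
      (forall i j, i != j -> A i j <= 0),
      (forall i j, (A i j == 0) = (A j i == 0)) &
      exists d : 'rV[rat]_r,
        [/\ (forall i, 0 < d 0 i),
            (forall i j, d 0 i * (A i j)%:~R = d 0 j * (A j i)%:~R) &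
            (forall v : 'rV[rat]_r, v != 0 ->
               0 < \sum_i \sum_j v 0 i * d 0 i * (A i j)%:~R * v 0 j)]].

Definition indecomposable (r : nat) (A : 'M[int]_r) : Prop :=
  forall S : {set 'I_r}, S != set0 -> S != setT ->
    exists i j, [/\ i \in S, j \notin S & A i j != 0].

(* simple reflection s_i acting on row vectors c (root coordinates) by c *m sref i:
   s_i(c) = c - < c, alpha_i^vee > alpha_i *)
Definition sref (r : nat) (A : 'M[int]_r) (i : 'I_r) : 'M[rat]_r :=
  \matrix_(j, k) ((j == k)%:R - (i == k)%:R * (A i j)%:~R).

Definition wordmx (r : nat) (A : 'M[int]_r) (s : seq 'I_r) : 'M[rat]_r :=
  foldr (fun i M => sref A i *m M) 1%:M s.

Definition inW (r : nat) (A : 'M[int]_r) (M : 'M[rat]_r) : Prop :=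
  exists s, wordmx A s = M.

Definition wlength (r : nat) (A : 'M[int]_r) (M : 'M[rat]_r) : nat :=
  epsilon (inhabits 0%N) (fun n =>
    (exists s, size s = n /\ wordmx A s = M) /\
    (forall s, wordmx A s = M -> (n <= size s)%N)).

Definition wsign (r : nat) (A : 'M[int]_r) (M : 'M[rat]_r) : int :=
  (-1) ^+ wlength A M.

Definition simple_root (r : nat) (i : 'I_r) : 'rV[rat]_r := delta_mx 0 i.

(* the root system Delta = W . Pi (given an enumeration Ws of W) *)
Definition rootsW (r : nat) (Ws : seq 'M[rat]_r) : seq 'rV[rat]_r :=
  undup [seq simple_root i *m w | i <- enum 'I_r, w <- Ws].

Definition posroots (r : nat) (Ws : seq 'M[rat]_r) : seq 'rV[rat]_r :=
  [seq a <- rootsW Ws | [forall i, 0 <= (a : 'rV[rat]_r) 0 i]].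

Definition rho (r : nat) (Ws : seq 'M[rat]_r) : 'rV[rat]_r :=
  2^-1 *: \sum_(a <- posroots Ws) a.

Definition ht (r : nat) (v : 'rV[rat]_r) : rat := \sum_i v 0 i.

(* q-Kostant partition function: coefficient of e^mu in
   prod_{alpha in ps} (1 - q e^alpha)^{-1}, i.e. the sum over all
   (k_alpha) in N^ps with sum k_alpha alpha = mu of q^(sum k_alpha).
   Since every positive root has height >= 1, each k_alpha <= ht mu, so
   restricting k_alpha < B (B > ht mu for mu in Q_+) loses no term;
   for mu outside Q_+ the sum is empty, i.e. 0. *)
Definition kostant (r : nat) (ps : seq 'rV[rat]_r) (mu : 'rV[rat]_r) : {poly int} :=
  let B := ((\sum_(i < r) absz (numq (mu ord0 i))).+1)%N in
  \sum_(k : {ffun 'I_(size ps) -> 'I_B} |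
          \sum_(j < size ps) (k j : nat)%:R *: ps`_j == mu)
     'X^(\sum_j (k j : nat))%N.

Definition qmult (r : nat) (A : 'M[int]_r) (Ws : seq 'M[rat]_r)
    (lambda mu : 'rV[rat]_r) : {poly int} :=
  \sum_(w <- Ws) (wsign A w)%:P *
     kostant (posroots Ws) ((lambda + rho Ws) *m w - (mu + rho Ws)).

(* Main.v *)
(* The character of V_theta is r + sum_(g in Delta) e^g: among the alternating
   sums at rho + g, those of the - a_ i cancel the term r, that of a short
   dominant root cancels against one other, and only theta remains.  Hence m_theta^mu(q) is
   r f0(mu) + sum_g f0(mu + g) with f0(mu) = m_0^mu(q).  All these functions of mu satisfy
   a straightening relation for each simple reflection, which determines them on
   the roots: with H = h - 1 = ht theta and m0 = m_theta^0(q),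
     m_theta^g(q) - m0 f0(g) = q^(H - ht g)         for g > 0,
     m_theta^g(q) - m0 f0(g) = q^(H + ht(-g) - 1)   for g < 0,
   where f0(g) = 0 and f0(g) = (q - 1) q^(ht(-g) - 1) respectively.  Summing,
   the theorem becomes q Y = m0 (1 + q + ... + q^H), where Y is the sum of these
   powers.  Explicitly, q (q - 1) Y = q^h m0(q) - q^h m0(1/q), so what is needed
   is that m0 is palindromic, m0(q) = q^h m0(1/q); by degree this holds once Y
   vanishes at the h-th roots of unity other than 1.  Now Y is a combination of
   the length generating functions of the orbits of the dominant roots.
   By Macdonald's identity these are quotients of products of
   1 - q^(ht b) over the roots b not orthogonal to the dominant root.  The
   heights of the roots b <> theta with (b, theta) > 0 are symmetric under
   k -> H - k, which gives the vanishing for the orbit of theta; the short orbit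
   is handled in the same way through the dual root system, in which the coroot
   of the dominant short root is the highest root. *)
Require Import Defs.
From Stdlib Require Import ClassicalEpsilon.
From HB Require Import structures.
From mathcomp Require Import all_boot all_order all_algebra all_field.
From mathcomp Require Import ring lra zify.
Set Implicit Arguments.
Unset Strict Implicit.
Unset Printing Implicit Defensive.
Import Order.TTheory GRing.Theory Num.Theory.
Local Open Scope ring_scope.

(** The straightening relation exists because multiplying by [1 - q e^(alpha_i)] removes [alpha_i]
    from Kostant's function, and [s_i] permutes the remaining positive roots. With two root lengths,
    [Theta mu = m_theta^mu - m0 f0(mu)] is a power of [q] times [q^ell] on the short orbit, but on
    the long orbit short roots inside the root strings disturb it. A second solution [Xi], built
    from the short roots alone, removes the disturbance, and a symmetric double sum evaluates the
    total of [Xi]. For the short orbit one also needs the highest coroot to have height [h - 1]. No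
    classification enters: both root systems have the same Weyl group and lengths, its Poincare
    polynomial is a quotient of products over heights in either system, and a primitive root of
    unity compares the largest heights. The last step counts roots: [m0(q) - q^h m0(1/q)] has degree
    at most [h] and vanishes at 0 and at all [h]-th roots of unity. The symmetrizer [d] is an
    explicit parameter so that every result can be applied again to the dual datum. *)

Record cartan_datum (r : nat) (A : 'M[int]_r) (d : 'rV[rat]_r)
    (Ws : seq 'M[rat]_r) : Prop := CartanDatum {
  cartan_diag : forall i, A i i = 2;
  cartan_offdiag : forall i j, i != j -> A i j <= 0;
  cartan_sym0 : forall i j, (A i j == 0) = (A j i == 0);
  symm_gt0 : forall i, 0 < d 0 i;
  symmC : forall i j, d 0 i * (A i j)%:~R = d 0 j * (A j i)%:~R;
  symm_posdef : forall v : 'rV[rat]_r, v != 0 ->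
    0 < \sum_i \sum_j v 0 i * d 0 i * (A i j)%:~R * v 0 j;
  weyl_uniq : uniq Ws;
  weylP : forall M, M \in Ws <-> inW A M }.

(** * The Weyl group action and the invariant form *)

Section Basics.
Variables (r : nat) (A : 'M[int]_r) (d : 'rV[rat]_r) (Ws : seq 'M[rat]_r).
Hypothesis CD : cartan_datum A d Ws.

Local Notation V := 'rV[rat]_r.
Local Notation a_ i := (simple_root i).
Local Notation s_ i := (sref A i).
Local Notation R := (rootsW Ws).

(** The pairing of [v] with the simple coroot [alpha_i^vee]; as a matrix product it inherits
    linearity in [v]. *)
Definition spair (i : 'I_r) (v : V) : rat :=
  (v *m \matrix_(j, k) (A k j)%:~R) 0 i.
Local Notation cp := spair.

Lemma cpE i v : cp i v = \sum_j v 0 j * (A i j)%:~R.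
Proof. by rewrite /spair mxE; apply: eq_bigr => j _; rewrite mxE. Qed.

Lemma cpD i u v : cp i (u + v) = cp i u + cp i v.
Proof. by rewrite /spair mulmxDl mxE. Qed.
Lemma cpN i u : cp i (- u) = - cp i u.
Proof. by rewrite /spair mulNmx mxE. Qed.
Lemma cpB i u v : cp i (u - v) = cp i u - cp i v.
Proof. by rewrite cpD cpN. Qed.
Lemma cpZ i a u : cp i (a *: u) = a * cp i u.
Proof. by rewrite /spair -scalemxAl mxE. Qed.

Lemma simpleE i j : (a_ i : V) 0 j = (i == j)%:R.
Proof. by rewrite mxE eqxx eq_sym. Qed.

Lemma cp_simple i j : cp i (a_ j) = (A i j)%:~R.
Proof.
rewrite cpE (bigD1 j) //= simpleE eqxx mul1r big1 ?addr0 // => k nkj.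
by rewrite simpleE eq_sym (negPf nkj) mul0r.
Qed.

Lemma cp_simple2 i : cp i (a_ i) = 2.
Proof. by rewrite cp_simple (cartan_diag CD). Qed.

Lemma row_simple (v : V) : v = \sum_i v 0 i *: a_ i.
Proof. by rewrite {1}[v]row_sum_delta. Qed.

Lemma srefE i (v : V) : v *m s_ i = v - cp i v *: a_ i.
Proof.
apply/rowP => k; rewrite !mxE cpE.
under eq_bigr => j _ do rewrite !mxE mulrBr.
rewrite sumrB (bigD1 k) //= eqxx mulr1 [X in _ + X - _]big1 => [|j njk]; last first.
  by rewrite (negPf njk) mulr0.
rewrite addr0; congr (_ - _).
rewrite [k == i]eq_sym mulr_suml; apply: eq_bigr => j _; ring.
Qed.

Lemma sref_simple i : a_ i *m s_ i = - a_ i.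
Proof. by rewrite srefE cp_simple2; apply/rowP => k; rewrite !mxE; ring. Qed.

Lemma cp_sref i v : cp i (v *m s_ i) = - cp i v.
Proof. by rewrite srefE cpB cpZ cp_simple2; ring. Qed.

Lemma srefK i (v : V) : v *m s_ i *m s_ i = v.
Proof. by rewrite srefE cp_sref srefE scaleNr opprK subrK. Qed.

Lemma mx_ext (M N : 'M[rat]_r) : (forall v : V, v *m M = v *m N) -> M = N.
Proof.
by move=> eqMN; apply/row_matrixP => i; rewrite !rowE eqMN.
Qed.

Lemma sref_sq i : s_ i *m s_ i = 1%:M.
Proof. by apply: mx_ext => v; rewrite mulmxA srefK mulmx1. Qed.

Lemma wordmx_cat s t : wordmx A (s ++ t) = wordmx A s *m wordmx A t.
Proof. by elim: s => [|i s IH] /=; rewrite ?mul1mx // IH mulmxA. Qed.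

Lemma wordmx_rcons s i : wordmx A (rcons s i) = wordmx A s *m s_ i.
Proof. by rewrite -cats1 wordmx_cat /= mulmx1. Qed.

Lemma wordmx_rev s : wordmx A (rev s) *m wordmx A s = 1%:M.
Proof.
elim: s => [|i s IH]; first by rewrite /= mulmx1.
rewrite rev_cons wordmx_rcons /= -mulmxA [s_ i *m _]mulmxA sref_sq.
by rewrite mul1mx.
Qed.

Lemma word_in s : wordmx A s \in Ws.
Proof. by apply/(weylP CD); exists s. Qed.

Lemma inWs M : M \in Ws -> exists s, wordmx A s = M.
Proof. by move/(weylP CD). Qed.

Lemma W1 : 1%:M \in Ws. Proof. exact: (word_in [::]). Qed.
Lemma Ws_sref i : s_ i \in Ws.
Proof. by have := word_in [:: i]; rewrite /= mulmx1. Qed.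
Lemma WsM M N : M \in Ws -> N \in Ws -> M *m N \in Ws.
Proof. by move=> /inWs[s <-] /inWs[t <-]; rewrite -wordmx_cat word_in. Qed.
Lemma Ws_unit M : M \in Ws -> M \in unitmx.
Proof.
by move=> /inWs[s <-]; have := wordmx_rev s => /mulmx1_unit[].
Qed.
Lemma WsV M : M \in Ws -> invmx M \in Ws.
Proof.
move=> MW; have uM := Ws_unit MW; case/inWs: MW => s sM.
have <- : wordmx A (rev s) = invmx M; last exact: word_in.
by rewrite -[LHS]mulmx1 -(mulmxV uM) mulmxA -sM wordmx_rev mul1mx.
Qed.
Lemma WK M (v : V) : M \in Ws -> v *m M *m invmx M = v.
Proof. by move=> MW; rewrite -mulmxA mulmxV ?Ws_unit // mulmx1. Qed.
Lemma WVK M (v : V) : M \in Ws -> v *m invmx M *m M = v.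
Proof. by move=> MW; rewrite -mulmxA mulVmx ?Ws_unit // mulmx1. Qed.
Lemma W_inj M (u v : V) : M \in Ws -> u *m M = v *m M -> u = v.
Proof. by move=> MW /(congr1 (fun x => x *m invmx M)); rewrite !WK. Qed.

(** The [W]-invariant scalar product normalized by [(alpha_i, alpha_i) = 2 d_i]. *)
Definition bform (u v : V) : rat := \sum_i u 0 i * d 0 i * cp i v.
Local Notation bf := bform.

Lemma bfDl u v w : bf (u + v) w = bf u w + bf v w.
Proof.
by rewrite /bform -big_split /=; apply: eq_bigr => i _; rewrite mxE; ring.
Qed.
Lemma bfZl a u w : bf (a *: u) w = a * bf u w.
Proof. by rewrite /bform mulr_sumr; apply: eq_bigr => i _; rewrite mxE; ring. Qed.

Lemma bfE u v : bf u v = \sum_i \sum_j u 0 i * d 0 i * (A i j)%:~R * v 0 j.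
Proof.
apply: eq_bigr => i _; rewrite cpE mulr_sumr; apply: eq_bigr => j _; ring.
Qed.

Lemma bfC u v : bf u v = bf v u.
Proof.
rewrite !bfE exchange_big; apply: eq_bigr => i _; apply: eq_bigr => j _ /=.
have := symmC CD i j; move: (d 0 i) (d 0 j) => x y e.
transitivity (u 0 j * v 0 i * (y * (A j i)%:~R)); first ring.
rewrite -e; ring.
Qed.
Lemma bfDr u v w : bf w (u + v) = bf w u + bf w v.
Proof. by rewrite bfC bfDl !(bfC w). Qed.
Lemma bfZr a u w : bf w (a *: u) = a * bf w u.
Proof. by rewrite bfC bfZl !(bfC w). Qed.
Lemma bfNl u w : bf (- u) w = - bf u w.
Proof. by rewrite -scaleN1r bfZl mulN1r. Qed.
Lemma bfNr u w : bf w (- u) = - bf w u.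
Proof. by rewrite -scaleN1r bfZr mulN1r. Qed.
Lemma bfBl u v w : bf (u - v) w = bf u w - bf v w.
Proof. by rewrite bfDl bfNl. Qed.
Lemma bfBr u v w : bf w (u - v) = bf w u - bf w v.
Proof. by rewrite bfDr bfNr. Qed.
Lemma bf0l u : bf 0 u = 0.
Proof. by rewrite -[0 in LHS](scale0r 0) bfZl mul0r. Qed.

Lemma bf_simple i v : bf (a_ i) v = d 0 i * cp i v.
Proof.
rewrite /bform (bigD1 i) //= simpleE eqxx mul1r big1 ?addr0 // => k nki.
by rewrite simpleE eq_sym (negPf nki) !mul0r.
Qed.

Lemma bf_gt0 v : v != 0 -> 0 < bf v v.
Proof. by move=> /(symm_posdef CD); rewrite -bfE. Qed.
Lemma bf_ge0 v : 0 <= bf v v.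
Proof. by have [->|/bf_gt0/ltW//] := eqVneq v 0; rewrite bf0l. Qed.
Lemma bf_eq0 v : bf v v = 0 -> v = 0.
Proof. by have [//|/bf_gt0] := eqVneq v 0 => /[swap] ->; rewrite ltxx. Qed.

Lemma bf_sref i u v : bf (u *m s_ i) (v *m s_ i) = bf u v.
Proof.
rewrite !srefE !(bfBl, bfBr) !(bfZl, bfZr) (bfC u (a_ i)) !bf_simple.
rewrite cp_simple2; ring.
Qed.

Lemma bf_W M u v : M \in Ws -> bf (u *m M) (v *m M) = bf u v.
Proof.
move=> /inWs[s <-]; elim: s u v => [|i s IH] u v /=; first by rewrite !mulmx1.
by rewrite !mulmxA IH bf_sref.
Qed.

Lemma bf_WV M u v : M \in Ws -> bf (u *m M) v = bf u (v *m invmx M).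
Proof. by move=> MW; rewrite -[v in LHS](WVK _ MW) bf_W. Qed.

Lemma simple_neq0 i : a_ i != 0 :> V.
Proof.
apply/eqP => /rowP/(_ i); rewrite simpleE eqxx mxE => /eqP.
by rewrite oner_eq0.
Qed.

Lemma cauchy (u v : V) : v != 0 -> (forall c, u != c *: v) ->
  bf u v ^+ 2 < bf u u * bf v v.
Proof.
move=> v0 nuv; have vv := bf_gt0 v0.
have /bf_gt0 : bf v v *: u - bf u v *: v != 0.
  rewrite subr_eq0; apply/eqP => e; have /eqP[] := nuv (bf u v / bf v v).
  by rewrite mulrC -scalerA -e scalerA mulVf ?scale1r // gt_eqF.
rewrite !(bfBl, bfBr, bfZl, bfZr) (bfC v u) => h.
have : 0 < bf v v * (bf u u * bf v v - bf u v ^+ 2) by rewrite (lt_le_trans h) //; nra.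
by rewrite pmulr_rgt0 // subr_gt0.
Qed.

Lemma rootsP g : reflect (exists i, exists2 M, M \in Ws & g = a_ i *m M) (g \in R).
Proof.
rewrite mem_undup; apply: (iffP allpairsP) => /=.
  by case=> [[i M]] /= [_ MW ->]; exists i, M.
by case=> i [M MW ->]; exists (i, M); rewrite mem_enum.
Qed.

Lemma root_uniq : uniq R. Proof. exact: undup_uniq. Qed.

Lemma rootW g M : M \in Ws -> g \in R -> g *m M \in R.
Proof.
move=> MW /rootsP[i [N NW ->]]; apply/rootsP; exists i, (N *m M).
  exact: WsM.
by rewrite mulmxA.
Qed.
Lemma rootWE g M : M \in Ws -> (g *m M \in R) = (g \in R).
Proof.
move=> MW; apply/idP/idP => [|/rootW]; last exact.
by move=> /(rootW (WsV MW)); rewrite WK.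
Qed.
Lemma simple_root_in i : a_ i \in R.
Proof. by apply/rootsP; exists i, 1%:M; rewrite ?W1 ?mulmx1. Qed.
Lemma root_sref g i : g \in R -> g *m s_ i \in R.
Proof. exact/rootW/Ws_sref. Qed.
Lemma rootN g : g \in R -> - g \in R.
Proof.
move=> /rootsP[i [M MW ->]]; rewrite -mulNmx -sref_simple.
by apply/rootW/root_sref/simple_root_in.
Qed.
Lemma rootNE g : (- g \in R) = (g \in R).
Proof. by apply/idP/idP => /rootN //; rewrite opprK. Qed.
Lemma root_neq0 g : g \in R -> g != 0.
Proof.
move=> /rootsP[i [M MW ->]]; apply: contra (simple_neq0 i) => /eqP e.
by rewrite -(WK (a_ i) MW) e mul0mx.
Qed.
Lemma root_bf_gt0 g : g \in R -> 0 < bf g g.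
Proof. by move=> /root_neq0/bf_gt0. Qed.

Definition intv (v : V) : Prop := forall i, v 0 i \is a Num.int.

Lemma intvD u v : intv u -> intv v -> intv (u + v).
Proof. by move=> iu iv i; rewrite mxE rpredD. Qed.
Lemma intvN u : intv u -> intv (- u).
Proof. by move=> iu i; rewrite mxE rpredN. Qed.
Lemma intvZ a u : a \is a Num.int -> intv u -> intv (a *: u).
Proof. by move=> ia iu i; rewrite mxE rpredM. Qed.
Lemma intv_simple i : intv (a_ i).
Proof. by move=> j; rewrite simpleE rpred_nat. Qed.
Lemma int_cp i v : intv v -> cp i v \is a Num.int.
Proof. by move=> iv; rewrite cpE rpred_sum // => j _; rewrite rpredM // intr_int. Qed.
Lemma intv_sref i v : intv v -> intv (v *m s_ i).
Proof.
by move=> iv; rewrite srefE; apply/intvD/intvN/intvZ/intv_simple/int_cp.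
Qed.
Lemma intvW M v : M \in Ws -> intv v -> intv (v *m M).
Proof.
move=> /inWs[s <-]; elim: s v => [|i s IH] v iv /=; first by rewrite mulmx1.
by rewrite mulmxA; apply/IH/intv_sref.
Qed.
Lemma root_int g : g \in R -> intv g.
Proof. by move=> /rootsP[i [M MW ->]]; apply/intvW/intv_simple. Qed.

(** The pairing of [u] with the coroot of [g]. *)
Definition cartan_int (u g : V) : rat := 2 * bf u g / bf g g.
Local Notation pr := cartan_int.

Lemma pr_simple u i : pr u (a_ i) = cp i u.
Proof.
rewrite /cartan_int bfC !bf_simple cp_simple2.
by have := symm_gt0 CD i => /gt_eqF/negbT h; field.
Qed.
Lemma pr_W M u g : M \in Ws -> pr (u *m M) (g *m M) = pr u g.
Proof. by move=> MW; rewrite /cartan_int !bf_W. Qed.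
Lemma pr_int u g : intv u -> g \in R -> pr u g \is a Num.int.
Proof.
move=> iu /rootsP[i [M MW ->]].
by rewrite -{1}(WVK u MW) pr_W // pr_simple; apply/int_cp/intvW => //; apply: WsV.
Qed.
Lemma root_refl g : g \in R -> exists2 M, M \in Ws & forall v, v *m M = v - pr v g *: g.
Proof.
move=> /rootsP[i [M MW ->]]; exists (invmx M *m s_ i *m M).
  by do !apply: WsM => //; rewrite ?WsV ?Ws_sref.
move=> v; rewrite !mulmxA srefE mulmxBl WVK // -scalemxAl; congr (_ - _ *: _).
by rewrite -{2}(WVK v MW) pr_W // pr_simple.
Qed.

Lemma refl_root u g : u \in R -> g \in R -> u - pr u g *: g \in R.
Proof. by move=> uR /root_refl[M MW e]; rewrite -e rootW. Qed.

(** Moving [e] to a simple root turns the multiplier into a coordinate of a root, hence an integer.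
    The same holds for its inverse, so it is a unit of the integers. *)
Lemma root_prop g e (c : rat) : g \in R -> e \in R -> g = c *: e -> g = e \/ g = - e.
Proof.
have key (x y : V) (b : rat) : x \in R -> y \in R -> x = b *: y -> b \is a Num.int.
  move=> xR /rootsP[i [M MW ->]] exy.
  have /root_int/(_ i) : x *m invmx M \in R by rewrite rootWE ?WsV.
  by rewrite exy -scalemxAl WK // !mxE !eqxx mulr1.
move=> gR eR ge.
have c0 : c != 0.
  by apply: contraTneq (root_neq0 gR) => c0; rewrite ge c0 scale0r eqxx.
have eg : e = c^-1 *: g by rewrite ge scalerA mulVf ?scale1r.
have /intrP[m mE] := key _ _ _ gR eR ge.
have /intrP[n nE] := key _ _ _ eR gR eg.
have : (m * n)%:~R = 1%:~R :> rat by rewrite intrM -mE -nE mulfV.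
move=> /intr_inj mn.
have /orP[] : m \is a GRing.unit by apply/unitrPr; exists n.
  by move=> /eqP mm; left; rewrite ge mE mm scale1r.
by move=> /eqP mm; right; rewrite ge mE mm scaleN1r.
Qed.
End Basics.

(** * The cone of nonnegative combinations of simple roots, and heights *)

Section Nneg.
Variable r : nat.
Implicit Types u v : 'rV[rat]_r.
Definition nneg v : bool := [forall i, 0 <= v 0 i].

Lemma nnegP v : reflect (forall i, 0 <= v 0 i) (nneg v).
Proof. exact: forallP. Qed.
Lemma nneg0 : nneg 0. Proof. by apply/nnegP => i; rewrite mxE. Qed.
Lemma nnegD u v : nneg u -> nneg v -> nneg (u + v).
Proof. by move=> /nnegP pu /nnegP pv; apply/nnegP => i; rewrite mxE addr_ge0. Qed.
Lemma nnegZ a v : 0 <= a -> nneg v -> nneg (a *: v).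
Proof. by move=> pa /nnegP pv; apply/nnegP => i; rewrite mxE mulr_ge0. Qed.
Lemma nneg_sum I (s : seq I) (P : pred I) F :
  (forall i, P i -> nneg (F i)) -> nneg (\sum_(i <- s | P i) F i).
Proof. by move=> h; elim/big_rec: _ => [|i v Pi]; [exact: nneg0|apply/nnegD/h]. Qed.
Lemma nneg_simple i : nneg (simple_root i).
Proof. by apply/nnegP => j; rewrite simpleE ler0n. Qed.
Lemma nneg_anti v : nneg v -> nneg (- v) -> v = 0.
Proof.
move=> /nnegP p /nnegP n; apply/rowP => i; have := n i; rewrite !mxE => ni.
by apply/eqP; rewrite eq_le p -oppr_ge0 ni.
Qed.
Lemma ht0 : ht (0 : 'rV_r) = 0.
Proof. by rewrite /ht big1 // => i _; rewrite mxE. Qed.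
Lemma htD u v : ht (u + v) = ht u + ht v.
Proof. by rewrite /ht -big_split; apply: eq_bigr => i _; rewrite mxE. Qed.
Lemma htZ a v : ht (a *: v) = a * ht v.
Proof. by rewrite /ht mulr_sumr; apply: eq_bigr => i _; rewrite mxE. Qed.
Lemma htN v : ht (- v) = - ht v.
Proof. by rewrite -scaleN1r htZ mulN1r. Qed.
Lemma htB u v : ht (u - v) = ht u - ht v.
Proof. by rewrite htD htN. Qed.
Lemma ht_simple i : ht (simple_root i : 'rV_r) = 1.
Proof.
rewrite /ht (bigD1 i) //= simpleE eqxx big1 ?addr0 // => j nji.
by rewrite simpleE eq_sym (negPf nji).
Qed.
Lemma ht_ge0 v : nneg v -> 0 <= ht v.
Proof. by move=> /nnegP p; apply: sumr_ge0. Qed.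
Lemma ht_eq0 v : nneg v -> ht v = 0 -> v = 0.
Proof.
move=> /nnegP p /eqP; rewrite psumr_eq0 // => /allP e.
by apply/rowP => i; rewrite mxE; apply/eqP/(e i); rewrite mem_index_enum.
Qed.
Lemma ht_gt0 v : nneg v -> v != 0 -> 0 < ht v.
Proof.
move=> p nz; rewrite lt_neqAle ht_ge0 // andbT eq_sym.
by apply: contra nz => /eqP/(ht_eq0 p)->.
Qed.
End Nneg.

(* Coefficients of the successive images of a simple root under an alternating
   word in two simple reflections: they stay nonnegative until the image is
   again the next simple root. *)
Fixpoint dihedral_nonneg (n : nat) (c c' p q : int) : bool :=
  if n is m.+1 then [&& 0 <= p, 0 <= q &
    ((p == 0) && (q == 1)) || dihedral_nonneg m c' c (c * p - q) p] else false.

(** * Every root is positive or negative *)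

Section Positivity.
Variables (r : nat) (A : 'M[int]_r) (d : 'rV[rat]_r) (Ws : seq 'M[rat]_r).
Hypothesis CD : cartan_datum A d Ws.

Local Notation V := 'rV[rat]_r.
Local Notation a_ i := (simple_root i).
Local Notation s_ i := (sref A i).
Local Notation R := (rootsW Ws).

Lemma cartan_lt4 i l : i != l -> A i l * A l i < 4.
Proof.
move=> nil.
have /(cauchy CD) h : a_ l != 0 :> V by exact: simple_neq0.
have /h : forall c, a_ i != c *: a_ l :> V.
  move=> c; apply/eqP => /rowP/(_ i); rewrite [RHS]mxE !simpleE eqxx.
  by rewrite eq_sym (negPf nil) mulr0 => /eqP; rewrite oner_eq0.
rewrite !bf_simple !(cp_simple A) !(cartan_diag CD).
have e := symmC CD i l.
have di := symm_gt0 CD i; have dl := symm_gt0 CD l.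
rewrite expr2 {2}e => h4.
have : d 0 i * d 0 l * (4 - (A i l * A l i)%:~R) > 0.
  rewrite intrM; move: h4; rewrite -[2%:~R]/(2%:R : rat); lra.
rewrite pmulr_rgt0 ?mulr_gt0 // subr_gt0.
by rewrite -[4]/(4%:~R) ltr_int.
Qed.

(** Only the rank two types A1 x A1, A2, B2 and G2 remain, and each is checked by computation. The
    bound 6 suffices: the longest chain, for G2, reaches a simple root with a word of length 5. *)
Lemma good_cartan i l : i != l -> dihedral_nonneg 6 (- A i l) (- A l i) (- A l i) 1.
Proof.
move=> nil; have h4 := cartan_lt4 nil.
have nli : l != i by rewrite eq_sym.
have := cartan_sym0 CD i l; have := cartan_offdiag CD nil.
have := cartan_offdiag CD nli; move: h4.
move: (A i l) (A l i) => x y h4 y0 x0 xy.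
have [x1|x1] := eqVneq x 0.
  by move: xy; rewrite x1 eqxx => /esym/eqP->.
have y1 : y != 0 by rewrite -xy.
have hx : -3 <= x <= -1 by nia.
have hy : -3 <= y <= -1 by nia.
have {hx} : [\/ x = -1, x = -2 | x = -3] by case: (eqVneq x (-1)); case: (eqVneq x (-2)) => ? ?; [constructor 1|constructor 1|constructor 2|constructor 3]; lia.
have {hy} : [\/ y = -1, y = -2 | y = -3] by case: (eqVneq y (-1)); case: (eqVneq y (-2)) => ? ?; [constructor 1|constructor 1|constructor 2|constructor 3]; lia.
by move=> [] ey [] ex; move: h4; rewrite ex ey.
Qed.

Lemma sref_conj i x (U : 'M[rat]_r) : U \in Ws -> a_ i *m U = a_ x ->
  s_ i *m U = U *m s_ x.
Proof.
move=> UW e; apply: mx_ext => v; rewrite !mulmxA !srefE mulmxBl -scalemxAl e.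
by rewrite -(pr_simple CD _ x) -e (pr_W CD) // (pr_simple CD).
Qed.

Definition wle (M : 'M[rat]_r) (n : nat) : Prop :=
  exists2 s, (size s <= n)%N & wordmx A s = M.
(** That is, [n] is the length of [M]. *)
Definition wmin (M : 'M[rat]_r) (n : nat) : Prop :=
  wle M n /\ forall m, wle M m -> (n <= m)%N.

Lemma wle_sref i M n : wle M n -> wle (s_ i *m M) n.+1.
Proof. by case=> s sn <-; exists (i :: s) => //. Qed.

Lemma wle_word s M n : wle M n -> wle (wordmx A s *m M) (size s + n).
Proof.
case=> t tn <-; exists (s ++ t); last exact: wordmx_cat.
by rewrite size_cat leq_add2l.
Qed.

Lemma srefKl i (M : 'M[rat]_r) : s_ i *m (s_ i *m M) = M.
Proof. by rewrite mulmxA (sref_sq CD) mul1mx. Qed.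

Lemma wle_srefK i M n : wle (s_ i *m M) n -> wle M n.+1.
Proof. by move=> /(wle_sref i); rewrite srefKl. Qed.

Lemma wmin_ex s : exists2 n, (n <= size s)%N & wmin (wordmx A s) n.
Proof.
have [n] := ubnP (size s); elim: n s => // n IH s; rewrite ltnS => sn.
have [[t ts]|h] := classic (exists2 t, (size t < size s)%N & wordmx A t = wordmx A s).
  move=> <-; have [m mt mm] := IH t (leq_trans ts sn).
  by exists m => //; apply: leq_trans (ltnW ts).
exists (size s) => //; split=> [|m [t tm e]]; first by exists s.
rewrite leqNgt; apply/negP => ms; apply: h; exists t => //.
exact: leq_ltn_trans ms.
Qed.

Section Step.
Variable n : nat.
Hypothesis IH : forall m M j, (m < n)%N -> wmin M m ->
  (forall k, wle (s_ j *m M) k -> (m <= k)%N) -> nneg (a_ j *m M).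

(** If [s_j] shortens [M], it does so by exactly one, and it lengthens [s_j M] back; the induction
    hypothesis then applies to [s_j M] instead of [M]. *)
Lemma descend M m j : (m < n)%N -> wmin M m ->
  nneg (a_ j *m M) \/ exists2 m', m = m'.+1 &
    wmin (s_ j *m M) m' /\ nneg (a_ j *m (s_ j *m M)).
Proof.
move=> mn Mm; have [h|h] := classic (forall k, wle (s_ j *m M) k -> (m <= k)%N).
  by left; apply: IH mn Mm h.
right; have [k hk] := not_all_ex_not _ _ h.
have [wk /negP] := imply_to_and _ _ hk.
rewrite -ltnNge => km.
have mk : m = k.+1 by apply/eqP; rewrite eqn_leq km andbT; apply: Mm.2 (wle_srefK wk).
have wmk : wmin (s_ j *m M) k.
  by split=> // p /wle_srefK/Mm.2; rewrite mk.
exists k => //; split=> //; apply: (IH _ wmk); first by rewrite -ltnS -mk ltnW.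
by move=> p; rewrite srefKl => /Mm.2; rewrite mk => /ltnW.
Qed.

(** The letters of a dihedral subgroup are peeled off [M'] alternately for as long as they shorten
    it. Throughout, [a_i *m wordmx A s] is a nonnegative combination of [a_x] and [a_y], so the
    chain may stop as soon as [M'] keeps both of these nonnegative. *)
Lemma dihedral_chain f i (M : 'M[rat]_r) s x y (M' : 'M[rat]_r) m (p q : int) :
  M = wordmx A s *m M' -> wmin M' m -> (size s + m = n)%N -> (0 < size s)%N ->
  (forall k, wle (s_ i *m M) k -> (n <= k)%N) ->
  a_ i *m wordmx A s = p%:~R *: a_ x + q%:~R *: a_ y ->
  nneg (a_ x *m M') -> dihedral_nonneg f (- A y x) (- A x y) p q ->
  nneg (a_ i *m M).
Proof.
elim: f s x y M' m p q => // f IHf s x y M' m p q eM mM' sm s0 hi az nx.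
case/and3P=> p0 q0 hg.
have mn : (m < n)%N by lia.
have [ny|[m' em [mM'' ny]]] := descend y mn mM'.
  rewrite eM mulmxA az mulmxDl -!scalemxAl.
  by apply: nnegD; apply: nnegZ => //; rewrite ler0z.
(* If the word carries [a_i] to [a_y], then it carries [s_i] to [s_y]; so [s_i M] loses the letter
   [y] of [M'] and is shorter than [M], against the hypothesis. *)
have [/andP[/eqP ep /eqP eq]|nend] := boolP ((p == 0) && (q == 1)).
  move: az; rewrite ep eq scale0r add0r scale1r => az.
  have e := sref_conj (word_in CD s) az.
  have : wle (s_ i *m M) (size s + m').
    by rewrite eM mulmxA e -mulmxA; apply: wle_word mM''.1.
  by move=> /hi; lia.
rewrite (negPf nend) /= in hg.
apply: (IHf (rcons s y) y x (s_ y *m M') m' _ _ _ mM'' _ _ hi _ ny hg).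
- by rewrite wordmx_rcons // -mulmxA srefKl.
- by rewrite size_rcons; lia.
- by rewrite size_rcons.
rewrite wordmx_rcons // mulmxA az mulmxDl -!scalemxAl (sref_simple CD) srefE.
rewrite (cp_simple A); apply/rowP => k; rewrite !mxE !rmorphB !rmorphM !rmorphN /=; ring.
Qed.
End Step.

(** Strong induction on the length: the first letter [l] of a reduced word of [M] starts the chain
    in the subgroup generated by [s_i] and [s_l]. *)
Lemma longer_nneg n M i : wmin M n ->
  (forall k, wle (s_ i *m M) k -> (n <= k)%N) -> nneg (a_ i *m M).
Proof.
elim/ltn_ind: n M i => n IH M i mM hi.
have [[t tn eM] minM] := mM; case: t tn eM => [_ <-|l t tn eM].
  by rewrite mulmx1 nneg_simple.
have n0 : (0 < n)%N by apply: leq_trans tn.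
have mM1 : wmin (wordmx A t) n.-1.
  split; first by exists t => //; rewrite -ltnS prednK.
  by move=> m /(wle_sref l); rewrite -[_ *m _]/(wordmx A (l :: t)) eM => /minM; lia.
have IH' : forall m M j, (m < n)%N -> wmin M m ->
  (forall k, wle (s_ j *m M) k -> (m <= k)%N) -> nneg (a_ j *m M).
  by move=> m N j mn; apply: IH.
have nil : i != l.
  apply/eqP => e; have := hi n.-1; rewrite -eM /= e srefKl => /(_ mM1.1); lia.
apply: (dihedral_chain IH' (s := [:: l]) (x := l) (y := i) _ mM1 _ _ hi _ _ (good_cartan nil)) => //=.
- by rewrite -eM mulmx1.
- by lia.
- rewrite mulmx1 srefE (cp_simple A); apply/rowP => k; rewrite !mxE rmorphN /=; ring.
apply: (IH _ _ _ _ mM1); first by lia.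
move=> k; rewrite -[_ *m _]/(wordmx A (l :: t)) eM => /minM; lia.
Qed.

Lemma root_sign g : g \in R -> nneg g \/ nneg (- g).
Proof.
move=> /rootsP[i [M /(inWs CD)[s <-] ->]].
have [n _ mM] := wmin_ex s.
have [h|h] := classic (forall k, wle (s_ i *m wordmx A s) k -> (n <= k)%N).
  by left; apply: longer_nneg h.
right; have [k hk] := not_all_ex_not _ _ h.
have [wk /negP] := imply_to_and _ _ hk.
rewrite -ltnNge => kn.
have [t ts et] := wk; have [m mt mM'] := wmin_ex t.
rewrite -mulNmx -(sref_simple CD) -mulmxA -et; apply: (longer_nneg mM').
move=> p; rewrite et srefKl => /mM.2 np.
by apply: leq_trans np; lia.
Qed.
End Positivity.

(** * Positive roots, dominance, inversions and the vector rho *)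

Section Roots.
Variables (r : nat) (A : 'M[int]_r) (d : 'rV[rat]_r) (Ws : seq 'M[rat]_r).
Hypothesis CD : cartan_datum A d Ws.

Local Notation V := 'rV[rat]_r.
Local Notation a_ i := (simple_root i).
Local Notation s_ i := (sref A i).
Local Notation R := (rootsW Ws).
Local Notation Rp := (posroots Ws).
Local Notation cp := (spair A).
Local Notation bf := (bform A d).
Local Notation rho := (rho Ws).

Lemma posP g : (g \in Rp) = (g \in R) && nneg g.
Proof. by rewrite mem_filter andbC. Qed.
Lemma pos_root g : g \in Rp -> g \in R. Proof. by rewrite posP => /andP[]. Qed.
Lemma pos_nneg g : g \in Rp -> nneg g. Proof. by rewrite posP => /andP[]. Qed.
Lemma pos_uniq : uniq Rp. Proof. exact/filter_uniq/root_uniq. Qed.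
Lemma pos_simple i : a_ i \in Rp.
Proof. by rewrite posP (simple_root_in CD) nneg_simple. Qed.

Lemma root_pos g : g \in R -> (g \in Rp) (+) (- g \in Rp).
Proof.
move=> gR; rewrite !posP gR (rootNE CD) gR /=.
case: (boolP (nneg g)) => [p|np]; last first.
  by have [p|->//] := root_sign CD gR; rewrite p in np.
apply/negP => n; move: (root_neq0 CD gR).
by rewrite (nneg_anti p n) eqxx.
Qed.
Lemma root_negE g : g \in R -> (- g \in Rp) = (g \notin Rp).
Proof. by move=> /root_pos; case: (g \in Rp); case: (- g \in Rp). Qed.
Lemma root_nnegN g : g \in R -> nneg (- g) = (g \notin Rp).
Proof. by move=> gR; rewrite -root_negE // posP (rootNE CD) gR. Qed.

Lemma nneg_coord_gt0 (v : V) j : nneg v -> v 0 j != 0 -> 0 < v 0 j.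
Proof. by move=> /nnegP p n; rewrite lt_neqAle eq_sym n p. Qed.

Lemma sref_coord i j (v : V) : j != i -> (v *m s_ i) 0 j = v 0 j.
Proof.
by move=> nji; rewrite srefE 2!mxE [X in - X]mxE simpleE eq_sym (negPf nji) mulr0 subr0.
Qed.

Lemma pos_other g i : g \in Rp -> g != a_ i -> exists2 j, j != i & 0 < g 0 j.
Proof.
move=> gp ne; have gR := pos_root gp; have gn := pos_nneg gp.
have [[j ji gj]|h] := classic (exists2 j, j != i & g 0 j != 0).
  by exists j => //; apply: nneg_coord_gt0.
have eg : g = g 0 i *: a_ i.
  apply/rowP => j; rewrite [RHS]mxE simpleE.
  have [<-|nij] := eqVneq i j; first by rewrite mulr1.
  by rewrite mulr0; apply/eqP/negPn/negP => gj; apply: h; exists j; rewrite // eq_sym.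
have [e|e] := root_prop CD gR (simple_root_in CD i) eg.
  by rewrite e eqxx in ne.
move: (root_nnegN (simple_root_in CD i)).
by rewrite -e gn pos_simple.
Qed.

(** [s_i] changes only the coordinate [i], so some positive coordinate of [g] survives, and one
    positive coordinate makes a root positive. *)
Lemma pos_sref g i : g \in Rp -> g != a_ i -> g *m s_ i \in Rp.
Proof.
move=> gp ne; have [j ji gj] := pos_other gp ne.
have gsR : g *m s_ i \in R by apply: (root_sref CD); apply: pos_root.
apply: contraT; rewrite -root_nnegN // => /nnegP/(_ j).
by rewrite mxE sref_coord // oppr_ge0 leNgt gj.
Qed.

Lemma perm_rem_sref i :
  perm_eq [seq g *m s_ i | g <- rem (a_ i) Rp] (rem (a_ i) Rp).
Proof.
have inj : injective (fun g : V => g *m s_ i).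
  by move=> u v; apply: (W_inj CD (Ws_sref CD i)).
apply: uniq_perm; rewrite ?map_inj_uniq ?rem_uniq ?pos_uniq //.
move=> g; rewrite mem_rem_uniq ?pos_uniq // inE /=; apply/mapP/andP.
  case=> b; rewrite mem_rem_uniq ?pos_uniq // inE /= => /andP[bi bp] ->.
  split; last exact: pos_sref.
  apply: contraL bp => /eqP e; rewrite -(srefK CD i b) e (sref_simple CD).
  by rewrite root_negE ?(simple_root_in CD) ?pos_simple.
case=> gi gp; exists (g *m s_ i); last by rewrite (srefK CD).
rewrite mem_rem_uniq ?pos_uniq // inE /= pos_sref // andbT.
apply: contraL gp => /eqP e; rewrite -(srefK CD i g) e (sref_simple CD).
by rewrite root_negE ?(simple_root_in CD) ?pos_simple.
Qed.

Lemma perm_pos_simple i : perm_eq Rp (a_ i :: rem (a_ i) Rp).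
Proof. exact/perm_to_rem/pos_simple. Qed.

Lemma rho2 : \sum_(g <- Rp) g = 2 *: rho.
Proof. by rewrite /rho scalerA mulfV ?scale1r. Qed.

Lemma rho_sref i : rho *m s_ i = rho - a_ i.
Proof.
have : 2 *: (rho *m s_ i) = 2 *: (rho - a_ i) :> V; last first.
  by move/(scalerI (a := 2)); apply.
rewrite scalemxAl -rho2 mulmx_suml (perm_big _ (perm_pos_simple i)) big_cons.
rewrite -[\sum_(j <- _) _](big_map (fun g => g *m s_ i) xpredT id).
rewrite (perm_big _ (perm_rem_sref i)) /= (sref_simple CD) scalerBr -rho2.
rewrite (perm_big _ (perm_pos_simple i)) big_cons.
by apply/rowP => j; rewrite !mxE; ring.
Qed.

Lemma cp_rho i : cp i rho = 1.
Proof.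
have := rho_sref i; rewrite srefE => /addrI/oppr_inj.
move=> /rowP/(_ i); rewrite [LHS]mxE simpleE eqxx mulr1; exact.
Qed.

Lemma nneg_addl_eq0 (u v : V) : nneg u -> nneg v -> u + v = 0 -> u = 0.
Proof.
move=> nu nv /eqP; rewrite addr_eq0 => /eqP e; apply: nneg_anti nu _.
by rewrite e opprK.
Qed.

(** Induction along reduced words: the premise [nneg (a_i *m M)] records that [s_i] lengthens
    [M]. *)
Lemma W_ind (P : 'M[rat]_r -> Prop) : P 1%:M ->
  (forall i M, M \in Ws -> nneg (a_ i *m M) -> P M -> P (s_ i *m M)) ->
  forall M, M \in Ws -> P M.
Proof.
move=> P1 PS M /(inWs CD)[s <-]; have [n _ mM] := wmin_ex A s.
elim/ltn_ind: n {s}(wordmx A s) mM => n IH N [[[|l t] tn eN] minN].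
  by rewrite -eN.
have mt : wmin A (wordmx A t) n.-1.
  split; first by exists t => //; rewrite /= in tn; lia.
  by move=> m /(wle_sref l); rewrite -[_ *m _]/(wordmx A (l :: t)) eN => /minN; lia.
rewrite -eN /=; apply: PS; first exact: word_in CD t.
  apply: (longer_nneg CD mt) => k.
  by rewrite -[_ *m _]/(wordmx A (l :: t)) eN => /minN; lia.
by apply: IH mt; rewrite /= in tn; lia.
Qed.

Definition dominant (v : V) : bool := [forall i, 0 <= cp i v].
Local Notation dom := dominant.
Lemma domP v : reflect (forall i, 0 <= cp i v) (dom v).
Proof. exact: forallP. Qed.
Lemma dom_rho : dom rho.
Proof. by apply/domP => i; rewrite cp_rho. Qed.

Lemma dom_le v M : dom v -> M \in Ws -> nneg (v - v *m M).
Proof.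
move=> /domP dv MW; elim/W_ind: M / MW => [|i M MW ni IH].
  by rewrite mulmx1 subrr nneg0.
rewrite mulmxA srefE mulmxBl -scalemxAl opprB addrA addrAC.
by apply: nnegD => //; apply: nnegZ.
Qed.

Lemma dom_uniq v M : dom v -> dom (v *m M) -> M \in Ws -> v *m M = v.
Proof.
move=> dv dvM MW; apply/eqP; rewrite eq_sym -subr_eq0; apply/eqP/nneg_anti.
  exact: dom_le.
by rewrite opprB -{2}(WK CD v MW) dom_le // (WsV CD).
Qed.

Lemma rho_fix M : M \in Ws -> rho *m M = rho -> M = 1%:M.
Proof.
move=> MW; elim/W_ind: M / MW => // i M MW ni _.
rewrite mulmxA rho_sref mulmxBl => e.
have e0 : a_ i *m M + (rho - rho *m M) = 0.
  by rewrite -{1}e; apply/rowP => j; rewrite !mxE; ring.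
have {}e0 := nneg_addl_eq0 ni (dom_le dom_rho MW) e0.
have := simple_neq0 i.
by rewrite -(WK CD (a_ i) MW) e0 mul0mx eqxx.
Qed.

Definition ninv (M : 'M[rat]_r) : nat := count (fun b => nneg (- (b *m M))) Rp.
Local Notation nv := ninv.

Lemma nneg_simpleN i M : M \in Ws -> nneg (- (a_ i *m M)) = ~~ nneg (a_ i *m M).
Proof.
move=> MW; have aR : a_ i *m M \in R by rewrite (rootWE CD) // (simple_root_in CD).
by rewrite root_nnegN // posP aR.
Qed.

Lemma nv_sref i M : M \in Ws ->
  (nv (s_ i *m M) + ~~ nneg (a_ i *m M) = nv M + nneg (a_ i *m M))%N.
Proof.
move=> MW; rewrite /ninv !(permP (perm_pos_simple i)) /= mulmxA (sref_simple CD).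
rewrite mulNmx opprK nneg_simpleN //.
have -> : count (fun b => nneg (- (b *m (s_ i *m M)))) (rem (a_ i) Rp) =
          count (fun b => nneg (- (b *m M))) (rem (a_ i) Rp).
  rewrite -[RHS](permP (perm_rem_sref i)) count_map; apply: eq_count => b /=.
  by rewrite mulmxA.
by case: (nneg (a_ i *m M)); rewrite /= ?addn0 ?add0n ?addn1 ?add1n.
Qed.

(** The sign through inversions, for which multiplicativity is easy; [wsign_eps] identifies it with
    the sign of the statement, which is defined through minimal words. *)
Definition sgnW (M : 'M[rat]_r) : int := (-1) ^+ nv M.
Local Notation eps := sgnW.

Lemma eps_sref i M : M \in Ws -> eps (s_ i *m M) = - eps M.
Proof.
move=> MW; have := nv_sref i MW; rewrite /sgnW; case: (nneg _) => /= e.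
  have -> : nv (s_ i *m M) = (nv M).+1 by lia.
  by rewrite exprS mulN1r.
have -> : nv M = (nv (s_ i *m M)).+1 by lia.
by rewrite exprS mulN1r opprK.
Qed.

Lemma nv1 : nv 1%:M = 0%N.
Proof.
apply/eqP; rewrite -leqn0 leqNgt -has_count -all_predC; apply/allP => b bp /=.
by rewrite mulmx1 root_nnegN ?pos_root // bp.
Qed.

Lemma eps_word s : eps (wordmx A s) = (-1) ^+ size s.
Proof.
elim: s => [|i s IH] /=; first by rewrite /sgnW nv1.
by rewrite eps_sref ?(word_in CD) // IH exprS mulN1r.
Qed.

Lemma epsM M N : M \in Ws -> N \in Ws -> eps (M *m N) = eps M * eps N.
Proof.
move=> /(inWs CD)[s <-] /(inWs CD)[t <-].
by rewrite -wordmx_cat !eps_word size_cat exprD.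
Qed.

Lemma eps_srefr i M : M \in Ws -> eps (M *m s_ i) = - eps M.
Proof.
move=> MW; rewrite epsM ?(Ws_sref CD) // -[s_ i]mulmx1 eps_sref ?(W1 CD) //.
by rewrite /sgnW nv1 mulrN1.
Qed.

Lemma wsign_eps M : M \in Ws -> wsign A M = eps M.
Proof.
move=> /(inWs CD)[s <-]; rewrite /wsign /wlength.
set P := fun n => _; have [n _ [[t tn et] mn]] := wmin_ex A s.
have Pn : P n.
  split=> [|u eu]; last by apply: mn; exists u.
  exists t; split=> //; apply/eqP; rewrite eqn_leq tn /=.
  by apply: mn; exists t.
have [[u [su eu]] _] := epsilon_spec (inhabits 0%N) P (ex_intro _ n Pn).
by rewrite -su -eps_word eu.
Qed.

Lemma eps1 : eps 1%:M = 1. Proof. by rewrite /sgnW nv1. Qed.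
Lemma epsV M : M \in Ws -> eps (invmx M) = eps M.
Proof.
move=> MW; have := epsM MW (WsV CD MW).
rewrite mulmxV ?(Ws_unit CD) // eps1 {2}/eps => e.
by rewrite -[LHS]mul1r -(sqrr_sign _ (nv M)) expr2 -mulrA -[X in _ * X]e mulr1.
Qed.

Definition absroot (v : V) : V := if v \in Rp then v else - v.
Local Notation absr := absroot.

Lemma absr_pos M b : M \in Ws -> b \in Rp -> nneg (- (b *m M)) = false -> absr (b *m M) = b *m M.
Proof.
move=> MW bp; rewrite root_nnegN ?(rootWE CD) ?pos_root // /absroot.
by case: (_ \in _).
Qed.
Lemma absr_neg M b : M \in Ws -> b \in Rp -> nneg (- (b *m M)) -> absr (b *m M) = - (b *m M).
Proof.
by move=> MW bp; rewrite root_nnegN ?(rootWE CD) ?pos_root // /absroot => /negPf->.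
Qed.

Lemma perm_absW M : M \in Ws -> perm_eq [seq absr (b *m M) | b <- Rp] Rp.
Proof.
move=> MW; apply: uniq_perm; rewrite ?pos_uniq //.
  rewrite map_inj_in_uniq ?pos_uniq // => b c bp cp.
  have aux x y : x \in Rp -> y \in Rp -> x *m M != - (y *m M).
    move=> xp yp; apply/eqP; rewrite -mulNmx => /(W_inj CD MW) e.
    by have := root_negE (pos_root yp); rewrite -e xp yp.
  rewrite /absroot; case: ifP => _; case: ifP => _ /eqP.
  - by move=> /eqP/(W_inj CD MW).
  - by rewrite (negPf (aux _ _ bp cp)).
  - by rewrite eq_sym (negPf (aux _ _ cp bp)).
  by rewrite eqr_opp => /eqP/(W_inj CD MW).
move=> g; rewrite /absroot; apply/mapP/idP => [[b bp ->]|gp].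
  have bR : b *m M \in R by rewrite (rootWE CD) // pos_root.
  by case: ifP => // /negbT; rewrite root_negE.
have gR : g *m invmx M \in R by rewrite (rootWE CD) ?(WsV CD) // pos_root.
have [p|n] := boolP (g *m invmx M \in Rp).
  by exists (g *m invmx M); rewrite // (WVK CD) // gp.
exists (- (g *m invmx M)); first by rewrite root_negE.
by rewrite mulNmx (WVK CD) // opprK root_negE ?pos_root // gp.
Qed.

(** [2 rho] is also the sum of the roots [absr (b *m M)]; subtracting [2 rho *m M] leaves twice the
    opposites of the images that became negative. *)
Lemma rho_sub_neg M : M \in Ws ->
  rho - rho *m M = \sum_(b <- Rp | nneg (- (b *m M))) - (b *m M).
Proof.
move=> MW; apply: (scalerI (a := 2)) => //.
rewrite scalerBr scalemxAl -rho2 mulmx_suml -{1}(perm_big _ (perm_absW MW)) big_map.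
rewrite -sumrB [in RHS]big_mkcond scaler_sumr; apply: eq_big_seq => b bp.
case: ifPn => h; first by rewrite absr_neg // scaler_nat mulr2n.
by rewrite absr_pos ?(negPf h) // subrr scaler0.
Qed.

Lemma rho_sub M : M \in Ws ->
  rho - rho *m M = \sum_(b <- Rp | nneg (- (b *m invmx M))) b.
Proof.
move=> MW; have := rho_sub_neg (WsV CD MW).
move=> /(congr1 (mulmx^~ M)); rewrite mulmxBl (WVK CD) // mulmx_suml => e.
rewrite -opprB e -sumrN; apply: eq_bigr => b _.
by rewrite mulNmx (WVK CD) // opprK.
Qed.

Lemma rho_le M : M \in Ws -> nneg (rho - rho *m M).
Proof. exact: dom_le dom_rho. Qed.

(** Write [v = p - n] with [p] and [n] nonnegative of disjoint supports. Then [(p, v) <= 0] and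
    [(p, n) <= 0], so [(p, p) <= 0] and [p = 0]. *)
Lemma antidom_le (v : V) : (forall i, cp i v <= 0) -> nneg (- v).
Proof.
move=> h; pose p : V := \row_i (if 0 <= v 0 i then v 0 i else 0).
pose n : V := \row_i (if 0 <= v 0 i then 0 else - v 0 i).
have ev : v = p - n.
  by apply/rowP => i; rewrite !mxE; case: ifP => _; rewrite ?subr0 // sub0r opprK.
have pp : nneg p by apply/nnegP => i; rewrite mxE; case: ifP.
have nn : nneg n.
  by apply/nnegP => i; rewrite mxE; case: ifPn; rewrite // -ltNge oppr_ge0 => /ltW.
have pv : bf p v <= 0.
  apply: sumr_le0 => i _; rewrite mulr_ge0_le0 ?h // mulr_ge0 //; first exact/nnegP.
  exact/ltW/(symm_gt0 CD).
have pn : bf p n <= 0.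
  rewrite bfE; apply: sumr_le0 => i _; apply: sumr_le0 => j _.
  have [<-|nij] := eqVneq i j.
    by rewrite !mxE; case: ifP => _; rewrite ?mulr0 ?mul0r.
  rewrite mulr_le0_ge0 //; last exact/nnegP.
  rewrite mulr_ge0_le0 ?mulr_ge0 //; first exact/nnegP.
    exact/ltW/(symm_gt0 CD).
  by rewrite lerz0 (cartan_offdiag CD).
have p0 : p = 0.
  apply: (bf_eq0 CD); apply/eqP; rewrite eq_le (bf_ge0 CD) andbT.
  have -> : bf p p = bf p v + bf p n.
    by rewrite -(bfDr CD); congr (bf p _); rewrite ev subrK.
  by rewrite -(addr0 0) lerD.
by rewrite ev p0 sub0r opprK.
Qed.

Lemma nneg_cp_gt0 (v : V) : nneg v -> v != 0 -> exists2 i, 0 < cp i v & 0 < v 0 i.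
Proof.
move=> nn nz.
have [[i hi vi]|h] := classic (exists2 i, 0 < cp i v & 0 < v 0 i); first by exists i.
have := bf_gt0 CD nz; rewrite ltNge => /negP[].
apply: sumr_le0 => i _; have [vi|vi] := eqVneq (v 0 i) 0; first by rewrite vi !mul0r.
have vi0 := nneg_coord_gt0 nn vi.
rewrite pmulr_rle0 ?mulr_gt0 ?(symm_gt0 CD) // leNgt.
by apply/negP => ci; apply: h; exists i.
Qed.

End Roots.

Lemma int_ge1 (x : rat) : x \is a Num.int -> 0 < x -> 1 <= x.
Proof. by move=> /intrP[m ->]; rewrite ltr0z ler1z. Qed.

Lemma seq_max (T : eqType) (f : T -> rat) (s : seq T) : s != [::] ->
  exists2 x, x \in s & forall y, y \in s -> f y <= f x.
Proof.
elim: s => // x s IH _; have [->|/IH[y ys hy]] := eqVneq s [::].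
  by exists x => [|y]; rewrite inE // => /eqP->.
have [xy|/ltW yx] := leP (f x) (f y).
  by exists y => [|z]; rewrite inE ?ys ?orbT // => /orP[/eqP->//|/hy].
exists x => [|z]; rewrite inE ?eqxx // => /orP[/eqP->//|/hy zy].
exact: le_trans yx.
Qed.

(** Agrees with [ht] on the integral vectors of the positive cone ([nhtE]), and is used only
    there. *)
Definition nht (r : nat) (v : 'rV[rat]_r) : nat := absz (numq (ht v)).

(** * Pairs of roots and their lengths *)

Section RootPairs.
Variables (r : nat) (A : 'M[int]_r) (d : 'rV[rat]_r) (Ws : seq 'M[rat]_r).
Hypothesis CD : cartan_datum A d Ws.

Local Notation V := 'rV[rat]_r.
Local Notation a_ i := (simple_root i).
Local Notation R := (rootsW Ws).
Local Notation Rp := (posroots Ws).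
Local Notation cp := (spair A).
Local Notation bf := (bform A d).
Local Notation pr := (cartan_int A d).
Local Notation dom := (dominant A).

Lemma root_cauchy g e : g \in R -> e \in R -> g != e -> g != - e ->
  bf g e ^+ 2 < bf g g * bf e e.
Proof.
move=> gR eR n1 n2; apply: (cauchy CD); first exact: (root_neq0 CD).
move=> c; apply/eqP => /(root_prop CD gR eR)[] /eqP; first by rewrite (negPf n1).
by rewrite (negPf n2).
Qed.

Lemma pr_lt4 g e : g \in R -> e \in R -> g != e -> g != - e ->
  pr g e * pr e g < 4.
Proof.
move=> gR eR n1 n2; have h := root_cauchy gR eR n1 n2.
have g0 := root_bf_gt0 CD gR; have e0 := root_bf_gt0 CD eR.
have -> : pr g e * pr e g = 4 * (bf g e ^+ 2 / (bf g g * bf e e)).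
  by rewrite /cartan_int (bfC CD e g); field; rewrite !gt_eqF.
by rewrite gtr_pMr // ltr_pdivrMr ?mulr_gt0 // mul1r.
Qed.

Lemma root_int_pr g e : g \in R -> e \in R -> pr g e \is a Num.int.
Proof. by move=> gR eR; apply: (pr_int CD) => //; apply: (root_int CD). Qed.

Lemma prE g e : e \in R -> 2 * bf g e = pr g e * bf e e.
Proof. by move=> /(root_bf_gt0 CD)/gt_eqF/negbT h; rewrite /cartan_int mulfVK. Qed.

Lemma pr_gt0 g e : e \in R -> (0 < pr g e) = (0 < bf g e).
Proof.
by move=> eR; rewrite /cartan_int pmulr_lgt0 ?invr_gt0 ?(root_bf_gt0 CD) // pmulr_rgt0.
Qed.

(** The two Cartan integers are positive with product below 4, so one of them is 1, and the
    corresponding reflection produces the difference up to sign. *)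
Lemma root_diff g e : g \in R -> e \in R -> 0 < bf g e -> g != e -> g - e \in R.
Proof.
move=> gR eR ge n1.
have n2 : g != - e.
  apply: contraTneq ge => ->; rewrite bfNl oppr_gt0 -leNgt.
  exact: (bf_ge0 CD).
have h := pr_lt4 gR eR n1 n2.
have p1 := int_ge1 (root_int_pr gR eR); rewrite pr_gt0 // ge in p1.
have p2 := int_ge1 (root_int_pr eR gR).
rewrite pr_gt0 // (bfC CD) ge in p2.
have [e1|/eqP e1] := eqVneq (pr g e) 1.
  by have := refl_root CD gR eR; rewrite e1 scale1r.
have [e2|/eqP e2] := eqVneq (pr e g) 1.
  by rewrite -(rootNE CD) opprB; have := refl_root CD eR gR; rewrite e2 scale1r.
have /intrP[m em] := root_int_pr gR eR; have /intrP[n en] := root_int_pr eR gR.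
move: p1 p2 h e1 e2; rewrite em en !ler1z -intrM.
rewrite -[4]/(4%:~R) ltr_int => p1 p2 h e1 e2.
have m1 : m <> 1 by move=> x; apply: e1; rewrite x.
have n1' : n <> 1 by move=> x; apply: e2; rewrite x.
exfalso; move: (p1 isT) (p2 isT); clear -h m1 n1'; nia.
Qed.

(** The Cartan integer of [u + e] with respect to [e] is at least 2, so the opposite one is 1:
    [2 (e, u + e) = (u + e, u + e)]. Expanding this gives both claims. *)
Lemma len_add u e : u \in R -> e \in R -> u + e \in R -> 0 <= bf u e ->
  bf u u = bf e e /\ 2 * bf u u <= bf (u + e) (u + e).
Proof.
move=> uR eR ueR ue; have e0 := root_bf_gt0 CD eR.
have c0 : 0 < bf (u + e) e by rewrite bfDl ltr_wpDl.
have n1 : u + e != e by rewrite -subr_eq0 addrK (root_neq0 CD).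
have n2 : u + e != - e.
  by apply: contraTneq c0 => ->; rewrite bfNl oppr_gt0 -leNgt ltW.
have h := pr_lt4 ueR eR n1 n2.
have p2 := int_ge1 (root_int_pr eR ueR).
rewrite pr_gt0 // (bfC CD) c0 in p2.
have p1 : 2 <= pr (u + e) e.
  by rewrite /cartan_int bfDl ler_pdivlMr //; lra.
have e2 : pr e (u + e) = 1.
  have /intrP[n en] := root_int_pr eR ueR.
  have n1' : (1 <= n)%R by have := p2 isT; rewrite en ler1z.
  have [e1|nn] := eqVneq n 1; first by rewrite en e1.
  have n2' : 2 <= n by clear -n1' nn; lia.
  have : 2 <= pr e (u + e) by rewrite en -[2]/(2%:~R) ler_int.
  by move: h p1; nra.
have := prE e ueR; rewrite e2 mul1r (bfC CD) => e3.
have := prE (u + e) eR; move: p1 e3; rewrite !(bfDl, bfDr CD) (bfC CD e u) => p1.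
by move=> e3 e4; split; nra.
Qed.

(** The product of the Cartan integers is the square of the nonzero integer [pr e u] times the ratio
    of the squared lengths, and would be at least 4. *)
Lemma len4 u e : u \in R -> e \in R -> bf u e != 0 -> 4 * bf e e <= bf u u -> False.
Proof.
move=> uR eR ue le; have e0 := root_bf_gt0 CD eR.
have /andP[n1 n2] : (u != e) && (u != - e).
  apply/andP; split; apply: contraTneq le => ->.
    by rewrite -ltNge; lra.
  by rewrite bfNl (bfNr CD) opprK -ltNge; lra.
have h := pr_lt4 uR eR n1 n2.
have u0 := root_bf_gt0 CD uR.
have /intrP[n en] := root_int_pr eR uR.
have n0 : n != 0.
  apply: contraNneq ue => n0; have := prE e uR; rewrite en n0 mul0r => /eqP.
  by rewrite mulf_eq0 (bfC CD) => /orP[].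
have nn : 1 <= pr e u ^+ 2.
  by rewrite en -rmorphXn /= ler1z; nia.
have e1 := prE u eR; have e2 := prE e uR.
rewrite (bfC CD e u) e1 in e2.
have : pr u e * pr e u * bf e e = pr e u ^+ 2 * bf u u.
  by rewrite expr2 -mulrA [_ * bf e e]mulrC mulrCA -[in RHS]mulrA -e2; ring.
nra.
Qed.

Lemma root_dom g : g \in R -> exists2 M, M \in Ws & dom (g *m M).
Proof.
move=> gR; have Wn : Ws != [::] by apply/eqP => e; have := W1 CD; rewrite e.
have [M MW hM] := seq_max (fun M : 'M_r => ht (g *m M)) Wn.
exists M => //; apply/domP => i; have := hM _ (WsM CD MW (Ws_sref CD i)).
by rewrite mulmxA srefE htB htZ ht_simple mulr1 gerBl.
Qed.

Lemma int_ht (v : V) : intv v -> ht v \is a Num.int.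
Proof. by move=> iv; apply: rpred_sum => i _; apply: iv. Qed.

Lemma nhtE (v : V) : intv v -> nneg v -> (nht v)%:R = ht v.
Proof.
move=> iv nv; have := ht_ge0 nv; rewrite /nht; have /intrP[m ->] := int_ht iv.
by rewrite numq_int ler0z => m0; rewrite -[in RHS](gez0_abs m0).
Qed.

Lemma pos_int g : g \in Rp -> intv g.
Proof. by move=> gp; apply: (root_int CD); apply: pos_root. Qed.

Lemma pos_nht g : g \in Rp -> (nht g)%:R = ht g.
Proof. by move=> gp; apply: nhtE; [exact: pos_int|exact: pos_nneg gp]. Qed.

Lemma nht_gt0 g : g \in Rp -> (0 < nht g)%N.
Proof.
move=> gp; rewrite -(ltr0n rat) pos_nht //.
by apply: ht_gt0; [exact: pos_nneg gp|exact: (root_neq0 CD (pos_root gp))].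
Qed.

Lemma nht_simple i : nht (a_ i : V) = 1%N.
Proof. by rewrite /nht ht_simple. Qed.

Lemma nhtD (u v : V) : intv u -> intv v -> nneg u -> nneg v -> nht (u + v) = (nht u + nht v)%N.
Proof.
move=> iu iv nu nv; apply/eqP; rewrite -(eqr_nat rat) natrD !nhtE ?htD //.
  exact: intvD.
exact: nnegD.
Qed.

Lemma nneg_sub_simple (v : V) i : intv v -> nneg v -> 0 < v 0 i -> nneg (v - a_ i).
Proof.
move=> iv /nnegP nv vi; apply/nnegP => j; rewrite mxE [X in _ + X]mxE simpleE.
by have [<-|_] := eqVneq i j; rewrite ?subr0 // subr_ge0 int_ge1.
Qed.

Lemma pos_lower g : g \in Rp -> exists2 i, 0 < cp i g &
  g = a_ i \/ g - a_ i \in Rp.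
Proof.
move=> gp; have gR := pos_root gp; have gn := pos_nneg gp.
have [i ci gi] := nneg_cp_gt0 CD gn (root_neq0 CD gR).
exists i => //; have [->|ng] := eqVneq g (a_ i); [by left|right].
rewrite posP nneg_sub_simple ?andbT //; last exact: pos_int.
apply: root_diff ng => //; first exact: (simple_root_in CD).
by rewrite (bfC CD) bf_simple mulr_gt0 // (symm_gt0 CD).
Qed.

Lemma nht1_simple g : g \in Rp -> nht g = 1%N -> exists i, g = a_ i.
Proof.
move=> gp g1; have [i _ [->|h]] := pos_lower gp; first by exists i.
have := nhtD (pos_int h) (intv_simple i) (pos_nneg h) (nneg_simple i).
by rewrite subrK g1 nht_simple; have := nht_gt0 h; lia.
Qed.

Lemma dom_bf (u v : V) : nneg u -> dom v -> 0 <= bf u v.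
Proof.
move=> /nnegP nu /domP dv; apply: sumr_ge0 => i _; rewrite mulr_ge0 //.
by rewrite mulr_ge0 // ltW // (symm_gt0 CD).
Qed.

Lemma dom_pos n : n \in R -> dom n -> n \in Rp.
Proof.
move=> nR dn; apply: contraT; rewrite -(root_negE CD) // => np.
have := dom_bf (pos_nneg np) dn; rewrite bfNl oppr_ge0 leNgt.
by rewrite (root_bf_gt0 CD).
Qed.

(** * Roots above a fixed dominant root *)

Section Above.
Variable n : V.
Hypotheses (nR : n \in R) (dn : dom n).
Let np := dom_pos nR dn.

Lemma above_bf g : nneg (g - n) -> 0 < bf g n.
Proof.
move=> gn; rewrite -(subrK n g) bfDl ltr_wpDl ?(root_bf_gt0 CD) //.
exact: dom_bf.
Qed.

Lemma above_diff g : g \in R -> nneg (g - n) -> g != n -> g - n \in Rp.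
Proof. by move=> gR gn ne; rewrite posP gn andbT root_diff // above_bf. Qed.

Lemma above_len g : g \in R -> nneg (g - n) -> g != n ->
  bf n n = bf (g - n) (g - n) /\ 2 * bf n n <= bf g g.
Proof.
move=> gR gn ne; have dp := above_diff gR gn ne.
have := len_add nR (pos_root dp); rewrite [n + _]addrC subrK; apply=> //.
by rewrite (bfC CD) dom_bf // pos_nneg.
Qed.

(** The differences [g1 - n] and [g2 - n] have the length of [n], so by strict Cauchy-Schwarz their
    product exceeds [- (n, n)]. Hence [(g1, g2) > 0], and [g1 - g2] would be a root of height 0. *)
Lemma above_ht_inj g1 g2 : g1 \in R -> g2 \in R -> nneg (g1 - n) -> nneg (g2 - n) ->
  g1 != n -> g2 != n -> ht g1 = ht g2 -> g1 = g2.
Proof.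
move=> g1R g2R n1 n2 e1 e2 hh; apply/eqP/negPn/negP => ne.
have [d1 d2] := (above_diff g1R n1 e1, above_diff g2R n2 e2).
have [l1 _] := above_len g1R n1 e1; have [l2 _] := above_len g2R n2 e2.
have hd : g1 - n != - (g2 - n).
  apply/eqP => e; have := root_negE CD (pos_root d2); rewrite -e d1.
  by rewrite d2.
have hd' : g1 - n != g2 - n by rewrite (inj_eq (addIr _)).
have := root_cauchy (pos_root d1) (pos_root d2) hd' hd.
rewrite -l1 -l2 => hc.
have b1 : 0 <= bf (g1 - n) n by rewrite dom_bf ?pos_nneg.
have b2 : 0 <= bf (g2 - n) n by rewrite dom_bf ?pos_nneg.
have nn := root_bf_gt0 CD nR.
have gg : 0 < bf g1 g2.
  have -> : bf g1 g2 = bf (g1 - n) (g2 - n) + bf (g1 - n) n + bf (g2 - n) n + bf n n.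
    by rewrite !(bfBl, bfBr CD) (bfC CD n g2); ring.
  move: hc b1 b2 nn; move: (bf _ _) (bf (g1 - n) n) (bf (g2 - n) n) (bf n n) => x y z t.
  by nra.
have := root_diff g1R g2R gg ne => dR.
have [p|] := boolP (g1 - g2 \in Rp).
  by have := ht_gt0 (pos_nneg p) (root_neq0 CD dR); rewrite htB hh subrr ltxx.
rewrite -(root_negE CD) // => p.
have := ht_gt0 (pos_nneg p) (root_neq0 CD (pos_root p)).
by rewrite htN htB hh subrr oppr0 ltxx.
Qed.

Lemma above_lower g : g \in R -> nneg (g - n) -> g != n ->
  exists i, g - a_ i \in R /\ nneg (g - a_ i - n).
Proof.
move=> gR gn ne; have dp := above_diff gR gn ne.
have [i ci di] := nneg_cp_gt0 CD gn (root_neq0 CD (pos_root dp)).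
have nl : nneg (g - a_ i - n) by rewrite addrAC nneg_sub_simple //; exact: pos_int.
exists i; split=> //; apply: root_diff => //; first exact: (simple_root_in CD).
  rewrite (bfC CD) bf_simple mulr_gt0 ?(symm_gt0 CD) //.
  by rewrite -(subrK n g) cpD ltr_pwDl //; apply/domP.
apply/eqP => e; move: nl; rewrite e subrr sub0r (root_nnegN CD) // (np).
by [].
Qed.

Lemma above_exists g j : g \in R -> nneg (g - n) -> (j <= nht (g - n))%N ->
  exists b, [/\ b \in R, nneg (b - n) & nht (b - n) = j].
Proof.
have [k] := ubnP (nht (g - n)); elim: k g => // k IH g; rewrite ltnS => gk gR gn.
rewrite leq_eqVlt => /orP[/eqP->|jg]; first by exists g.
have ne : g != n by apply: contraTneq jg => ->; rewrite subrr /nht ht0.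
have [i [giR gin]] := above_lower gR gn ne.
have e : (nht (g - a_ i - n)).+1 = nht (g - n).
  have ii : intv (g - a_ i - n).
    by apply/intvD/intvN; apply: (root_int CD).
  have := nhtD ii (intv_simple i) gin (nneg_simple i).
  by rewrite nht_simple addn1 => <-; rewrite addrAC subrK.
by apply: (IH (g - a_ i)) => //; lia.
Qed.

(** The heights of the [g - n] are the integers from 1 to [ht (t - n)], each taken once:
    [above_ht_inj] excludes repetitions and [above_exists] gaps. *)
Lemma above_sum (K : pzRingType) (q : K) t : t \in R -> (forall a, a \in R -> nneg (t - a)) ->
  \sum_(g <- R | nneg (g - n) && (g != n)) q ^+ (nht (g - n)).-1 =
  \sum_(j < nht (t - n)) q ^+ j.
Proof.
move=> tR tmax; rewrite -big_filter.
rewrite -(big_map (fun g => (nht (g - n)).-1) xpredT (fun j => q ^+ j)).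
rewrite -(big_mkord xpredT (fun j => q ^+ j)); apply: perm_big.
have dif g : g \in [seq g <- R | nneg (g - n) && (g != n)] ->
  [/\ g \in R, nneg (g - n), g != n & g - n \in Rp].
  by rewrite mem_filter => /andP[/andP[? ?] ?]; split=> //; apply: above_diff.
apply: uniq_perm; rewrite ?iota_uniq //.
  rewrite map_inj_in_uniq ?filter_uniq ?root_uniq // => g1 g2 /dif[r1 n1 e1 p1] /dif[r2 n2 e2 p2] e.
  apply: above_ht_inj => //; apply: (addIr (ht (- n))); rewrite -!htD.
  rewrite -!pos_nht //; congr (_%:R).
  by rewrite -(prednK (nht_gt0 p1)) e prednK // nht_gt0.
move=> j; rewrite mem_index_iota /=; apply/mapP/idP => [[g /dif[gR gn gne gp] ->]|jt].
  have tn : nneg (t - g) := tmax _ gR.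
  have := nhtD _ _ tn gn; rewrite addrA subrK => ->; last exact: pos_int.
    by apply: leq_trans (leq_addl _ _); rewrite prednK // nht_gt0.
  by apply/intvD/intvN; apply: (root_int CD).
have [b [bR bn ej]] := above_exists tR (tmax _ nR) jt.
exists b; last by rewrite ej.
rewrite mem_filter bR bn andbT /=; apply: contraTneq (ltn0Sn j) => eb.
by rewrite -ej eb subrr /nht ht0.
Qed.
End Above.
End RootPairs.

(** * Kostant's partition function *)

Section Partition.
Variable r : nat.
Local Notation V := 'rV[rat]_r.
Implicit Types (ps : seq V) (mu a : V) (N : nat).

(** Kostant's function by recursion on the list of roots. The bound [N] is a separate argument so
    that [mu] can vary while the bound stays; above the height of [mu] its value does not matter
    ([KL_ext]). *)
Fixpoint KL N ps mu : {poly int} :=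
  if ps is a :: ps' then \sum_(k < N) 'X^k * KL N ps' (mu - k%:R *: a)
  else (mu == 0)%:R.

Lemma KL_ffun N ps mu :
  \sum_(k : {ffun 'I_(size ps) -> 'I_N} |
          \sum_(j < size ps) (k j : nat)%:R *: ps`_j == mu)
     'X^(\sum_j (k j : nat))%N = KL N ps mu.
Proof.
elim: ps mu => [|a ps IH] mu /=.
  have k0 : {ffun 'I_0 -> 'I_N} by apply: finfun => -[].
  have uk (k : {ffun 'I_0 -> 'I_N}) : k = k0 by apply/ffunP => -[].
  have [->|ne] := eqVneq mu 0; last first.
    by rewrite big_pred0 // => k; rewrite big_ord0 eq_sym (negPf ne).
  rewrite (big_pred1 k0) => [|k]; first by rewrite big_ord0 expr0.
  by rewrite /= big_ord0 (uk k) !eqxx.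
pose h (p : 'I_N * {ffun 'I_(size ps) -> 'I_N}) : {ffun 'I_(size ps).+1 -> 'I_N} :=
  [ffun j => if unlift ord0 j is Some j' then p.2 j' else p.1].
have h0 p : h p ord0 = p.1 by rewrite ffunE unlift_none.
have hS p j : h p (lift ord0 j) = p.2 j by rewrite ffunE liftK.
rewrite (reindex h) /=; last first.
  exists (fun k : {ffun 'I_(size ps).+1 -> 'I_N} => (k ord0, [ffun j => k (lift ord0 j)])).
    move=> p _; rewrite h0; case: p => x f; congr (_, _).
    by apply/ffunP => j; rewrite ffunE hS.
  move=> k _; apply/ffunP => j; rewrite ffunE /=.
  by case: unliftP => [j' ->|->]; rewrite ?ffunE.
rewrite big_mkcond /=.
rewrite -(pair_bigA _ (fun x f => if \sum_(j < (size ps).+1) (h (x, f) j : nat)%:R *: (a :: ps)`_j == mu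
  then 'X^(\sum_j (h (x, f) j : nat)) else 0)) /=.
apply: eq_bigr => x _; rewrite -IH mulr_sumr [RHS]big_mkcond.
apply: eq_bigr => f _; rewrite !big_ord_recl h0 /=.
under eq_bigr => j _ do rewrite hS.
under [in X in 'X^(_ + X)%N]eq_bigr => j _ do rewrite hS.
by rewrite exprD [in RHS]eq_sym subr_eq [in RHS]eq_sym [in RHS]addrC.
Qed.

Lemma KL_nneg N ps mu : all (@nneg r) ps -> KL N ps mu != 0 -> nneg mu.
Proof.
elim: ps mu => [|a ps IH] mu /=.
  by move=> _; have [->|_] := eqVneq mu 0; rewrite ?nneg0 ?eqxx.
case/andP=> na nps; apply: contraNT => nmu; rewrite big1 // => k _.
apply/eqP; rewrite mulf_eq0 orbC; apply/orP; left; apply: contraNT nmu => /(IH _ nps) h.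
by rewrite -(subrK (k%:R *: a) mu) nnegD // nnegZ.
Qed.

Definition posht (a : V) := nneg a && (1 <= ht a).

Lemma posht_nneg ps : all posht ps -> all (@nneg r) ps.
Proof. by apply: sub_all => a /andP[]. Qed.

Lemma KL_ht0 N ps mu : all posht ps -> ht mu < 0 -> KL N ps mu = 0.
Proof.
move=> /posht_nneg hp hm; apply/eqP; apply: contraTT hm => /(KL_nneg hp)/ht_ge0.
by rewrite leNgt.
Qed.

Lemma ht_sub_mul N k mu a : posht a -> ht mu < N%:R -> (N <= k)%N ->
  ht (mu - k%:R *: a) < 0.
Proof.
move=> /andP[_ a1] hm Nk; rewrite htB htZ subr_lt0 (lt_le_trans hm) //.
rewrite -[N%:R]mulr1; apply: ler_pM => //; first by rewrite ler_nat.
Qed.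

Lemma KL_ext N N' ps mu : all posht ps -> ht mu < N%:R -> ht mu < N'%:R ->
  KL N ps mu = KL N' ps mu.
Proof.
move=> hp; wlog NN : N N' / (N <= N')%N => [hw h1 h2|].
  by case/orP: (leq_total N N') => /hw; [apply|move=> ->].
elim: ps mu hp => [//|a ps IH] mu /= /andP[ha hp] h1 h2.
rewrite -(big_mkord xpredT (fun k => 'X^k * KL N ps (mu - k%:R *: a))).
rewrite -(big_mkord xpredT (fun k => 'X^k * KL N' ps (mu - k%:R *: a))).
rewrite [RHS](@big_cat_nat _ _ _ N) //= [X in _ + X]big_nat_cond [X in _ + X]big1 ?addr0.
  apply: eq_bigr => k _; congr (_ * _).
  have hk : ht (mu - k%:R *: a) <= ht mu.
    by rewrite htB htZ gerBl mulr_ge0 //; case/andP: ha => /ht_ge0.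
  by apply: IH => //; apply: le_lt_trans hk _.
move=> k /andP[/andP[Nk _] _]; rewrite (KL_ht0 _ hp) ?mulr0 //.
exact: ht_sub_mul Nk.
Qed.

(** Multiplying the generating series by [1 - q e^a] removes the factor of [a]: the sum over [k]
    telescopes, and its last term sits at negative height. *)
Lemma KL_rec N ps a mu : posht a -> all posht ps -> ht mu < N%:R ->
  KL N (a :: ps) mu - 'X * KL N (a :: ps) (mu - a) = KL N ps mu.
Proof.
move=> ha hp hm /=; pose G k := 'X^k * KL N ps (mu - k%:R *: a).
rewrite mulr_sumr -sumrB -(big_mkord xpredT (fun k => 'X^k * KL N ps (mu - k%:R *: a) - 'X * ('X^k * KL N ps (mu - a - k%:R *: a)))).
rewrite (eq_bigr (fun k => - (G k.+1 - G k))) => [|k _].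
  rewrite sumrN telescope_sumr // /G (KL_ht0 _ hp) ?mulr0; last first.
    exact: ht_sub_mul (leqnn _).
  by rewrite scale0r subr0 expr0 mul1r sub0r opprK.
rewrite /G opprB mulrA -exprS; congr (_ - _ * KL _ _ _).
by rewrite -addrA -opprD -[k.+1]add1n natrD scalerDl scale1r.
Qed.

Lemma KL_move N s t a mu : KL N (s ++ a :: t) mu = KL N (a :: s ++ t) mu.
Proof.
elim: s mu => // b s IH mu; rewrite cat_cons /=.
under eq_bigr => k _ do rewrite IH /= mulr_sumr.
rewrite exchange_big /=; apply: eq_bigr => k _; rewrite mulr_sumr.
apply: eq_bigr => l _; rewrite mulrCA; congr (_ * (_ * KL _ _ _)).
by rewrite addrAC.
Qed.

Lemma KL_perm N ps ps' mu : perm_eq ps ps' -> KL N ps mu = KL N ps' mu.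
Proof.
elim: ps ps' mu => [|a ps IH] ps' mu.
  by move=> /perm_size/esym/eqP/nilP->.
move=> e; have ain : a \in ps' by rewrite -(perm_mem e) mem_head.
case/splitPr: ps' / ain e => s t e; rewrite KL_move /=; apply: eq_bigr => k _.
congr (_ * _); apply: IH; rewrite -(perm_cons a) (perm_trans e) //.
by rewrite -cat1s perm_catCA.
Qed.

Lemma KL_map N ps mu (M : 'M[rat]_r) : M \in unitmx ->
  KL N [seq a *m M | a <- ps] (mu *m M) = KL N ps mu.
Proof.
move=> uM; elim: ps mu => [|a ps IH] mu /=.
  congr ((_ : bool)%:R); apply/eqP/eqP => [|->]; last exact: mul0mx.
  by move/(congr1 (mulmx^~ (invmx M))); rewrite mulmxK // mul0mx.
by apply: eq_bigr => k _; rewrite scalemxAl -mulmxBl IH.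
Qed.

Lemma KL0 ps : KL 1 ps 0 = 1.
Proof.
elim: ps => [|a ps IH] /=; first by rewrite eqxx.
by rewrite big_ord1 scale0r subr0 expr0 mul1r.
Qed.

Definition kbound (mu : V) : nat := (\sum_(i < r) absz (numq (mu ord0 i))).+1%N.

Lemma ht_kbound mu : ht mu < (kbound mu)%:R.
Proof.
rewrite /kbound -natr1 natr_sum; apply: ltr_pwDr => //.
apply: ler_sum => i _; apply: le_trans (ler_norm _) _.
rewrite -[X in `|X|]divq_num_den normrM normfV.
rewrite ler_pdivrMr ?normr_gt0 ?intr_eq0 ?denq_eq0 //.
rewrite -[(absz _)%:R]/((absz (numq (mu 0 i)))%:~R) -!intr_norm abszE.
rewrite -[leLHS]mulr1 ler_wpM2l ?ler0z // ler1z.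
by rewrite -gtz0_ge1 normr_gt0 denq_eq0.
Qed.

Lemma kostantE ps mu : kostant ps mu = KL (kbound mu) ps mu.
Proof. exact: KL_ffun. Qed.

Lemma kostantN N ps mu : all posht ps -> ht mu < N%:R -> kostant ps mu = KL N ps mu.
Proof. by move=> hp hN; rewrite kostantE; apply: KL_ext => //; apply: ht_kbound. Qed.

Lemma kostant_nneg ps mu : all (@nneg r) ps -> kostant ps mu != 0 -> nneg mu.
Proof. by rewrite kostantE; apply: KL_nneg. Qed.

Lemma kostant0 ps : all posht ps -> kostant ps 0 = 1.
Proof. by move=> hp; rewrite (kostantN (N := 1) hp) ?KL0 // ht0. Qed.
End Partition.

(** * Alternating sums and the character of the adjoint representation *)

Section Alternating.
Variables (r : nat) (A : 'M[int]_r) (d : 'rV[rat]_r) (Ws : seq 'M[rat]_r).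
Hypothesis CD : cartan_datum A d Ws.

Local Notation V := 'rV[rat]_r.
Local Notation a_ i := (simple_root i).
Local Notation s_ i := (sref A i).
Local Notation R := (rootsW Ws).
Local Notation cp := (spair A).
Local Notation bf := (bform A d).
Local Notation pr := (cartan_int A d).
Local Notation dom := (dominant A).
Local Notation rho := (rho Ws).
Local Notation eps := (sgnW Ws).

Lemma perm_Ws M : M \in Ws -> perm_eq [seq N *m M | N <- Ws] Ws.
Proof.
move=> MW; have uM := Ws_unit CD MW.
apply: uniq_perm; rewrite ?(weyl_uniq CD) //.
  by rewrite map_inj_uniq ?(weyl_uniq CD) // => N N' /(congr1 (mulmx^~ (invmx M))); rewrite !mulmxK.
move=> N; apply/mapP/idP => [[N' N'W ->]|NW]; first exact: (WsM CD).
by exists (N *m invmx M); rewrite ?mulmxKV // (WsM CD) // (WsV CD).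
Qed.

Lemma perm_Wsl M : M \in Ws -> perm_eq [seq M *m N | N <- Ws] Ws.
Proof.
move=> MW; have uM := Ws_unit CD MW.
apply: uniq_perm; rewrite ?(weyl_uniq CD) //.
  by rewrite map_inj_uniq ?(weyl_uniq CD) // => N N' /(congr1 (mulmx (invmx M))); rewrite !mulKmx.
move=> N; apply/mapP/idP => [[N' N'W ->]|NW]; first exact: (WsM CD).
by exists (invmx M *m N); rewrite ?mulKVmx // (WsM CD) // (WsV CD).
Qed.

Lemma perm_R M : M \in Ws -> perm_eq [seq g *m M | g <- R] R.
Proof.
move=> MW; apply: uniq_perm; rewrite ?root_uniq //.
  rewrite map_inj_uniq ?root_uniq // => u v; exact: (W_inj CD MW).
move=> g; apply/mapP/idP => [[g' g'R ->]|gR]; first by rewrite (rootWE CD).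
by exists (g *m invmx M); rewrite ?(WVK CD) // (rootWE CD) // (WsV CD).
Qed.

(** The alternating sum of the exponentials [e^(k w)] seen through the linear map [e^v |-> phi v];
    an identity valid for all [phi] is an identity between formal characters. *)
Definition altsum (phi : V -> {poly int}) (k : V) : {poly int} :=
  \sum_(w <- Ws) (eps w)%:P * phi (k *m w).
Local Notation J := altsum.

Lemma altsum_sref phi i k : J phi (k *m s_ i) = - J phi k.
Proof.
rewrite /altsum -[in RHS](perm_big _ (perm_Wsl (Ws_sref CD i))) big_map -sumrN.
apply: eq_big_seq => w wW; rewrite mulmxA (eps_sref CD) //.
by rewrite polyCN mulNr opprK.
Qed.

Lemma altsum_W phi M k : M \in Ws -> J phi (k *m M) = (eps M)%:P * J phi k.
Proof.
move=> /(inWs CD)[s <-]; elim: s k => [|i s IH] k /=.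
  by rewrite (eps1 CD) mulmx1 mul1r.
rewrite mulmxA IH altsum_sref (eps_sref CD) ?(word_in CD) //.
by rewrite polyCN mulNr mulrN.
Qed.

Lemma poly_int_double (p : {poly int}) : p = - p -> p = 0.
Proof.
move=> /eqP; rewrite -addr_eq0 -mulr2n => /eqP e; apply/polyP => i.
have := congr1 (fun p : {poly int} => p`_i) e; rewrite /= coefMn coef0.
by move=> /eqP; rewrite mulrn_eq0 /= => /eqP.
Qed.

Lemma altsum_fixed phi i k : cp i k = 0 -> J phi k = 0.
Proof.
move=> h; apply: poly_int_double; rewrite -(altsum_sref phi i).
by rewrite srefE h scale0r subr0.
Qed.

Lemma altsum_rho_root0 phi i g : cp i g = -1 -> J phi (rho + g) = 0.
Proof. by move=> h; apply: (@altsum_fixed _ i); rewrite cpD (cp_rho CD) h subrr. Qed.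

Lemma altsum_rho_sref phi i g :
  J phi (rho + g) = - J phi (rho + (g - (cp i g + 1) *: a_ i)).
Proof.
rewrite -(altsum_sref _ i); congr (J _ _); rewrite srefE cpD (cp_rho CD).
rewrite cpB cpZ (cp_simple2 CD); apply/rowP => j; rewrite !mxE; ring.
Qed.

Lemma altsum_rho_simpleN phi i : J phi (rho - a_ i) = - J phi rho.
Proof. by rewrite -(rho_sref CD) altsum_sref. Qed.

Lemma int_lt0_le (x : rat) : x \is a Num.int -> x < 0 -> x != -1 -> x <= -2.
Proof.
move=> /intrP[m ->]; rewrite ltrz0 -[-2]/((-2)%:~R) ler_int => m0 m1.
have : m != -1 by apply: contraNneq m1 => ->.
lia.
Qed.

(* For a root [g] that is neither dominant nor the opposite of a simple root,
   either [rho + g] lies on a wall, or the dot-reflection of [g] is a dominant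
   root [n] which is not maximal since [n + a_i] is a root. *)
Lemma altsum_nondominant g : g \in R -> ~~ dom g -> (forall i, g != - a_ i) ->
  (forall phi, J phi (rho + g) = 0) \/
  exists n i, [/\ n \in R, dom n, n + a_ i \in R, g = (n + a_ i) *m s_ i &
    forall phi, J phi (rho + g) = - J phi (rho + n)].
Proof.
move=> gR nd ns.
have [i ci] : exists i, cp i g < 0.
  by move: nd; rewrite negb_forall => /existsP[i]; rewrite -ltNge; exists i.
have [c1|c1] := eqVneq (cp i g) (-1); first by left=> phi; apply: altsum_rho_root0 c1.
have c2 := int_lt0_le (int_cp A i (root_int CD gR)) ci c1.
pose n := g - (cp i g + 1) *: a_ i.
have nE : n + a_ i = g *m s_ i.
  by rewrite srefE /n; apply/rowP => j; rewrite !mxE; ring.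
have aR := simple_root_in CD i.
have naR : n + a_ i \in R by rewrite nE (root_sref CD).
have nR : n \in R.
  rewrite -(addrK (a_ i) n); apply: (root_diff CD) => //.
    rewrite (bfC CD) bf_simple nE (cp_sref CD) mulr_gt0 ?(symm_gt0 CD) //.
    by rewrite oppr_gt0.
  apply/eqP => e; have /eqP[] := ns i.
  by rewrite -(srefK CD i g) -nE e (sref_simple CD).
have cn : cp i n = - cp i g - 2.
  by rewrite cpB cpZ (cp_simple2 CD); ring.
have bn : 0 <= bf n (a_ i).
  rewrite (bfC CD) bf_simple; apply: mulr_ge0; first exact/ltW/(symm_gt0 CD).
  by rewrite cn; lra.
have [l1 l2] := len_add CD nR aR naR bn.
have Jn phi : J phi (rho + g) = - J phi (rho + n) by exact: altsum_rho_sref.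
have [dn|] := boolP (dom n).
  by right; exists n, i; split=> //; rewrite nE (srefK CD).
rewrite negb_forall => /existsP[l]; rewrite -ltNge => cl.
left=> phi; rewrite Jn.
have [cl1|cl1] := eqVneq (cp l n) (-1); first by rewrite (altsum_rho_root0 _ cl1) oppr0.
have cl2 := int_lt0_le (int_cp A l (root_int CD nR)) cl cl1.
have il : l != i by apply: contraTneq cl => ->; rewrite cn -leNgt; lra.
(* Since [cp l n <= -2], the squared length of [a_l] is at most half that of [n], hence at most a
   quarter of that of [n + a_i], which is not orthogonal to [a_l]; [len4] excludes this. *)
exfalso.
have lR := simple_root_in CD l.
have nl : n != - a_ l.
  apply/eqP => e; move: naR; rewrite e addrC => dR.
  case: (root_sign CD dR); last rewrite opprB.
    move=> /nnegP/(_ l); rewrite mxE [X in _ + X]mxE !simpleE eqxx.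
    by rewrite [i == l]eq_sym (negPf il) sub0r oppr_ge0 ler10.
  move=> /nnegP/(_ i); rewrite mxE [X in _ + X]mxE !simpleE eqxx (negPf il).
  by rewrite sub0r oppr_ge0 ler10.
have nl' : n != a_ l.
  by apply: contraTneq cl => ->; rewrite (cp_simple2 CD).
have h4 := pr_lt4 CD nR lR nl' nl.
rewrite (pr_simple CD) in h4.
have p0 : pr (a_ l) n < 0.
  rewrite -oppr_gt0 /cartan_int -mulNr -mulrN -(bfNr CD).
  rewrite -/(cartan_int A d (a_ l) (- n)) in h4 *.
  rewrite mulr_gt0 ?invr_gt0 ?(root_bf_gt0 CD) // mulr_gt0 // bf_simple.
  by rewrite mulr_gt0 ?(symm_gt0 CD) // cpN oppr_gt0.
have p1 : pr (a_ l) n = -1.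
  apply/eqP/negPn/negP => /(int_lt0_le (root_int_pr CD lR nR) p0) m2.
  have : 0 <= (-2 - cp l n) * (-2 - pr (a_ l) n) by rewrite mulr_ge0 // subr_ge0.
  by move: h4 cl2 m2; move: (cp l n) (pr _ _) => x y; lra.
have e1 := prE CD (a_ l) nR; rewrite p1 bf_simple in e1.
have dl := symm_gt0 CD l.
have ll : bf (a_ l) (a_ l) = 2 * d 0 l by rewrite bf_simple (cp_simple2 CD); ring.
have nn : 2 * bf (a_ l) (a_ l) <= bf n n by rewrite ll; nra.
apply: (len4 CD naR lR); last by lra.
rewrite bfDl lt_eqF // -(addr0 0) ltr_leD //.
  rewrite (bfC CD) bf_simple; nra.
rewrite bf_simple (cp_simple A) mulr_ge0_le0 //; first exact/ltW/(symm_gt0 CD).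
by rewrite lerz0 (cartan_offdiag CD) // eq_sym.
Qed.
End Alternating.

(** * Dominant roots and the Weyl numerator of the adjoint representation *)

Section HighestRoot.
Variables (r : nat) (A : 'M[int]_r) (d : 'rV[rat]_r) (Ws : seq 'M[rat]_r).
Hypothesis CD : cartan_datum A d Ws.

Local Notation V := 'rV[rat]_r.
Local Notation a_ i := (simple_root i).
Local Notation s_ i := (sref A i).
Local Notation R := (rootsW Ws).
Local Notation Rp := (posroots Ws).
Local Notation cp := (spair A).
Local Notation bf := (bform A d).
Local Notation dom := (dominant A).
Local Notation rho := (rho Ws).
Local Notation J := (altsum Ws).

Section DomPairs.
Hypothesis Aind : indecomposable A.

(** If the support were proper, indecomposability would link it to an index [j] outside, where the
    pairing of [n] with [alpha_j^vee] would be negative. *)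
Lemma dom_full n : n \in R -> dom n -> forall i, 0 < n 0 i.
Proof.
move=> nR dn i; have /nnegP np := pos_nneg (dom_pos CD nR dn).
rewrite lt_neqAle np andbT eq_sym; apply/negP => /eqP ni.
pose S := [set i | n 0 i != 0].
have S0 : S != set0.
  apply: contra (root_neq0 CD nR) => /eqP e; apply/eqP/rowP => j.
  by have := in_set0 j; rewrite -e inE mxE => /negbFE/eqP.
have ST : S != setT.
  by apply: contraTneq (in_setT i) => <-; rewrite inE ni eqxx.
have [k [j [kS jS kj]]] := Aind S0 ST.
rewrite inE in kS; rewrite inE negbK in jS.
have /domP/(_ j) := dn; rewrite leNgt => /negP[].
rewrite cpE (bigD1 k) //=; apply: ltr_wnDr.
  apply: sumr_le0 => l _; have [->|jl] := eqVneq l j; first by rewrite (eqP jS) mul0r.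
  by rewrite mulr_ge0_le0 // lerz0 (cartan_offdiag CD) // eq_sym.
rewrite pmulr_rlt0; last by rewrite lt_neqAle eq_sym kS np.
have jk : j != k by apply: contraNneq kS => <-.
by rewrite ltrz0 lt_neqAle (cartan_offdiag CD) // andbT (cartan_sym0 CD).
Qed.

Lemma dom_dom_gt0 n m : n \in R -> m \in R -> dom n -> dom m -> 0 < bf n m.
Proof.
move=> nR mR dn dm; have n0 := dom_full nR dn.
have np := pos_nneg (dom_pos CD nR dn).
rewrite lt_neqAle (dom_bf CD) // andbT eq_sym; apply/negP => /eqP.
move=> /eqP; rewrite psumr_eq0 => [|i _]; last first.
  apply: mulr_ge0; last exact/domP.
  by apply: mulr_ge0; apply/ltW => //; apply: (symm_gt0 CD).
move=> /allP h; have c0 i : cp i m = 0.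
  have := h i (mem_index_enum i); rewrite mulf_eq0 => /orP[|/eqP//].
  by rewrite gt_eqF // mulr_gt0 ?(symm_gt0 CD).
have := root_bf_gt0 CD mR; rewrite /bform big1 ?ltxx // => i _.
by rewrite c0 mulr0.
Qed.

Lemma dom_comparable n m : n \in R -> m \in R -> dom n -> dom m -> n != m ->
  n - m \in Rp \/ m - n \in Rp.
Proof.
move=> nR mR dn dm nm; have dR := root_diff CD nR mR (dom_dom_gt0 nR mR dn dm) nm.
have [|] := boolP (n - m \in Rp); [by left|right].
by rewrite -opprB (root_negE CD).
Qed.
End DomPairs.

Variable theta : V.
Hypotheses (thR : theta \in R)
  (thmax : forall a, a \in R -> forall i, a 0 i <= theta 0 i).

Lemma th_ge a : a \in R -> nneg (theta - a).
Proof. by move=> aR; apply/nnegP => i; rewrite mxE [X in _ + X]mxE subr_ge0 thmax. Qed.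

Lemma dom_th : dom theta.
Proof.
apply/domP => i; have := thmax (root_sref CD i thR) i.
by rewrite srefE mxE [X in _ + X]mxE [X in - X]mxE simpleE eqxx mulr1 gerBl.
Qed.

Lemma th_add_simple i : theta + a_ i \notin R.
Proof.
apply/negP => /thmax/(_ i); rewrite mxE simpleE eqxx gerDl.
by rewrite ler10.
Qed.

Hypothesis Aind : indecomposable A.

(** Dominant roots are comparable, and each step up at least doubles the squared length. A chain of
    three ending at [theta] would give the ratio 4, excluded by [len4]. *)
Lemma dom_two n m : n \in R -> m \in R -> dom n -> dom m ->
  n != theta -> m != theta -> n = m.
Proof.
have key x y : x \in R -> y \in R -> dom x -> dom y -> x != theta -> y != theta ->
    y - x \in Rp -> False.
  move=> xR yR dx dy xt yt yx.
  have ne : y != x.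
    by rewrite -subr_eq0 (root_neq0 CD) // pos_root.
  have [_ l1] := above_len CD xR dx yR (pos_nneg yx) ne.
  have := above_len CD yR dy thR (th_ge yR); rewrite eq_sym => /(_ yt)[_ l2].
  apply: (len4 CD thR xR); last by lra.
  by rewrite gt_eqF // dom_dom_gt0 // dom_th.
move=> nR mR dn dm nt mt; apply/eqP/negPn/negP => nm.
by have [h|h] := dom_comparable Aind nR mR dn dm nm; exact: key h.
Qed.

Lemma dom_cover n : n \in R -> dom n -> n != theta -> exists i, n + a_ i \in R.
Proof.
move=> nR dn nt.
have tn : theta - n \in Rp by apply: (above_diff CD) => //; rewrite 1?eq_sym ?th_ge.
have [b [bR bn b1]] := above_exists CD nR dn thR (th_ge nR) (nht_gt0 CD tn).
have bne : b != n by apply: contra_eqN b1 => /eqP->; rewrite subrr /nht ht0.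
have [i e] := nht1_simple CD (above_diff CD nR dn bR bn bne) b1.
by exists i; rewrite -e addrC subrK.
Qed.

Lemma dom_cover_uniq n i j : n \in R -> dom n -> n + a_ i \in R -> n + a_ j \in R ->
  i = j.
Proof.
move=> nR dn iR jR.
have e k : n + a_ k - n = a_ k by rewrite addrC addKr.
have ne k : n + a_ k != n by rewrite -subr_eq0 e simple_neq0.
have : n + a_ i = n + a_ j.
  by apply: (above_ht_inj CD nR dn) => //; rewrite ?e ?nneg_simple // !htD !ht_simple.
move=> /addrI/rowP/(_ i); rewrite !simpleE eqxx.
by have [->//|_] := eqVneq j i => /eqP; rewrite oner_eq0.
Qed.

Lemma sum_pick (I : eqType) (s : seq I) (x : I) (F : I -> {poly int}) :
  uniq s -> x \in s -> \sum_(y <- s) (if y == x then F y else 0) = F x.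
Proof.
move=> us xs; rewrite (bigD1_seq x) //= eqxx big1 ?addr0 // => y /negPf->.
by [].
Qed.

(** Weyl's character formula for the adjoint representation, multiplied by the Weyl denominator: the
    left side is the numerator, and [r + sum e^g] is the character. *)
Lemma weyl_theta phi :
  J phi (rho + theta) = r%:R * J phi rho + \sum_(g <- R) J phi (rho + g).
Proof.
pose F g := J phi (rho + g).
have ndneg i : ~~ dom (- a_ i).
  apply/negP => /domP/(_ i); rewrite cpN (cp_simple2 CD).
  by rewrite oppr_ge0.
have negR i : - a_ i \in R by rewrite (rootNE CD) (simple_root_in CD).
have negsum : \sum_(g <- R) \sum_i (if g == - a_ i then - J phi rho else 0) =
    - (r%:R * J phi rho).
  rewrite exchange_big /= -mulrN.
  rewrite (eq_bigr (fun=> - J phi rho)) => [|i _]; last first.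
    by rewrite (sum_pick (fun=> - J phi rho)) ?root_uniq.
  by rewrite sumr_const card_ord mulr_natl.
have negone (g : V) i : g = - a_ i ->
    \sum_j (if g == - a_ j then - J phi rho else 0) = - J phi rho.
  move=> e; rewrite (bigD1 i) //= e eqxx big1 ?addr0 // => j ji.
  case: ifP => // /eqP/oppr_inj/rowP/(_ i); rewrite !simpleE eqxx (negPf ji).
  by move=> /eqP; rewrite oner_eq0.
have negnone (g : V) : (forall i, g != - a_ i) ->
    \sum_j (if g == - a_ j then - J phi rho else 0) = 0.
  by move=> h; rewrite big1 // => j _; rewrite (negPf (h j)).
have negdec (g : V) : (exists i, g = - a_ i) \/ (forall i, g != - a_ i).
  case: (boolP [exists i, g == - a_ i]) => [/existsP[i /eqP e]|]; first by left; exists i.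
  by rewrite negb_exists => /forallP; right.
have [[n [nR dn nt]]|none] :=
    classic (exists n, [/\ n \in R, dom n & n != theta]); last first.
  have FE g : g \in R -> F g = (if g == theta then F g else 0) +
      \sum_i (if g == - a_ i then - J phi rho else 0).
    move=> gR; have [->|gt] := eqVneq g theta.
      rewrite negnone ?addr0 // => i; apply: contraNneq (ndneg i) => <-.
      exact: dom_th.
    rewrite add0r; have [[i e]|h] := negdec g.
      by rewrite (negone _ i) // e /F; apply: altsum_rho_simpleN CD _ _.
    rewrite negnone //; have nd : ~~ dom g.
      by apply/negP => dg; apply: none; exists g.
    have [h0|[n [i [nR dn naR _ _]]]] := altsum_nondominant CD gR nd h; first exact: h0.
    exfalso; apply: none; exists n; split=> //.
    by apply: contraTneq naR => ->; exact: th_add_simple.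
  rewrite (eq_big_seq _ FE) big_split /= sum_pick ?root_uniq // negsum.
  by rewrite addrCA subrr addr0.
have [i niR] := dom_cover nR dn nt.
(* [g0] is the image of [n] under the dot action of [s_i], so its term cancels that of [n]. As [i]
   is the only index with [n + a_i] a root, no other root straightens to [n]. *)
pose g0 := (n + a_ i) *m s_ i.
have g0R : g0 \in R by rewrite (root_sref CD).
have g0E : g0 = n - (cp i n + 1) *: a_ i.
  rewrite /g0 mulmxDl (sref_simple CD) srefE; apply/rowP => j; rewrite !mxE; ring.
have ci0 : 0 <= cp i n by move/domP: dn.
have cg0 : cp i g0 < 0.
  by rewrite (cp_sref CD) cpD (cp_simple2 CD) oppr_lt0; lra.
have g0nd : ~~ dom g0 by apply/negP => /domP/(_ i); rewrite leNgt cg0.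
have Fg0 : F g0 = - F n.
  rewrite /F (altsum_rho_sref CD phi i); congr (- J phi (_ + _)).
  by rewrite g0E cpB cpZ (cp_simple2 CD); apply/rowP => j; rewrite !mxE; ring.
have np := dom_pos CD nR dn.
have g0neg j : g0 != - a_ j.
  apply/eqP => e.
  have : n + a_ i = - (a_ j *m s_ i).
    by rewrite -mulNmx -e (srefK CD).
  have [->|ji] := eqVneq j i.
    rewrite (sref_simple CD) opprK => /eqP; rewrite -subr_eq0 addrK.
    by rewrite (negPf (root_neq0 CD nR)).
  have jp : a_ j *m s_ i \in Rp.
    apply: (pos_sref CD) (pos_simple CD j) _.
    apply/eqP => /rowP/(_ i); rewrite !simpleE eqxx (negPf ji) => /eqP.
    by rewrite eq_sym oner_eq0.
  move=> e2; have := root_negE CD (pos_root jp); rewrite -e2 jp posP niR.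
  by rewrite nnegD ?nneg_simple ?(pos_nneg np).
have FE g : g \in R -> F g = (if g == theta then F g else 0) +
    (if g == n then F g else 0) + (if g == g0 then F g else 0) +
    \sum_i (if g == - a_ i then - J phi rho else 0).
  move=> gR; have [->|gt] := eqVneq g theta.
    rewrite eq_sym (negPf nt) negnone; last first.
      by move=> j; apply: contraNneq (ndneg j) => <-; exact: dom_th.
    by rewrite eq_sym (negPf (contraNneq _ g0nd)) ?addr0 // => ->; apply: dom_th.
  have [->|gn] := eqVneq g n.
    rewrite negnone; last by move=> j; apply: contraNneq (ndneg j) => <-.
    by rewrite eq_sym (negPf (contraNneq _ g0nd)) ?addr0 ?add0r // => ->.
  rewrite !add0r; have [->|gg0] := eqVneq g g0; first by rewrite negnone ?addr0.
  rewrite add0r; have [[j e]|h] := negdec g.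
    by rewrite (negone _ j) // e /F; apply: altsum_rho_simpleN CD _ _.
  rewrite negnone //; have nd : ~~ dom g.
    by apply/negP => dg; move: gn; rewrite (dom_two gR nR dg dn gt nt) eqxx.
  have [h0|[m [j [mR dm maR e _]]]] := altsum_nondominant CD gR nd h; first exact: h0.
  exfalso; have mt : m != theta.
    by apply: contraTneq maR => ->; exact: th_add_simple.
  have mn := dom_two mR nR dm dn mt nt.
  rewrite mn in e maR; have ij := dom_cover_uniq nR dn maR niR.
  by move: gg0; rewrite e ij eqxx.
rewrite (eq_big_seq _ FE) !big_split /= !sum_pick ?root_uniq // negsum Fg0.
by rewrite addrK addrCA subrr addr0.
Qed.
End HighestRoot.

(** * Straightening relations *)

Section Straightening.
Variables (r : nat) (A : 'M[int]_r) (d : 'rV[rat]_r) (Ws : seq 'M[rat]_r).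
Hypothesis CD : cartan_datum A d Ws.

Local Notation V := 'rV[rat]_r.
Local Notation a_ i := (simple_root i).
Local Notation s_ i := (sref A i).
Local Notation R := (rootsW Ws).
Local Notation Rp := (posroots Ws).
Local Notation cp := (spair A).
Local Notation dom := (dominant A).
Local Notation rho := (rho Ws).
Local Notation J := (altsum Ws).
Local Notation K := (kostant Rp).

Lemma pos_posht : all (@posht r) Rp.
Proof.
apply/allP => g gp; rewrite /posht (pos_nneg gp) -(pos_nht CD gp).
by rewrite ler1n (nht_gt0 CD).
Qed.

Lemma rem_posht i : all (@posht r) (rem (a_ i) Rp).
Proof. by apply/allP => g /mem_rem; apply/allP: g; apply: pos_posht. Qed.

Definition Krem i (v : V) := KL (kbound v) (rem (a_ i) Rp) v.

Lemma kostant_rec i v : K v - 'X * K (v - a_ i) = Krem i v.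
Proof.
have h := pos_posht; have hv := ht_kbound v.
rewrite (kostantN h hv) (@kostantN _ (kbound v)) //; last first.
  by rewrite htB ht_simple; move: hv; lra.
rewrite !(KL_perm _ _ (perm_pos_simple CD i)) KL_rec // ?rem_posht //.
by rewrite /posht nneg_simple ht_simple.
Qed.

(* [Krem i] is the partition function of the positive roots other than [a_ i],
   a set which [s_ i] permutes. *)
Lemma Krem_sref i v : Krem i (v *m s_ i) = Krem i v.
Proof.
have h := rem_posht i; pose N := maxn (kbound v) (kbound (v *m s_ i)).
have l1 : ht v < N%:R.
  by apply: lt_le_trans (ht_kbound v) _; rewrite ler_nat leq_maxl.
have l2 : ht (v *m s_ i) < N%:R.
  by apply: lt_le_trans (ht_kbound _) _; rewrite ler_nat leq_maxr.
rewrite /Krem (@KL_ext _ _ N) ?ht_kbound // [RHS](@KL_ext _ _ N) ?ht_kbound //.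
rewrite -(KL_perm _ _ (perm_rem_sref CD i)) KL_map //.
exact/(Ws_unit CD)/(Ws_sref CD).
Qed.

Lemma qmult_altsum lam mu : qmult A Ws lam mu = J (fun v => K (v - (mu + rho))) (lam + rho).
Proof. by apply: eq_big_seq => w wW; rewrite (wsign_eps CD). Qed.

(** The combination [f mu - q f (mu + a_i)] changes sign under the dot action
    [mu |-> mu *m s_i - a_i]. *)
Definition straight (f : V -> {poly int}) : Prop := forall mu i,
  f mu - 'X * f (mu + a_ i) + f (mu *m s_ i - a_ i) - 'X * f (mu *m s_ i) = 0.

(** By [kostant_rec] the combination is an alternating sum of [Krem i], which is [s_i]-invariant;
    reindexing the sum over [W] by [s_i] yields the sign. *)
Lemma straight_qmult lam : straight (qmult A Ws lam).
Proof.
move=> mu i.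
have key m : qmult A Ws lam m - 'X * qmult A Ws lam (m + a_ i) =
    J (fun v => Krem i (v - (m + rho))) (lam + rho).
  rewrite !qmult_altsum /altsum mulr_sumr -sumrB; apply: eq_bigr => w _.
  rewrite mulrCA -mulrBr -kostant_rec; congr (_ * (_ - _ * K _)).
  by rewrite addrAC opprD addrA.
rewrite -addrA key -[X in _ - 'X * qmult _ _ _ X](subrK (a_ i)) key.
rewrite /altsum -[X in X + _](perm_big _ (perm_Ws CD (Ws_sref CD i))) big_map -big_split /=.
rewrite big_seq big1 // => w wW.
rewrite (eps_srefr CD) // polyCN mulNr -(Krem_sref i) mulmxA mulmxBl (srefK CD).
have -> : (mu + rho) *m s_ i = mu *m s_ i - a_ i + rho.
  by rewrite mulmxDl (rho_sref CD) addrA addrAC.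
by rewrite addNr.
Qed.

Lemma straightD f g : straight f -> straight g -> straight (fun v => f v + g v).
Proof.
move=> hf hg mu i; rewrite -[RHS](addr0 0) -{1}(hf mu i) -(hg mu i); ring.
Qed.
Lemma straightZ c f : straight f -> straight (fun v => c * f v).
Proof. by move=> hf mu i; rewrite -[RHS](mulr0 c) -(hf mu i); ring. Qed.
Lemma straight_conv (S : seq V) f : straight f ->
  (forall i, perm_eq [seq g *m s_ i | g <- S] S) ->
  straight (fun v => \sum_(g <- S) f (v + g)).
Proof.
move=> hf hS mu i.
have e v : \sum_(g <- S) f (v + g) = \sum_(g <- S) f (v + g *m s_ i).
  by rewrite -(perm_big _ (hS i)) big_map.
rewrite [X in _ + X - _]e [X in _ - _ * X]e !mulr_sumr -!sumrB -big_split /= -sumrB.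
rewrite big1 // => g _; rewrite -[RHS](hf (mu + g) i) mulmxDl.
by rewrite -!addrA [a_ i + g]addrC [- a_ i + _]addrC.
Qed.

Lemma qmult00 : qmult A Ws 0 0 = 1.
Proof.
rewrite qmult_altsum /altsum !add0r (bigD1_seq 1%:M) ?(W1 CD) ?(weyl_uniq CD) //=.
rewrite (eps1 CD) mulmx1 subrr kostant0 ?pos_posht // mul1r big_seq_cond big1 ?addr0 //.
move=> w /andP[wW w1]; apply/eqP; rewrite mulf_eq0 orbC; apply/orP; left.
apply: contraNT w1 => /(kostant_nneg (posht_nneg pos_posht)) n1; apply/eqP.
apply: (rho_fix CD wW); apply/eqP; rewrite -subr_eq0; apply/eqP/nneg_anti => //.
by rewrite opprB (rho_le CD).
Qed.

Lemma qmult0_le mu : qmult A Ws 0 mu != 0 -> nneg (- mu).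
Proof.
apply: contraNT => nmu; rewrite qmult_altsum /altsum big_seq big1 // => w wW; apply/eqP.
rewrite mulf_eq0 orbC; apply/orP; left; apply: contraNT nmu.
move=> /(kostant_nneg (posht_nneg pos_posht)) n1.
have -> : - mu = ((0 + rho) *m w - (mu + rho)) + (rho - rho *m w).
  by rewrite add0r; apply/rowP => j; rewrite !mxE; ring.
by rewrite nnegD // (rho_le CD).
Qed.

Lemma perm_RN : perm_eq [seq - g | g <- R] R.
Proof.
apply: uniq_perm; rewrite ?root_uniq ?(map_inj_uniq oppr_inj) ?root_uniq //.
move=> g; apply/mapP/idP => [[b bR ->]|gR]; first by rewrite (rootNE CD).
by exists (- g); rewrite ?opprK // (rootNE CD).
Qed.

Lemma perm_R_pos : perm_eq R (Rp ++ [seq - g | g <- Rp]).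
Proof.
apply: uniq_perm; rewrite ?root_uniq //.
  rewrite cat_uniq pos_uniq (map_inj_uniq oppr_inj) pos_uniq andbT /=.
  apply/hasPn => g /mapP[b bp ->].
  by rewrite /= (root_negE CD) ?bp // pos_root.
move=> g; rewrite mem_cat; apply/idP/orP => [gR|].
  have := root_pos CD gR; case: (boolP (g \in Rp)) => /= [_ _|_ gn]; [by left|right].
  by apply/mapP; exists (- g); rewrite ?opprK.
case=> [/pos_root//|/mapP[b bp ->]]; by rewrite (rootNE CD) pos_root.
Qed.

(** [weyl_theta] for the shifted partition function; the set of roots is stable under [W] and under
    negation, so the shift by a root moves from the highest weight to [mu]. *)
Lemma qmult_theta theta mu : theta \in R ->
  (forall a, a \in R -> forall i, a 0 i <= theta 0 i) -> indecomposable A ->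
  qmult A Ws theta mu =
    r%:R * qmult A Ws 0 mu + \sum_(g <- R) qmult A Ws 0 (mu + g).
Proof.
move=> thR thmax Aind; rewrite !qmult_altsum [theta + _]addrC.
rewrite (weyl_theta CD thR thmax Aind) add0r; congr (_ + _).
under [RHS]eq_bigr => g _ do rewrite qmult_altsum add0r /altsum.
rewrite exchange_big /= [RHS]exchange_big /= big_seq [RHS]big_seq.
apply: eq_bigr => w wW; rewrite -!mulr_sumr; congr (_ * _).
rewrite -[RHS](perm_big _ perm_RN) big_map -[RHS](perm_big _ (perm_R CD wW)) big_map.
apply: eq_bigr => g _; congr K.
by rewrite mulmxDl; apply/rowP => j; rewrite !mxE; ring.
Qed.

Section Values.
Variable f : V -> {poly int}.
Hypothesis fS : straight f.

Lemma straight_simpleN i : f (- a_ i) = ('X - 1) * f 0 + 'X * f (a_ i).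
Proof.
have := fS (- a_ i) i; rewrite mulNmx (sref_simple CD) opprK addNr subrr => e.
by apply/eqP; rewrite -subr_eq0 -[X in _ == X]e; apply/eqP; ring.
Qed.

Lemma poly_int_addrr0 (p : {poly int}) : p + p = 0 -> p = 0.
Proof. by move=> /eqP; rewrite addr_eq0 => /eqP/poly_int_double. Qed.

(** Here [mu] is fixed by the dot action, so the relation is twice the claimed equation. *)
Lemma straight1 mu i : cp i mu = -1 -> f mu = 'X * f (mu *m s_ i).
Proof.
move=> c; have := fS mu i; rewrite srefE c scaleN1r opprK addrK => e.
apply/eqP; rewrite -subr_eq0; apply/eqP/poly_int_addrr0.
by rewrite -[RHS]e; ring.
Qed.

(** The powers of [q] grow by one with each step down the [a_i]-string from [mu *m s_i] to [mu]. For
    [n = 1] the guarded hypothesis would be the conclusion itself, as then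
    [mu *m s_i - a_i = mu]. *)
Lemma straight_geom mu i n c e : cp i mu = - n%:R -> (0 < n)%N ->
  f (mu + a_ i) = c * 'X^(e + n.-1) ->
  ((1 < n)%N -> f (mu *m s_ i - a_ i) = c * 'X^(e.+1)) ->
  f (mu *m s_ i) = c * 'X^e -> f mu = c * 'X^(e + n).
Proof.
move=> cn n0 f1 f2 f3; have [n1|n1] := eqVneq n 1%N.
  by rewrite (straight1 (i := i)) ?cn ?n1 // f3 addn1 exprS; ring.
have := fS mu i; rewrite f1 f2 ?f3; last by lia.
case: n n0 {cn n1 f1 f2} => // n _ /= h.
by apply/eqP; rewrite -subr_eq0 -[X in _ == X]h addnS !exprS; apply/eqP; ring.
Qed.

Lemma root_coord_pos g j : g \in R -> 0 < g 0 j -> g \in Rp.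
Proof.
move=> gR gj; apply: contraT; rewrite -(root_nnegN CD) // => /nnegP/(_ j).
by rewrite mxE oppr_ge0 leNgt gj.
Qed.

Lemma int_nat (x : rat) : x \is a Num.int -> 0 < x -> exists2 n, x = n%:R & (0 < n)%N.
Proof.
move=> /intrP[m ->]; rewrite ltr0z => m0; exists `|m|%N; last by rewrite absz_gt0 gt_eqF.
by rewrite natr_absz gtr0_norm.
Qed.

Lemma nht_addZ (v : V) i n : intv v -> nneg v -> nht (v + n%:R *: a_ i) = (nht v + n)%N.
Proof.
move=> iv nv; rewrite nhtD ?nnegZ ?nneg_simple //.
  by rewrite /nht htZ ht_simple mulr1 -[n%:R]/(n%:~R) numq_int.
by apply: intvZ; [rewrite -[n%:R]/(n%:~R) intr_int|exact: intv_simple].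
Qed.

(** Induction on the height: if [a_i] pairs positively with [g], the other points of the relation at
    [- g] are the opposites of [g - a_i], [g *m s_i + a_i] and [g *m s_i], positive roots that are
    lower when they are needed. *)
Lemma neg_values c k : (forall i, f (- a_ i) = c * 'X^k) ->
  forall g, g \in Rp -> f (- g) = c * 'X^(k + (nht g).-1).
Proof.
move=> fa g; have [m] := ubnP (nht g); elim: m g => // m IH g; rewrite ltnS => gm gp.
have gR := pos_root gp; have gi := pos_int CD gp.
have [i ci] := pos_lower CD gp; have [-> _|ne [|g1]] := eqVneq g (a_ i).
- by rewrite fa nht_simple addn0.
- by move/eqP; rewrite (negPf ne).
have [j ji gj] := pos_other CD gp ne.
have [n cn n0] := int_nat (int_cp A i gi) ci.
have aR := simple_root_in CD i.
have gs : g *m s_ i = g - n%:R *: a_ i by rewrite srefE cn.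
have gsp : g *m s_ i \in Rp by apply: (pos_sref CD).
have g2 : g *m s_ i + a_ i \in Rp.
  apply: (@root_coord_pos _ j).
    have -> : g *m s_ i + a_ i = (g - a_ i) *m s_ i.
      by rewrite mulmxBl (sref_simple CD) opprK.
    by rewrite (root_sref CD) ?pos_root.
  by rewrite mxE (sref_coord A) // simpleE eq_sym (negPf ji) addr0.
have e1 : nht g = (nht (g *m s_ i) + n)%N.
  by rewrite -(nht_addZ i n (pos_int CD gsp) (pos_nneg gsp)) gs subrK.
have e2 : nht (g *m s_ i + a_ i) = (nht (g *m s_ i) + 1)%N.
  by rewrite (nhtD (pos_int CD gsp) (intv_simple i) (pos_nneg gsp) (nneg_simple i)) nht_simple.
have e3 : nht g = (nht (g - a_ i) + 1)%N.
  by have := nhtD (pos_int CD g1) (intv_simple i) (pos_nneg g1) (nneg_simple i); rewrite subrK nht_simple.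
have p0 := nht_gt0 CD gsp.
have [b1 b2 b3] : [/\ (nht (g - a_ i) < m)%N, (nht (g *m s_ i) < m)%N &
    (1 < n -> nht (g *m s_ i + a_ i) < m)%N].
  by rewrite e2; clear -e1 e3 n0 gm p0; split; lia.
have [x1 x2 x3] : [/\ (k + (nht g).-1 = k + (nht (g *m s_ i)).-1 + n)%N,
    (k + (nht (g - a_ i)).-1 = k + (nht (g *m s_ i)).-1 + n.-1)%N &
    (k + (nht (g *m s_ i + a_ i)).-1 = (k + (nht (g *m s_ i)).-1).+1)%N].
  by rewrite e2; clear -e1 e3 n0 p0; split; lia.
rewrite x1; apply: (straight_geom (i := i)) => //.
- by rewrite cpN cn.
- by rewrite -x2 -IH // opprB addrC.
- by move=> n1; rewrite mulNmx -opprD IH ?b3 // x3.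
by rewrite mulNmx IH.
Qed.

(** Descending induction on the height from the dominant roots: if [a_i] pairs negatively with [g],
    the relation at [g] involves [g + a_i], [g *m s_i - a_i] and [g *m s_i]. *)
Lemma pos_values H : (forall g, g \in Rp -> (nht g <= H)%N) ->
  (forall n, n \in R -> dom n -> f n = 'X^(H - nht n)) ->
  forall g, g \in Rp -> f g = 'X^(H - nht g).
Proof.
move=> hH fd g; have [m] := ubnP (H - nht g)%N; elim: m g => // m IH g; rewrite ltnS => gm gp.
have gR := pos_root gp; have gi := pos_int CD gp.
have [dg|] := boolP (dom g); first exact: fd.
rewrite negb_forall => /existsP[i]; rewrite -ltNge => ci.
have [n cn n0] : exists2 n, - cp i g = n%:R & (0 < n)%N.
  by apply: int_nat; rewrite ?oppr_gt0 // rpredN int_cp.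
have aR := simple_root_in CD i.
have gs : g *m s_ i = g + n%:R *: a_ i by rewrite srefE -scaleNr cn.
have ne : g != a_ i.
  by apply: contraTneq ci => ->; rewrite (cp_simple2 CD).
have gsp : g *m s_ i \in Rp by apply: (pos_sref CD).
have g1R : g + a_ i \in R.
  rewrite -(opprK (a_ i)); apply: (root_diff CD) => //; first by rewrite (rootNE CD).
    rewrite (bfNr CD) (bfC CD) bf_simple oppr_gt0.
    by rewrite pmulr_rlt0 // (symm_gt0 CD).
  apply/eqP => e; have := root_negE CD aR.
  by rewrite -e gp (pos_simple CD).
have g1 : g + a_ i \in Rp by rewrite posP g1R nnegD ?nneg_simple ?(pos_nneg gp).
have g2 : g *m s_ i - a_ i \in Rp.
  rewrite posP; have -> : g *m s_ i - a_ i = (g + a_ i) *m s_ i.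
    by rewrite mulmxDl (sref_simple CD).
  rewrite (root_sref CD) //=; have -> : (g + a_ i) *m s_ i = g + (n%:R - 1) *: a_ i.
    by rewrite mulmxDl (sref_simple CD) gs; apply/rowP => j; rewrite !mxE; ring.
  by rewrite nnegD ?(pos_nneg gp) // nnegZ ?nneg_simple // subr_ge0 ler1n.
have e1 : nht (g *m s_ i) = (nht g + n)%N by rewrite gs nht_addZ // (pos_nneg gp).
have e2 : nht (g + a_ i) = (nht g + 1)%N.
  by rewrite (nhtD gi (intv_simple i) (pos_nneg gp) (nneg_simple i)) nht_simple.
have e3 : nht (g *m s_ i) = (nht (g *m s_ i - a_ i) + 1)%N.
  by have := nhtD (pos_int CD g2) (intv_simple i) (pos_nneg g2) (nneg_simple i); rewrite subrK nht_simple.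
have h1 := hH _ gsp; have h2 := hH _ g1; have h3 := hH _ g2.
have [b1 b2 b3] : [/\ (H - nht (g + a_ i) < m)%N, (H - nht (g *m s_ i) < m)%N &
    (1 < n -> H - nht (g *m s_ i - a_ i) < m)%N].
  by rewrite e2; clear -e1 e3 n0 gm h1 h2 h3 e2; split; lia.
have [x1 x2 x3] : [/\ (H - nht g = H - nht (g *m s_ i) + n)%N,
    (H - nht (g + a_ i) = H - nht (g *m s_ i) + n.-1)%N &
    (H - nht (g *m s_ i - a_ i) = (H - nht (g *m s_ i)).+1)%N].
  by rewrite e2; clear -e1 e3 n0 h1 h2 h3 e2; split; lia.
rewrite x1 -[RHS]mul1r; apply: (straight_geom (i := i)) => //; rewrite ?mul1r.
- by rewrite -cn opprK.
- by rewrite IH // x2.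
- by move=> n1; rewrite IH ?b3 // x3.
by rewrite IH.
Qed.
End Values.
End Straightening.

(** * Orbits of the dominant roots and the sum of Theta *)

Section Orbits.
Variables (r : nat) (A : 'M[int]_r) (d : 'rV[rat]_r) (Ws : seq 'M[rat]_r).
Hypothesis CD : cartan_datum A d Ws.

Local Notation V := 'rV[rat]_r.
Local Notation a_ i := (simple_root i).
Local Notation s_ i := (sref A i).
Local Notation R := (rootsW Ws).
Local Notation Rp := (posroots Ws).
Local Notation cp := (spair A).
Local Notation bf := (bform A d).
Local Notation dom := (dominant A).

Definition orb (n : V) : seq V := undup [seq n *m w | w <- Ws].

Lemma orbP n g : reflect (exists2 w, w \in Ws & g = n *m w) (g \in orb n).
Proof. by rewrite mem_undup; apply: (iffP mapP) => -[w wW ->]; exists w. Qed.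
Lemma orb_uniq n : uniq (orb n). Proof. exact: undup_uniq. Qed.
Lemma orb_refl n : n \in orb n.
Proof. by apply/orbP; exists 1%:M; rewrite ?(W1 CD) ?mulmx1. Qed.
Lemma orbW n g w : w \in Ws -> g \in orb n -> g *m w \in orb n.
Proof.
move=> wW /orbP[u uW ->]; apply/orbP; exists (u *m w); first exact: (WsM CD).
by rewrite mulmxA.
Qed.
Lemma orb_sref n g i : g \in orb n -> g *m s_ i \in orb n.
Proof. exact/orbW/(Ws_sref CD). Qed.
Lemma orb_root n g : n \in R -> g \in orb n -> g \in R.
Proof. by move=> nR /orbP[w wW ->]; rewrite (rootWE CD). Qed.
Lemma orb_bf n g : g \in orb n -> bf g g = bf n n.
Proof. by move=> /orbP[w wW ->]; rewrite (bf_W CD). Qed.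
Lemma orb_dom n g : dom n -> dom g -> g \in orb n -> g = n.
Proof. by move=> dn dg /orbP[w wW e]; rewrite e; apply: (dom_uniq CD); rewrite -?e. Qed.
Lemma perm_orb n i : perm_eq [seq g *m s_ i | g <- orb n] (orb n).
Proof.
apply: uniq_perm; rewrite ?orb_uniq //.
  rewrite map_inj_uniq ?orb_uniq // => u v; exact: (W_inj CD (Ws_sref CD i)).
move=> g; apply/mapP/idP => [[b bO ->]|gO]; first exact: orb_sref.
by exists (g *m s_ i); rewrite ?(srefK CD) // orb_sref.
Qed.

(** On the orbit of a dominant vector this is the length of the shortest element of [W] taking that
    vector to [g]. *)
Definition ell (g : V) : nat := count (fun b => bf g b < 0) Rp.

Lemma ell_sref g i : cp i g < 0 -> ell g = (ell (g *m s_ i)).+1.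
Proof.
move=> ci; rewrite /ell !(permP (perm_pos_simple CD i)) /=.
have di := symm_gt0 CD i.
rewrite !(bfC CD _ (a_ i)) !bf_simple (cp_sref CD) pmulr_rlt0 // ci.
rewrite mulrN oppr_lt0 pmulr_rgt0 // ltNge (ltW ci) /= add0n add1n; congr _.+1.
rewrite -[in RHS](permP (perm_rem_sref CD i)) count_map; apply: eq_count => b /=.
by rewrite (bf_sref CD).
Qed.

Lemma ell_dom n : dom n -> ell n = 0%N.
Proof.
move=> dn; apply/eqP; rewrite -leqn0 leqNgt -has_count; apply/hasPn => b bp.
by rewrite -leNgt (bfC CD) (dom_bf CD) // (pos_nneg bp).
Qed.

Lemma ell_values (f : V -> {poly int}) n c : dom n -> f n = c ->
  (forall g i, g \in orb n -> cp i g < 0 -> f g = 'X * f (g *m s_ i)) ->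
  forall g, g \in orb n -> f g = c * 'X^(ell g).
Proof.
move=> dn fn fs g; have [m] := ubnP (ell g); elim: m g => // m IH g; rewrite ltnS => gm gO.
have [dg|] := boolP (dom g).
  by rewrite (orb_dom dn dg gO) fn ell_dom // mulr1.
rewrite negb_forall => /existsP[i]; rewrite -ltNge => ci.
rewrite (fs _ i) // (ell_sref ci) exprS mulrCA IH ?orb_sref //.
by rewrite (ell_sref ci) in gm.
Qed.

Lemma orbN n g : n \in R -> g \in orb n -> - g \in orb n.
Proof.
move=> nR gO; have gR := orb_root nR gO; have [M MW hM] := root_refl CD gR.
have := orbW MW gO; rewrite hM /cartan_int mulfK ?gt_eqF ?(root_bf_gt0 CD) //.
by rewrite scaler_nat mulr2n opprD addNKr.
Qed.

Lemma string_mid g i : g \in R -> g != - a_ i -> cp i g <= -2 ->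
  [/\ g *m s_ i - a_ i \in R, g + a_ i \in R,
     bf (g *m s_ i - a_ i) (g *m s_ i - a_ i) = bf (g + a_ i) (g + a_ i) &
     2 * bf (g + a_ i) (g + a_ i) <= bf g g].
Proof.
move=> gR gn ci; have aR := simple_root_in CD i; have di := symm_gt0 CD i.
pose n := g *m s_ i - a_ i.
have gsR : g *m s_ i \in R by rewrite (root_sref CD).
have nE : n + a_ i = g *m s_ i by rewrite subrK.
have cgs : cp i (g *m s_ i) = - cp i g by rewrite (cp_sref CD).
have nR : n \in R.
  apply: (root_diff CD) => //; first by rewrite (bfC CD) bf_simple mulr_gt0 // cgs; lra.
  by apply: contra gn => /eqP e; rewrite -(srefK CD i g) e (sref_simple CD).
have ns : g + a_ i = n *m s_ i by rewrite mulmxBl (srefK CD) (sref_simple CD) opprK.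
have bn : 0 <= bf n (a_ i).
  rewrite (bfC CD) bf_simple; apply: mulr_ge0; first exact: ltW.
  by rewrite cpB cgs (cp_simple2 CD); lra.
have naR : n + a_ i \in R by rewrite nE.
have [_ l2] := len_add CD nR aR naR bn; rewrite nE (bf_sref CD) in l2.
by split=> //; rewrite ns ?(root_sref CD) ?(bf_sref CD).
Qed.

Section Steps.
Variable f : V -> {poly int}.
Hypotheses (fS : straight A f) (f00 : f 0 = 0).

(** The two middle terms of the relation at [g] belong to roots of at most half the squared length
    ([string_mid]), where [f] vanishes. *)
Lemma step_orb n g i : n \in R ->
  (forall x, x \in R -> 2 * bf x x <= bf n n -> f x = 0) ->
  g \in orb n -> cp i g < 0 -> f g = 'X * f (g *m s_ i).
Proof.
move=> nR fz gO ci; have gR := orb_root nR gO.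
have [->|gn] := eqVneq g (- a_ i).
  by rewrite (straight_simpleN CD fS) f00 mulr0 add0r mulNmx (sref_simple CD) opprK.
have [c1|c1] := eqVneq (cp i g) (-1); first by rewrite -(straight1 fS c1).
have c2 := int_lt0_le (int_cp A i (root_int CD gR)) ci c1.
have [r1 r2 l1 l2] := string_mid gR gn c2.
rewrite (orb_bf gO) in l2; have z1 := fz _ r2 l2.
have z2 : f (g *m s_ i - a_ i) = 0 by apply: fz; rewrite ?l1.
have := fS g i; rewrite z1 z2.
by rewrite mulr0 addr0 subr0 => /eqP; rewrite subr_eq0 => /eqP.
Qed.
End Steps.

Section Theta.
Variable theta : V.
Hypotheses (thR : theta \in R)
  (thmax : forall a, a \in R -> forall i, a 0 i <= theta 0 i)
  (Aind : indecomposable A).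

Local Notation f0 := (qmult A Ws 0).
Local Notation Mt := (qmult A Ws theta).
Local Notation M0 := (qmult A Ws theta 0).
Local Notation H := (nht theta).

Lemma f0_pos g : g \in Rp -> f0 g = 0.
Proof.
move=> gp; apply/eqP; apply: contraT => /(qmult0_le CD).
by rewrite (root_nnegN CD (pos_root gp)) gp.
Qed.

Lemma f0_neg g : g \in Rp -> f0 (- g) = ('X - 1) * 'X^((nht g).-1).
Proof.
apply: (neg_values CD (straight_qmult CD 0) (k := 0)) => i.
rewrite (straight_simpleN CD (straight_qmult CD 0)) (qmult00 CD).
by rewrite f0_pos ?(pos_simple CD) // mulr0 addr0 expr0.
Qed.

Lemma sum_f0 : \sum_(g <- R) f0 g = \sum_(g <- Rp) ('X - 1) * 'X^((nht g).-1).
Proof.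
rewrite (perm_big _ (perm_R_pos CD)) big_cat big_map /= big_seq big1 ?add0r.
  by apply: eq_big_seq => g; apply: f0_neg.
by move=> g; apply: f0_pos.
Qed.

Lemma MtE mu : Mt mu = r%:R * f0 mu + \sum_(g <- R) f0 (mu + g).
Proof. exact: (qmult_theta CD). Qed.

Lemma M0_sum : M0 = r%:R + \sum_(g <- R) f0 g.
Proof.
rewrite MtE (qmult00 CD) mulr1; congr (_ + _).
by apply: eq_bigr => g _; rewrite add0r.
Qed.

Lemma M0E : M0 = r%:R + \sum_(g <- Rp) ('X - 1) * 'X^((nht g).-1).
Proof. by rewrite M0_sum sum_f0. Qed.

Lemma th_nht n : n \in Rp -> (nht (theta - n) + nht n)%N = H.
Proof.
move=> np; have nR := pos_root np.
have ti : intv (theta - n) by apply/intvD/intvN; apply: (root_int CD).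
by rewrite -(nhtD ti (pos_int CD np) (th_ge thmax nR) (pos_nneg np)) subrK.
Qed.

(** In the sum of [f0 (n - g)] only roots [g >= n] count. The root [n] gives 1, the others give
    [(q - 1) q^(ht (g - n) - 1)] once for each height up to [H - ht n], and the sum telescopes. *)
Lemma Mt_dom n : n \in R -> dom n -> Mt n = 'X^(H - nht n).
Proof.
move=> nR dn; have np := dom_pos CD nR dn.
rewrite MtE f0_pos // mulr0 add0r -(perm_big _ (perm_RN CD)) big_map.
rewrite (bigD1_seq n) ?root_uniq //= subrr (qmult00 CD).
have -> : \sum_(g <- R | g != n) f0 (n - g) =
    ('X - 1) * \sum_(g <- R | nneg (g - n) && (g != n)) 'X^((nht (g - n)).-1).
  rewrite mulr_sumr big_mkcondl big_seq_cond [RHS]big_seq_cond.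
  apply: eq_bigr => g /andP[gR gn]; case: ifPn => nn.
    by rewrite -opprB f0_neg // (above_diff CD).
  by apply/eqP; apply: contraNT nn => /(qmult0_le CD); rewrite opprB.
rewrite (above_sum CD nR dn _ thR) => [|a aR]; last exact: (th_ge thmax aR).
by rewrite -subrX1 -(th_nht np) addnK addrC subrK.
Qed.

(** The correction makes the function vanish at 0 without changing it on positive roots; it is
    written as a sum so that [straightD] and [straightZ] apply directly. *)
Definition Theta mu := Mt mu + (- M0) * f0 mu.

Lemma ThetaE mu : Theta mu = Mt mu - M0 * f0 mu.
Proof. by rewrite /Theta mulNr. Qed.

Lemma straight_Theta : straight A Theta.
Proof. by apply: straightD; [|apply: straightZ]; apply: (straight_qmult CD). Qed.
Lemma Theta0 : Theta 0 = 0.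
Proof. by rewrite ThetaE (qmult00 CD) mulr1 subrr. Qed.
Lemma Theta_dom n : n \in R -> dom n -> Theta n = 'X^(H - nht n).
Proof.
by move=> nR dn; rewrite ThetaE f0_pos ?(dom_pos CD) // mulr0 subr0 Mt_dom.
Qed.

Lemma nht_le g : g \in Rp -> (nht g <= H)%N.
Proof. by move=> gp; rewrite -(th_nht gp) leq_addl. Qed.

Lemma Theta_pos g : g \in Rp -> Theta g = 'X^(H - nht g).
Proof. apply: (pos_values CD straight_Theta nht_le); exact: Theta_dom. Qed.

Lemma Theta_neg g : g \in Rp -> Theta (- g) = 'X^(H + (nht g).-1).
Proof.
rewrite -[RHS]mul1r; apply: (neg_values CD straight_Theta) => i.
have ap := pos_simple CD i.
rewrite (straight_simpleN CD straight_Theta) Theta0 mulr0 add0r mul1r Theta_pos //.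
rewrite -exprS nht_simple; congr 'X^_.
by have := nht_le ap; rewrite nht_simple; case: (H) => // m _; rewrite subn1.
Qed.

Definition Theta_sum := \sum_(g <- R) Theta g.
Local Notation Y := Theta_sum.

Lemma Theta_sumE : Y = \sum_(g <- Rp) ('X^(H - nht g) + 'X^(H + (nht g).-1)).
Proof.
rewrite /Theta_sum (perm_big _ (perm_R_pos CD)) big_cat big_map [RHS]big_split /=.
by rewrite (eq_big_seq _ Theta_pos) (eq_big_seq _ Theta_neg).
Qed.

Lemma sum_Mt : \sum_(g <- R) Mt g = Y + M0 * (M0 - r%:R).
Proof.
have -> : M0 - r%:R = \sum_(g <- R) f0 g by rewrite M0_sum addrC addKr.
by rewrite mulr_sumr -big_split; apply: eq_bigr => g _; rewrite /= ThetaE subrK.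
Qed.

(** All roots are conjugate to [theta] and of equal length, so the vanishing required by [step_orb]
    is vacuous. *)
Lemma Theta_sum_simply_laced : (forall n, n \in R -> dom n -> n = theta) ->
  Y = \sum_(g <- orb theta) 'X^(ell g).
Proof.
move=> one; have rO x : x \in R -> x \in orb theta.
  move=> xR; have [w wW dw] := root_dom CD xR.
  rewrite -(WK CD x wW); apply: orbW (WsV CD wW) _.
  by rewrite (one _ _ dw) ?orb_refl // (rootWE CD).
have pR : perm_eq R (orb theta).
  apply: uniq_perm; rewrite ?root_uniq ?orb_uniq // => x.
  by apply/idP/idP => [/rO//|/(orb_root thR)].
rewrite /Theta_sum (perm_big _ pR); apply: eq_big_seq => g gO.
have dt := dom_th CD thR thmax.
rewrite (ell_values dt (Theta_dom thR dt) _ gO) ?subnn ?mul1r // => x i xO ci.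
apply: (step_orb straight_Theta Theta0 thR _ xO ci) => y yR; rewrite (orb_bf (rO _ yR)).
by have := root_bf_gt0 CD thR; move: (bf _ _) => z z0 h; exfalso; lra.
Qed.

(** On the short orbit [Theta] is [q^k q^ell] and [Xi] is [q^ell]. Their combination
    [D = Theta - q^k Xi] therefore vanishes on short roots, so [step_orb] applies to it on the long
    orbit, where it equals [q^ell]. *)
Lemma Theta_sum_two_lengths n : n \in R -> dom n -> n != theta ->
  Y = \sum_(g <- orb theta) 'X^(ell g) +
      'X^(H - nht n) * ('X^(H - nht n) * \sum_(g <- orb n) 'X^(ell g)).
Proof.
move=> nR dn nt; set k := (H - nht n)%N; have dt := dom_th CD thR thmax.
have np := dom_pos CD nR dn; have thp := dom_pos CD thR dt.
have tn : theta != n by rewrite eq_sym.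
have [_ ln] := above_len CD nR dn thR (th_ge thmax nR) tn.
have n0 := root_bf_gt0 CD nR.
have rO x : x \in R -> (x \in orb theta) || (x \in orb n).
  move=> xR; have [w wW dw] := root_dom CD xR.
  have yR : x *m w \in R by rewrite (rootWE CD).
  have [e|ne] := eqVneq (x *m w) theta.
    by rewrite -(WK CD x wW) e orbW ?(WsV CD) ?orb_refl.
  have e := dom_two CD thR thmax Aind yR nR dw dn ne nt.
  by rewrite -(WK CD x wW) e (orbW (WsV CD wW) (orb_refl n)) orbT.
have dis x : x \in orb n -> x \notin orb theta.
  move=> xn; apply/negP => /orb_bf; rewrite (orb_bf xn) => e.
  by move: ln n0; rewrite -e; move: (bf _ _) => z; lra.
have pR : perm_eq R (orb theta ++ orb n).
  apply: uniq_perm; rewrite ?root_uniq // ?cat_uniq ?orb_uniq ?andbT /=.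
    by apply/hasPn.
  move=> x; rewrite mem_cat; apply/idP/idP => [/rO//|/orP[]/orb_root]; exact.
have small x : x \in R -> 2 * bf x x <= bf n n -> False.
  move=> xR; case/orP: (rO _ xR) => /orb_bf->; move: ln n0; move: (bf n n) (bf _ _) => u v; lra.
pose N mu := \sum_(g <- orb n) f0 (mu + g).
have NS : straight A N := straight_conv (straight_qmult CD 0) (perm_orb n).
pose Xi mu := N mu + (- N 0) * f0 mu.
have XS : straight A Xi := straightD NS (straightZ _ (straight_qmult CD 0)).
have Xi0 : Xi 0 = 0 by rewrite /Xi (qmult00 CD) mulr1 subrr.
(* A term [f0 (n + g)] can be nonzero only if [- g >= n]; roots strictly above [n] are longer than
   [n], so only [g = - n] in its orbit contributes. *)
have Xin : Xi n = 1.
  rewrite /Xi f0_pos // mulr0 addr0 /N (bigD1_seq (- n)) ?orb_uniq ?orbN ?orb_refl //=.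
  rewrite subrr (qmult00 CD) big_seq_cond big1 ?addr0 // => g /andP[gO gn].
  apply/eqP; apply: contraT => /(qmult0_le CD); rewrite opprD addrC => h.
  have gO' := orbN nR gO; have gR' := orb_root nR gO'.
  have [|_] := above_len CD nR dn gR' h; first by rewrite -eqr_opp opprK.
  by rewrite (orb_bf gO'); move: n0; move: (bf _ _) => z z0 h1; exfalso; lra.
have Xit : Xi theta = 0.
  rewrite /Xi f0_pos // mulr0 addr0 /N big_seq big1 // => g gO.
  apply/eqP; apply: contraT => /(qmult0_le CD); rewrite opprD addrC => h.
  have gO' := orbN nR gO; have gR' := orb_root nR gO'.
  have := nneg_anti h; rewrite opprB => /(_ (th_ge thmax gR')) /eqP.
  rewrite subr_eq0 => /eqP e; have := dis _ gO'.
  by rewrite e orb_refl.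
have stepn (f : V -> {poly int}) : straight A f -> f 0 = 0 -> forall g i,
    g \in orb n -> cp i g < 0 -> f g = 'X * f (g *m s_ i).
  move=> fS f00 g i; apply: (step_orb fS f00 nR) => x xR /(small x xR); by [].
have Xis g : g \in orb n -> Xi g = 'X^(ell g).
  by move=> gO; rewrite (ell_values dn Xin (stepn _ XS Xi0) gO) mul1r.
have Ths g : g \in orb n -> Theta g = 'X^k * 'X^(ell g).
  by apply: (ell_values dn (Theta_dom nR dn) (stepn _ straight_Theta Theta0)).
pose D mu := Theta mu + (- 'X^k) * Xi mu.
have DS : straight A D := straightD straight_Theta (straightZ _ XS).
have D0 : D 0 = 0 by rewrite /D Theta0 Xi0 mulr0 addr0.
have Dn g : g \in orb n -> D g = 0.
  by move=> gO; rewrite /D Ths // Xis // mulNr subrr.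
have Dt g : g \in orb theta -> D g = 'X^(ell g).
  move=> gO; have Dth : D theta = 1 by rewrite /D Xit mulr0 addr0 Theta_dom // subnn.
  rewrite (ell_values dt Dth _ gO) ?mul1r // => x i xO ci.
  apply: (step_orb DS D0 thR _ xO ci) => y yR hy.
  case/orP: (rO _ yR) => [/orb_bf e|]; last exact: Dn.
  by move: hy (root_bf_gt0 CD thR); rewrite e; move: (bf _ _) => z h1 z0; exfalso; lra.
have sumD : \sum_(g <- R) D g = \sum_(g <- orb theta) 'X^(ell g).
  rewrite (perm_big _ pR) big_cat /= [X in _ + X]big_seq [X in _ + X]big1 ?addr0; last exact: Dn.
  exact: eq_big_seq.
(* Both sides contain the sum of [f0 (x + g)] over all roots [x] and all short roots [g], and the
   correction terms agree because [f0] sums to [M0 - r] over the roots. *)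
have sumXi : \sum_(g <- R) Xi g = \sum_(g <- orb n) Theta g.
  rewrite big_split /= /N exchange_big /= -mulr_sumr.
  have -> : \sum_(g <- R) f0 g = M0 - r%:R by rewrite M0_sum addrC addKr.
  rewrite mulNr mulr_suml -sumrB; apply: eq_bigr => g _.
  rewrite ThetaE (MtE g) add0r.
  under eq_bigr => x _ do rewrite addrC.
  ring.
rewrite -sumD mulr_sumr (eq_big_seq _ (fun g gO => esym (Ths g gO))) -sumXi.
rewrite mulr_sumr -big_split; apply: eq_bigr => g _ /=.
by rewrite /D mulNr subrK.
Qed.
End Theta.
End Orbits.

(** * Macdonald's identity *)

Section Macdonald.
Variables (r : nat) (A : 'M[int]_r) (d : 'rV[rat]_r) (Ws : seq 'M[rat]_r).
Hypothesis CD : cartan_datum A d Ws.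

Local Notation V := 'rV[rat]_r.
Local Notation a_ i := (simple_root i).
Local Notation s_ i := (sref A i).
Local Notation R := (rootsW Ws).
Local Notation Rp := (posroots Ws).
Local Notation cp := (spair A).
Local Notation rho := (rho Ws).
Local Notation eps := (sgnW Ws).
Local Notation nv := (ninv Ws).
Local Notation J := (altsum Ws).

Definition psum (P : pred V) : V := \sum_(b <- Rp | P b) b.

Lemma psum_nneg P : nneg (psum P).
Proof.
rewrite /psum big_seq_cond; apply: nneg_sum => b /andP[bp _]; exact: pos_nneg bp.
Qed.

Lemma psum_int P : intv (psum P).
Proof.
rewrite /psum big_seq_cond; apply: (big_ind (fun v : V => intv v)).
- by move=> i; rewrite mxE rpred0.
- by move=> u v; apply: intvD.
by move=> b /andP[bp _]; apply: (pos_int CD).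
Qed.

(** [rho - psum P] is half the sum of the positive roots with signs, negative on [P]. The reflection
    flips the sign of [a_i] and permutes the others. *)
Lemma psum_sref P i : (rho - psum P) *m s_ i =
  rho - psum (fun b => if b == a_ i then ~~ P b else P (b *m s_ i)).
Proof.
rewrite mulmxBl (rho_sref CD) /psum !(perm_big _ (perm_pos_simple CD i)) !big_cons eqxx.
have -> : \sum_(b <- rem (a_ i) Rp | if b == a_ i then ~~ P b else P (b *m s_ i)) b =
   (\sum_(b <- rem (a_ i) Rp | P b) b) *m s_ i.
  rewrite mulmx_suml -(perm_big _ (perm_rem_sref CD i)) big_map.
  rewrite big_seq_cond [RHS]big_seq_cond; apply: eq_bigl => b.
  case: (boolP (b \in _)) => //= br; rewrite (srefK CD); case: eqP => // e.
  have := br; rewrite mem_rem_uniq ?pos_uniq // inE /= => /andP[bi bp].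
  have := pos_sref CD bp bi; rewrite e => _.
  have : - a_ i \in Rp.
    by rewrite -(sref_simple CD) -e (srefK CD).
  by rewrite (root_negE CD) ?(simple_root_in CD) // (pos_simple CD).
case: (P (a_ i)); rewrite /= ?mulmxDl ?(sref_simple CD); apply/rowP => j; rewrite !mxE; ring.
Qed.

(** Reflect in a simple root whose pairing with [rho - psum P] is negative; this lowers the height
    of [psum P]. A zero pairing kills the alternating sum, and if all pairings are positive then
    [psum P] is antidominant, hence 0. *)
Lemma altsum_psum P : (forall phi, J phi (rho - psum P) = 0) \/
  exists2 w, w \in Ws & rho - psum P = rho *m w.
Proof.
have [m] := ubnP (nht (psum P)); elim: m P => // m IH P; rewrite ltnS => Pm.
pose k := rho - psum P.
have ik i : cp i k \is a Num.int.
  by rewrite cpB (cp_rho CD) rpredB ?rpred1 // int_cp // ; apply: psum_int.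
have [h|] := boolP [forall i, 0 < cp i k].
  right; exists 1%:M; rewrite ?(W1 CD) // mulmx1.
  have : nneg (- psum P).
    apply: (antidom_le CD) => i; have := int_ge1 (ik i) (forallP h i).
    by rewrite cpB (cp_rho CD); lra.
  by move=> /(nneg_anti (psum_nneg P))->; rewrite subr0.
rewrite negb_forall => /existsP[i]; rewrite -leNgt => ci.
have [c0|c0] := eqVneq (cp i k) 0; first by left=> phi; apply: altsum_fixed CD _ _ _ c0.
pose P' b := if b == a_ i then ~~ P b else P (b *m s_ i).
have e : k *m s_ i = rho - psum P' by apply: psum_sref.
have e1 : psum P = psum P' + (- cp i k) *: a_ i.
  move: e; rewrite srefE /k => /(congr1 (fun v => rho - v)) e2.
  have -> : psum P' = rho - (rho - psum P - cp i k *: a_ i) by rewrite e2 opprB addrC subrK.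
  by apply/rowP => j; rewrite !mxE; ring.
have [n cn n0] : exists2 n, - cp i k = n%:R & (0 < n)%N.
  by apply: int_nat; [rewrite rpredN|rewrite oppr_gt0 lt_neqAle c0].
have Pm' : (nht (psum P') < m)%N.
  apply: leq_trans Pm; rewrite e1 cn nht_addZ; [|exact: psum_int|exact: psum_nneg].
  by rewrite -addn1 leq_add2l.
have [h|[w wW h]] := IH _ Pm'; [left|right].
  move=> phi; apply/eqP; rewrite -oppr_eq0 -(altsum_sref CD phi i) -/k e; exact/eqP.
exists (w *m s_ i); first by rewrite (WsM CD) ?(Ws_sref CD).
by rewrite mulmxA -h -e (srefK CD).
Qed.

(** [P] and the inversion set [N] of the inverse of [w] have the same sum. After applying that
    inverse and taking heights, each root lying in just one of them contributes to the difference
    the absolute value of a nonzero height, so there is none. *)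
Lemma psum_inv P w : w \in Ws -> rho - psum P = rho *m w ->
  forall b, b \in Rp -> P b = nneg (- (b *m invmx w)).
Proof.
move=> wW e b bp; have wV := WsV CD wW.
pose N b := nneg (- (b *m invmx w)).
have e1 : psum P = psum N.
  by rewrite /psum -(rho_sub CD wW) -e opprB addrC subrK.
have Rw x : x \in Rp -> x *m invmx w \in R by move=> xp; rewrite (rootWE CD) // pos_root.
pose t x := if P x == N x then 0 else `|ht (x *m invmx w)|.
have : \sum_(x <- Rp) t x = 0.
  transitivity (ht ((psum P - psum N) *m invmx w)); last first.
    by rewrite e1 subrr mul0mx ht0.
  rewrite mulmxBl htB /psum !mulmx_suml.
  have hs (Q : pred V) : ht (\sum_(x <- Rp | Q x) x *m invmx w) =
      \sum_(x <- Rp) (if Q x then ht (x *m invmx w) else 0).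
    by rewrite (big_morph (@ht r) (@htD r) (ht0 r)) big_mkcond.
  rewrite !hs -sumrB; apply: eq_big_seq => x xp; rewrite /t.
  have := root_nnegN CD (Rw _ xp); rewrite -/(N x) posP Rw //= => Nx.
  case: (boolP (N x)) => nx.
    have h0 : ht (x *m invmx w) <= 0 by rewrite -oppr_ge0 -htN ht_ge0.
    by case: (P x); rewrite /= ?subrr // sub0r ler0_norm.
  have h0 : 0 <= ht (x *m invmx w) by apply: ht_ge0; move: nx; rewrite Nx negbK.
  by case: (P x); rewrite /= ?subrr // subr0 ger0_norm.
move=> /eqP; rewrite psumr_eq0 => [|x _]; last by rewrite /t; case: ifP.
move=> /allP/(_ b bp); rewrite /t; case: (eqVneq (P b) (N b)) => //= _; rewrite normr_eq0 => /eqP h0.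
have := Rw _ bp => bR; have := root_neq0 CD bR.
have [n|n] := root_sign CD bR; first by rewrite (ht_eq0 n h0) eqxx.
by rewrite -oppr_eq0 (ht_eq0 n) ?eqxx // htN h0 oppr0.
Qed.

Lemma rho_inj w u : w \in Ws -> u \in Ws -> rho *m w = rho *m u -> w = u.
Proof.
move=> wW uW e; have : rho *m (w *m invmx u) = rho.
  by rewrite mulmxA e (WK CD).
move=> /(rho_fix CD (WsM CD wW (WsV CD uW))) h.
by rewrite -[w](mulmxKV (Ws_unit CD uW)) h mul1mx.
Qed.

Section Monomials.
Variable x : 'I_r -> {poly int}.
(** The image of [e^v] under [e^(a_i) |-> x i], meaningful for integral [v] in the positive cone. *)
Definition mon (v : V) : {poly int} := \prod_i x i ^+ absz (numq (v 0 i)).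

Lemma mon0 : mon 0 = 1.
Proof. by rewrite /mon big1 // => i _; rewrite mxE expr0. Qed.

Lemma monD u v : intv u -> intv v -> nneg u -> nneg v -> mon (u + v) = mon u * mon v.
Proof.
move=> iu iv /nnegP nu /nnegP nv; rewrite /mon -big_split /=; apply: eq_bigr => i _.
rewrite -exprD; congr (_ ^+ _); rewrite mxE.
have := nu i; have := nv i; have /intrP[m ->] := iu i; have /intrP[n ->] := iv i.
by rewrite -intrD !numq_int !ler0z => n0 m0; lia.
Qed.

Lemma mon_sum (I : finType) (F : I -> V) : (forall i, intv (F i)) -> (forall i, nneg (F i)) ->
  mon (\sum_i F i) = \prod_i mon (F i).
Proof.
move=> iF nF; suff [] : [/\ intv (\sum_i F i), nneg (\sum_i F i) &
    mon (\sum_i F i) = \prod_i mon (F i)] by [].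
elim/big_rec2: _ => [|i p v _ [iv nv <-]].
  by split; rewrite ?mon0 ?nneg0 // => i; rewrite mxE rpred0.
split; [exact: intvD|exact: nnegD|exact: monD].
Qed.
End Monomials.

Section Subsets.
Variables (a : pred V) (q : {poly int}).
Local Notation n := (size Rp).
(** Sets of positive roots are coded as sets of positions in [Rp], the form needed to expand a
    product with [bigA_distr]. *)
Definition bt (j : 'I_n) : V := Rp`_j.
Definition setp (I : {set 'I_n}) : pred V :=
  fun b => [exists j : 'I_n, (j \in I) && (bt j == b)].
Definition wgt (j : 'I_n) : {poly int} := if a (bt j) then - q else 0.
Definition wt (I : {set 'I_n}) := \prod_j (if j \in I then wgt j else 1).

Lemma bt_in j : bt j \in Rp. Proof. exact: mem_nth. Qed.
Lemma bt_inj : injective bt.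
Proof.
move=> i j /eqP; rewrite /bt nth_uniq ?pos_uniq // => /eqP; exact: val_inj.
Qed.
Lemma btP b : b \in Rp -> exists j, b = bt j.
Proof.
move=> bp; have jn : (index b Rp < n)%N by rewrite index_mem.
by exists (Ordinal jn); rewrite /bt nth_index.
Qed.
Lemma setp_bt I j : setp I (bt j) = (j \in I).
Proof.
apply/existsP/idP => [[i /andP[iI /eqP/bt_inj<-]] //|jI].
by exists j; rewrite jI eqxx.
Qed.
Lemma sum_bt (P : pred V) (F : V -> V) :
  \sum_(b <- Rp | P b) F b = \sum_(j | P (bt j)) F (bt j).
Proof. by rewrite (big_nth 0) big_mkord. Qed.
Lemma prod_bt (F : V -> {poly int}) : \prod_(b <- Rp) F b = \prod_j F (bt j).
Proof. by rewrite (big_nth 0) big_mkord. Qed.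

Definition inv_in (w : 'M[rat]_r) := all (fun b => nneg (- (b *m w)) ==> a b) Rp.
Definition macdonald_sum : {poly int} :=
  \sum_(w <- Ws) (if inv_in (invmx w) then q ^+ nv (invmx w) else 0).

Lemma wt_inv w : w \in Ws ->
  wt [set j | nneg (- (bt j *m invmx w))] * (eps w)%:P =
  (if inv_in (invmx w) then q ^+ nv (invmx w) else 0).
Proof.
move=> wW; rewrite -(epsV CD wW) /sgnW; case: ifPn => h.
  have -> : wt [set j | nneg (- (bt j *m invmx w))] =
      \prod_(b <- Rp) (if nneg (- (b *m invmx w)) then - q else 1).
    rewrite prod_bt; apply: eq_bigr => j _; rewrite inE; case: ifP => // nj.
    by have := allP h _ (bt_in j); rewrite /wgt nj /= => ->.
  rewrite -big_mkcond big_const_seq iter_mulr_1 -/(nv (invmx w)).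
  by rewrite rmorphXn /= polyCN -exprMn mulrN1 opprK.
case/allPn: h => b bp; rewrite negb_imply => /andP[nb nab].
have [j ej] := btP bp; rewrite /wt (bigD1 j) //= inE -ej nb /wgt -ej (negPf nab).
by rewrite !mul0r.
Qed.

(** By [altsum_psum] and [psum_inv] only inversion sets survive, one for each [w]; the sign in
    [(-q)^#|I|] cancels that of [w]. *)
Lemma macdonald_altsum phi :
  \sum_I wt I * J phi (rho - psum (setp I)) = macdonald_sum * J phi rho.
Proof.
transitivity (\sum_I \sum_(w <- Ws)
    (if rho - psum (setp I) == rho *m w then wt I * J phi (rho *m w) else 0)).
  apply: eq_bigr => I _; have [h|[w wW e]] := altsum_psum (setp I).
    rewrite h mulr0 big1 // => w _; case: eqP => // e.
    by rewrite -e h mulr0.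
  rewrite (bigD1_seq w) ?(weyl_uniq CD) //= e eqxx big_seq_cond big1 ?addr0 //.
  move=> u /andP[uW nuw]; case: eqP => // e2; have := rho_inj wW uW e2 => e3.
  by rewrite e3 eqxx in nuw.
rewrite exchange_big /= /macdonald_sum mulr_suml; apply: eq_big_seq => w wW.
pose Iw := [set j | nneg (- (bt j *m invmx w))].
rewrite (bigD1 Iw) //= big1 ?addr0 => [|I nI]; last first.
  case: eqP => // e; case/eqP: nI; apply/setP => j.
  by rewrite inE -setp_bt (psum_inv wW e) ?bt_in.
have -> : rho - psum (setp Iw) == rho *m w.
  rewrite subr_eq addrC -subr_eq (rho_sub CD wW) /psum.
  apply/eqP; rewrite !(sum_bt _ id); apply: eq_bigl => j.
  by rewrite setp_bt inE.
by rewrite (altsum_W CD) // mulrA wt_inv.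
Qed.

Variable x : 'I_r -> {poly int}.
Definition hin (w : 'M[rat]_r) (b : V) := if nneg (- (b *m w)) then 1 else mon x (b *m w).
Definition hout (w : 'M[rat]_r) (b : V) := if nneg (- (b *m w)) then mon x (- (b *m w)) else 1.

(* Macdonald's identity for sum_w w(prod_(b | a b) (1 - q e^b) / prod_b (1 - e^b)),
   multiplied by the Weyl denominator; [hin] and [hout] multiply the factor
   1 - q e^(b w) by e^(- b w) when b w < 0, and [x i] is the image of e^(a_ i). *)
Lemma macdonald_identity : \sum_(w <- Ws) (eps w)%:P *
    \prod_(b <- Rp) ((if a b then - q else 0) * hin w b + hout w b) =
  macdonald_sum * \sum_(w <- Ws) (eps w)%:P * mon x (rho - rho *m w).
Proof.
rewrite -[RHS](macdonald_altsum (fun v => mon x (rho - v))) /altsum.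
under [RHS]eq_bigr => I _ do rewrite mulr_sumr.
rewrite exchange_big /=; apply: eq_big_seq => w wW.
rewrite prod_bt bigA_distr mulr_sumr; apply: eq_bigr => I _.
rewrite mulrCA; congr (_ * _).
have Rw j : bt j *m w \in R by rewrite (rootWE CD) // pos_root // bt_in.
have -> : rho - (rho - psum (setp I)) *m w =
    \sum_j (if nneg (- (bt j *m w)) then (if j \in I then 0 else - (bt j *m w))
            else (if j \in I then bt j *m w else 0)).
  rewrite mulmxBl opprB addrA addrAC.
  rewrite (rho_sub_neg CD) // (sum_bt _ (fun b => - (b *m w))) /psum mulmx_suml (sum_bt _ (fun b => b *m w)).
  rewrite big_mkcond [X in _ + X]big_mkcond -big_split; apply: eq_bigr => j _ /=.
  rewrite setp_bt; case: (nneg _); case: (j \in I); rewrite ?addr0 ?add0r //.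
  by rewrite addNr.
rewrite mon_sum => [|j|j].
- rewrite /wt -big_split; apply: eq_bigr => j _ /=; rewrite /hin /hout /wgt.
  by case: (nneg _); case: (j \in I); rewrite ?mul1r ?mon0 ?mulr1.
- case: ifP => _; case: ifP => _; first by move=> i; rewrite mxE rpred0.
  + by apply/intvN/(root_int CD).
  + exact/(root_int CD).
  by move=> i; rewrite mxE rpred0.
case: ifP => n; case: ifP => _; rewrite ?nneg0 //.
by have := root_nnegN CD (Rw j); rewrite n posP Rw => /esym/negbFE.
Qed.
End Subsets.
End Macdonald.

(** * Specializations: Weyl's denominator formula and products over heights *)

Section MacEval.
Variables (r : nat) (A : 'M[int]_r) (d : 'rV[rat]_r) (Ws : seq 'M[rat]_r).
Hypothesis CD : cartan_datum A d Ws.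

Local Notation V := 'rV[rat]_r.
Local Notation a_ i := (simple_root i).
Local Notation s_ i := (sref A i).
Local Notation R := (rootsW Ws).
Local Notation Rp := (posroots Ws).
Local Notation cp := (spair A).
Local Notation bf := (bform A d).
Local Notation dom := (dominant A).
Local Notation rho := (rho Ws).
Local Notation eps := (sgnW Ws).
Local Notation nv := (ninv Ws).
Local Notation absr := (absroot Ws).

Lemma perm_WsV : perm_eq [seq invmx w | w <- Ws] Ws.
Proof.
apply: uniq_perm; rewrite ?(weyl_uniq CD) ?(map_inj_uniq (can_inj (@invmxK _ _))) ?(weyl_uniq CD) //.
move=> w; apply/mapP/idP => [[u uW ->]|wW]; first exact: (WsV CD).
by exists (invmx w); rewrite ?invmxK // (WsV CD).
Qed.

Lemma macdonald_sumE a q : macdonald_sum Ws a q = \sum_(w <- Ws | inv_in Ws a w) q ^+ nv w.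
Proof.
rewrite /macdonald_sum [RHS]big_mkcond -[RHS](perm_big _ perm_WsV) big_map.
by [].
Qed.

Lemma natr_poly_neq0 n : (0 < n)%N -> (n%:R : {poly int}) != 0.
Proof. by move=> n0; rewrite -polyC_natr polyC_eq0 pnatr_eq0 -lt0n. Qed.

Lemma size_Ws : (0 < size Ws)%N.
Proof. by have := W1 CD; case: (Ws). Qed.

(** Macdonald's identity for [q = 1] with all roots allowed: every [w] contributes the same product,
    and the factor [#|W|] is cancelled from both sides. *)
Lemma weyl_denom (x : 'I_r -> {poly int}) :
  \sum_(w <- Ws) (eps w)%:P * mon x (rho - rho *m w) = \prod_(b <- Rp) (1 - mon x b).
Proof.
have := macdonald_identity CD predT 1 x; rewrite macdonald_sumE.
have -> : \sum_(w <- Ws | inv_in Ws predT w) 1 ^+ nv w = (size Ws)%:R :> {poly int}.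
  rewrite big_mkcond; under eq_bigr => w _.
    rewrite expr1n (_ : inv_in _ _ _); last by apply/allP => b _; rewrite implybT.
    over.
  by rewrite big_const_seq count_predT iter_addr_0.
have -> : \sum_(w <- Ws) (eps w)%:P *
    \prod_(b <- Rp) ((if predT b then - 1 else 0) * hin x w b + hout x w b) =
    (size Ws)%:R * \prod_(b <- Rp) (1 - mon x b).
  rewrite (eq_big_seq (fun=> \prod_(b <- Rp) (1 - mon x b))).
    by rewrite big_const_seq count_predT iter_addr_0 mulr_natl.
  move=> w wW /=; rewrite -[in RHS](perm_big _ (perm_absW CD wW)) big_map.
  have -> : \prod_(b <- Rp) (- 1 * hin x w b + hout x w b) =
     \prod_(b <- Rp) (if nneg (- (b *m w)) then - 1 else 1) *
     \prod_(b <- Rp) (1 - mon x (absr (b *m w))).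
    rewrite -big_split; apply: eq_big_seq => b bp /=; rewrite /hin /hout.
    case: ifPn => h; first by rewrite (absr_neg CD) //; ring.
    by rewrite (absr_pos CD) ?(negPf h) //; ring.
  rewrite mulrA -big_mkcond big_const_seq iter_mulr_1 -/(nv w) /sgnW.
  by rewrite rmorphXn /= polyCN -exprMn mulrNN mulr1 expr1n mul1r.
by move=> /(mulfI (natr_poly_neq0 size_Ws)).
Qed.

Lemma nhtS (v : V) : intv v -> nneg v -> (\sum_i absz (numq (v 0%R i)))%N = nht v.
Proof.
move=> iv nv'; apply/eqP; rewrite -(eqr_nat rat) nhtE // natr_sum /ht; apply/eqP.
apply: eq_bigr => i _; have := iv i; have /nnegP/(_ i) := nv' => + /intrP[m em].
by rewrite em numq_int ler0z natr_absz => m0; rewrite ger0_norm.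
Qed.

Lemma mon_X (v : V) : intv v -> nneg v -> mon (fun=> 'X) v = 'X^(nht v).
Proof. by move=> iv nv'; rewrite -nhtS // -prodrXr. Qed.

Section Dominant.
Variable n : V.
Hypothesis dn : dom n.
Local Notation inA b := (0 < bf n b).

Lemma inA_pos b : b \in R -> inA b -> b \in Rp.
Proof.
move=> bR h; apply: contraT; rewrite -(root_negE CD) // => np.
have := dom_bf CD (pos_nneg np) dn; rewrite bfNl (bfC CD) oppr_ge0 leNgt.
by rewrite h.
Qed.

(* The specialization that reduces Weyl's denominator formula to the stabilizer
   of [n]. *)
Definition xpar i : {poly int} := if cp i n == 0 then 'X else 0.

Lemma bf_dom_eq0 (v : V) : nneg v -> (bf n v == 0) = [forall i, (v 0 i == 0) || (cp i n == 0)].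
Proof.
move=> nv'; rewrite (bfC CD) psumr_eq0 => [|i _]; last first.
  apply: mulr_ge0; last exact/domP.
  by apply: mulr_ge0; [exact/nnegP|exact/ltW/(symm_gt0 CD)].
apply/allP/forallP => h i; have := h i.
  move=> /(_ (mem_index_enum i)) /=; rewrite !mulf_eq0 -orbA => /or3P[->//|e|->].
    by have := symm_gt0 CD i; rewrite (eqP e) ltxx.
  by rewrite orbT.
by rewrite !mulf_eq0 => /orP[->//|->]; rewrite !orbT.
Qed.

Lemma mon_par (v : V) : intv v -> nneg v ->
  mon xpar v = if bf n v == 0 then 'X^(nht v) else 0.
Proof.
move=> iv nv'; rewrite bf_dom_eq0 //; case: ifPn => [/forallP h|].
  rewrite -mon_X //; apply: eq_bigr => i _; rewrite /xpar.
  by have /orP[/eqP->|->//] := h i; rewrite !expr0.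
rewrite negb_forall => /existsP[i]; rewrite negb_or => /andP[vi ci].
rewrite /mon (bigD1 i) //= /xpar (negPf ci) expr0n absz_eq0.
have /intrP[m em] := iv i; rewrite em numq_int -(intr_eq0 rat) -em (negPf vi).
by rewrite mul0r.
Qed.

(** Hence [mon xpar (rho - rho *m w)] is nonzero exactly when [w] fixes [n]. The pairing equals that
    of [rho] with [n - n *m invmx w], a nonnegative vector, on which [rho] is strictly positive
    unless it is 0. *)
Lemma stab_rho w : w \in Ws -> (bf n (rho - rho *m w) == 0) = (n *m w == n).
Proof.
move=> wW; have wV := WsV CD wW.
have -> : bf n (rho - rho *m w) = bf (n - n *m invmx w) rho.
  by rewrite (bfBr CD) bfBl (bf_WV CD _ _ wV) invmxK.
have nn := dom_le CD dn wV; apply/eqP/eqP => [h|e]; last first.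
  by rewrite -{2}e (WK CD) // subrr bf0l.
suff e : n = n *m invmx w by rewrite {1}e (WVK CD).
apply/eqP; rewrite -subr_eq0; apply/eqP/rowP => i; rewrite [RHS]mxE.
move: h => /eqP; rewrite psumr_eq0 => [|j _]; last first.
  by rewrite (cp_rho CD) mulr1 mulr_ge0 //; [exact/nnegP|exact/ltW/(symm_gt0 CD)].
move=> /allP/(_ i (mem_index_enum i)); rewrite (cp_rho CD) mulr1 mulf_eq0.
by rewrite (gt_eqF (symm_gt0 CD i)) orbF => /eqP.
Qed.

Lemma rho_sub_int w : w \in Ws -> intv (rho - rho *m w).
Proof.
move=> wW; rewrite (rho_sub CD wW); exact: (psum_int CD).
Qed.

(* With e^(a_ i) = q for all i, a simple root [a_ i] with <n w, a_ i> < 0 gives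
   the vanishing factor 1 - q e^(- a_ i). *)
Lemma macdonald_term_moved w : w \in Ws -> n *m w != n ->
  \prod_(b <- Rp) ((if inA b then - 'X else 0) * hin (fun=> 'X) w b +
     hout (fun=> 'X) w b) = 0.
Proof.
move=> wW ne; have : ~~ dom (n *m w) by apply: contra ne => dw; rewrite (dom_uniq CD).
rewrite negb_forall => /existsP[i]; rewrite -ltNge => ci.
have wV := WsV CD wW; have aR := simple_root_in CD i.
pose b : V := - (a_ i *m invmx w).
have bR : b \in R by rewrite (rootNE CD) (rootWE CD).
have bw : b *m w = - a_ i by rewrite mulNmx (WVK CD).
have bA : inA b.
  rewrite -(bf_W CD _ _ wW) bw (bfNr CD) (bfC CD) bf_simple oppr_gt0.
  by rewrite pmulr_rlt0 // (symm_gt0 CD).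
rewrite (bigD1_seq b) ?pos_uniq ?inA_pos //= bA /hin /hout bw opprK nneg_simple.
rewrite mon_X ?nneg_simple //; last exact: intv_simple.
by rewrite nht_simple mulr1 addNr mul0r.
Qed.

(** An element fixing [n] permutes the roots with positive product with [n], and these are all
    positive. *)
Lemma macdonald_term_fixed w : w \in Ws -> n *m w = n ->
  \prod_(b <- Rp) ((if inA b then - 'X else 0) * hin (fun=> 'X) w b +
     hout (fun=> 'X) w b) =
  (\prod_(b <- Rp | inA b) (1 - 'X^((nht b).+1))) * 'X^(nht (rho - rho *m w)).
Proof.
move=> wW e; have bfw b : bf n (b *m w) = bf n b by rewrite -{1}e (bf_W CD).
have Rw b : b \in Rp -> b *m w \in R by move=> bp; rewrite (rootWE CD) // pos_root.
have -> : 'X^(nht (rho - rho *m w)) = \prod_(b <- Rp) hout (fun=> 'X) w b.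
  rewrite -mon_X ?(rho_le CD) //; last exact: rho_sub_int.
  rewrite (rho_sub_neg CD wW) (@sum_bt _ Ws _ (fun b => - (b *m w))) prod_bt.
  rewrite big_mkcond mon_sum => [|j|j].
  - by apply: eq_bigr => j _; rewrite /hout; case: ifP => // _; rewrite mon0.
  - case: ifP => _; first by apply/intvN/(root_int CD)/Rw/bt_in.
    by move=> i; rewrite mxE rpred0.
  by case: ifP; rewrite ?nneg0.
have -> : \prod_(b <- Rp | inA b) (1 - 'X^((nht b).+1)) =
    \prod_(b <- Rp | inA b) (1 - 'X^((nht (b *m w)).+1)) :> {poly int}.
  rewrite -[LHS]big_filter -[RHS]big_filter.
  rewrite -[RHS](big_map (fun b => b *m w) xpredT (fun b => 1 - 'X^((nht b).+1))).
  apply: perm_big; apply: uniq_perm; first exact/filter_uniq/pos_uniq.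
    rewrite map_inj_uniq; first exact/filter_uniq/pos_uniq.
    move=> u v; exact: (W_inj CD wW).
  move=> b; rewrite mem_filter; apply/idP/mapP => [/andP[bA bp]|[c]].
    have bw : b *m invmx w \in R by rewrite (rootWE CD) ?(WsV CD) // pos_root.
    exists (b *m invmx w); last by rewrite (WVK CD).
    have h : inA (b *m invmx w) by rewrite -bfw (WVK CD).
    by rewrite mem_filter h inA_pos.
  by rewrite mem_filter => /andP[cA cp] ->; rewrite bfw cA inA_pos ?bfw // Rw.
rewrite [X in X * _]big_mkcond -big_split; apply: eq_big_seq => b bp /=.
case: ifPn => bA; last by rewrite mul0r add0r mul1r.
have bwp : b *m w \in Rp by rewrite inA_pos ?Rw ?bfw.
have nn : nneg (- (b *m w)) = false by rewrite (root_nnegN CD) ?Rw // bwp.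
rewrite /hin /hout nn mon_X ?(pos_nneg bwp) //; last exact: (pos_int CD bwp).
by rewrite mulr1 mulNr -exprS addrC.
Qed.

Lemma prod_neq0 (P : pred V) : \prod_(b <- Rp | P b) (1 - 'X^(nht b)) != 0 :> {poly int}.
Proof.
rewrite big_seq_cond prodf_seq_neq0; apply/allP => b bp; apply/implyP => _.
apply/eqP => /(congr1 (fun p : {poly int} => p`_0)).
rewrite coefB coef1 coefXn coef0 eqxx eq_sym.
by have := nht_gt0 CD bp; case: (nht b).
Qed.

(** Only the stabilizer of [n] contributes, and [weyl_denom] at [xpar] sums it to the product over
    the positive roots orthogonal to [n]. The full denominator contains the same factor, which is
    cancelled. *)
Lemma macdonald_height : macdonald_sum Ws (fun b => inA b) 'X *
    \prod_(b <- Rp | inA b) (1 - 'X^(nht b)) =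
  \prod_(b <- Rp | inA b) (1 - 'X^((nht b).+1)).
Proof.
have := macdonald_identity CD (fun b => inA b) 'X (fun=> 'X); rewrite weyl_denom.
have -> : \prod_(b <- Rp) (1 - mon (fun=> 'X) b) =
   \prod_(b <- Rp | inA b) (1 - 'X^(nht b)) * \prod_(b <- Rp | bf n b == 0) (1 - 'X^(nht b)).
  rewrite [X in X * _]big_mkcond [X in _ * X]big_mkcond -big_split.
  apply: eq_big_seq => b bp /=; rewrite mon_X ?(pos_nneg bp) //; last exact: (pos_int CD).
  have : 0 <= bf n b by rewrite (bfC CD) (dom_bf CD) ?(pos_nneg bp).
  by rewrite le_eqVlt eq_sym => /orP[/eqP->|h]; rewrite ?ltxx ?eqxx ?h ?mul1r // gt_eqF // mulr1.
have -> : \sum_(w <- Ws) (eps w)%:P *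
    \prod_(b <- Rp) ((if inA b then - 'X else 0) * hin (fun=> 'X) w b + hout (fun=> 'X) w b) =
    \prod_(b <- Rp | inA b) (1 - 'X^((nht b).+1)) *
    \prod_(b <- Rp | bf n b == 0) (1 - 'X^(nht b)).
  have -> : \prod_(b <- Rp | bf n b == 0) (1 - 'X^(nht b)) = \prod_(b <- Rp) (1 - mon xpar b).
    rewrite big_mkcond; apply: eq_big_seq => b bp; rewrite mon_par ?(pos_nneg bp) //.
      by case: ifP => // _; rewrite subr0.
    exact: (pos_int CD).
  rewrite -weyl_denom mulr_sumr; apply: eq_big_seq => w wW.
  rewrite mon_par ?(rho_le CD) //; last exact: rho_sub_int.
  rewrite stab_rho // mulrCA; congr (_ * _); case: eqVneq => [e|ne].
    exact: macdonald_term_fixed.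
  by rewrite macdonald_term_moved // mulr0.
by rewrite mulrA => /(mulIf (prod_neq0 _)) <-.
Qed.

Lemma simple_pos_id w : w \in Ws -> (forall i, nneg (a_ i *m w)) -> w = 1%:M.
Proof.
move=> wW; elim/(W_ind CD): w / wW => // i M MW ni _ /(_ i).
rewrite mulmxA (sref_simple CD) mulNmx => /(nneg_anti ni) e.
by have := simple_neq0 i; rewrite -(WK CD (a_ i) MW) e mul0mx eqxx.
Qed.

(** If [y = u w^-1] were not 1, some [a_i] orthogonal to [n] would have [a_i y < 0]. Since neither
    [w] nor [u] inverts a root orthogonal to [n], the image [a_i u = (a_i y) w] would be both
    negative and positive. *)
Lemma rep_inj w u : w \in Ws -> u \in Ws -> inv_in Ws (fun b => inA b) w ->
  inv_in Ws (fun b => inA b) u -> n *m w = n *m u -> w = u.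
Proof.
move=> wW uW iw iu e; pose y := u *m invmx w.
have yW : y \in Ws by rewrite (WsM CD) ?(WsV CD).
have ey : n *m y = n by rewrite mulmxA -e (WK CD).
have eu : u = y *m w by rewrite /y mulmxKV // (Ws_unit CD).
suff y1 : y = 1%:M by rewrite eu y1 mul1mx.
apply: simple_pos_id => // i; apply: contraT; rewrite -(nneg_simpleN CD) // => ny.
have aR := simple_root_in CD i.
have b0 : bf n (a_ i) = 0.
  apply/eqP; rewrite eq_le (bfC CD) (dom_bf CD) ?nneg_simple // andbT (bfC CD).
  by rewrite -(bf_W CD _ _ yW) ey -oppr_ge0 -(bfNr CD) (bfC CD) (dom_bf CD).
have bp : - (a_ i *m y) \in Rp by rewrite posP ny (rootNE CD) (rootWE CD) ?aR.
have := allP iw _ bp; rewrite mulNmx opprK -mulmxA -eu (bfNr CD) -{1}ey (bf_W CD) // b0.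
rewrite oppr0 ltxx implybF => nu; have := allP iu _ (pos_simple CD i).
by rewrite b0 ltxx implybF (nneg_simpleN CD) // nu.
Qed.

(** A [w] with the fewest inversions works: if it inverted a root orthogonal to [n], it would send
    some simple root [a_i] orthogonal to [n] to a negative root, and [s_i w] would have fewer
    inversions and the same image of [n]. *)
Lemma rep_ex g : g \in orb Ws n -> exists2 w, w \in Ws & inv_in Ws (fun b => inA b) w /\ n *m w = g.
Proof.
move=> /orbP[w0 w0W e0].
pose s := [seq w <- Ws | n *m w == g].
have w0s : w0 \in s by rewrite mem_filter w0W e0 eqxx.
have sn : s != [::] by apply: contraTneq w0s => ->.
have [w ws hw] := seq_max (fun w => - (nv w)%:R : rat) sn.
move: ws; rewrite mem_filter => /andP[/eqP ew wW].
exists w => //; split=> //; apply/allP => b bp; apply/implyP => nb.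
have bn := pos_nneg bp; rewrite lt_neqAle (bfC CD) (dom_bf CD) // andbT (bfC CD) eq_sym.
apply/negP; rewrite bf_dom_eq0 // => /forallP h.
have [[i bi ni]|hn] := classic (exists2 i, b 0 i != 0 & ~~ nneg (a_ i *m w)).
  have ci : cp i n = 0 by have := h i; rewrite (negPf bi) => /eqP.
  have sW : s_ i *m w \in Ws by rewrite (WsM CD) ?(Ws_sref CD).
  have := hw (s_ i *m w); rewrite mem_filter sW mulmxA srefE ci scale0r subr0 ew eqxx.
  move=> /(_ isT); rewrite lerN2 ler_nat; have := nv_sref CD i wW.
  by rewrite (negPf ni) addn0 addn1 => <-; rewrite ltnn.
have : nneg (b *m w).
  rewrite (row_simple b) mulmx_suml; apply: nneg_sum => i _; rewrite -scalemxAl.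
  have [->|bi] := eqVneq (b 0 i) 0; first by rewrite scale0r nneg0.
  apply: nnegZ; first exact/nnegP.
  by apply: contraT => ni; case: hn; exists i.
move=> /nneg_anti/(_ nb) e; have := root_neq0 CD (pos_root bp).
by rewrite -(WK CD b wW) e mul0mx eqxx.
Qed.

Lemma ell_rep w : w \in Ws -> inv_in Ws (fun b => inA b) w -> ell A d Ws (n *m w) = nv w.
Proof.
move=> wW iw; have wV := WsV CD wW; rewrite /ell /ninv -!size_filter.
rewrite -[RHS](size_map (fun b => - (b *m w))); apply: perm_size; apply: uniq_perm.
- exact/filter_uniq/pos_uniq.
- rewrite map_inj_uniq; first exact/filter_uniq/pos_uniq.
  by move=> u v /oppr_inj; exact: (W_inj CD wW).
move=> b; rewrite mem_filter; apply/andP/mapP => [[h bp]|[c]].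
  have e : bf (n *m w) b = bf n (b *m invmx w) by rewrite (bf_WV CD).
  have bR : b *m invmx w \in R by rewrite (rootWE CD) // pos_root.
  exists (- (b *m invmx w)); last by rewrite mulNmx (WVK CD) // opprK.
  rewrite mem_filter mulNmx (WVK CD) // opprK (pos_nneg bp) /=.
  by apply: inA_pos; rewrite ?(rootNE CD) // (bfNr CD) oppr_gt0 -e.
rewrite mem_filter => /andP[nc cp] ->; split.
  by rewrite (bfNr CD) (bf_W CD) // oppr_lt0; have := allP iw _ cp; rewrite nc.
by rewrite posP nc (rootNE CD) (rootWE CD) // pos_root.
Qed.

Lemma macdonald_sum_orb : macdonald_sum Ws (fun b => inA b) 'X = \sum_(g <- orb Ws n) 'X^(ell A d Ws g).
Proof.
rewrite macdonald_sumE -big_filter.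
rewrite (eq_big_seq (fun w => 'X^(ell A d Ws (n *m w)))) => [|w]; last first.
  by rewrite mem_filter => /andP[iw wW]; rewrite ell_rep.
rewrite -(big_map (mulmx n) xpredT (fun g => 'X^(ell A d Ws g))).
apply: perm_big; apply: uniq_perm; rewrite ?orb_uniq //.
  rewrite map_inj_in_uniq ?filter_uniq ?(weyl_uniq CD) // => w u.
  by rewrite !mem_filter => /andP[iw wW] /andP[iu uW]; apply: rep_inj.
move=> g; apply/mapP/idP => [[w]|/rep_ex[w wW [iw e]]].
  by rewrite mem_filter => /andP[_ wW] ->; apply/orbP; exists w.
by exists w; rewrite // mem_filter iw.
Qed.

Lemma orb_height : (\sum_(g <- orb Ws n) 'X^(ell A d Ws g)) *
    \prod_(b <- Rp | inA b) (1 - 'X^(nht b)) =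
  \prod_(b <- Rp | inA b) (1 - 'X^((nht b).+1)) :> {poly int}.
Proof. by rewrite -macdonald_sum_orb macdonald_height. Qed.
End Dominant.

(** The case [n = rho], which is positive on every positive root. *)
Lemma poincare_height : (\sum_(w <- Ws) 'X^(nv w)) * \prod_(b <- Rp) (1 - 'X^(nht b)) =
  \prod_(b <- Rp) (1 - 'X^((nht b).+1)) :> {poly int}.
Proof.
have inr b : b \in Rp -> 0 < bf rho b.
  move=> bp; rewrite lt_neqAle (bfC CD) (dom_bf CD) ?(dom_rho CD) ?(pos_nneg bp) // andbT.
  rewrite (bfC CD) eq_sym bf_dom_eq0 ?(dom_rho CD) ?(pos_nneg bp) //.
  apply/negP => /forallP h; have /eqP[] := root_neq0 CD (pos_root bp).
  apply/rowP => i; have := h i; rewrite (cp_rho CD) oner_eq0 orbF mxE; exact: eqP.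
have pe (F : V -> {poly int}) : \prod_(b <- Rp | 0 < bf rho b) F b = \prod_(b <- Rp) F b.
  rewrite big_seq_cond [RHS]big_seq; apply: eq_bigl => b.
  by case: (boolP (b \in Rp)) => // bp; rewrite inr.
have := macdonald_height (dom_rho CD); rewrite !pe => <-; congr (_ * _).
rewrite macdonald_sumE [RHS]big_mkcond; apply: eq_bigr => w _.
by rewrite (_ : inv_in _ _ _) //; apply/allP => b bp; rewrite inr // implybT.
Qed.
End MacEval.

(** * Vanishing at roots of unity *)

Section Cyclotomic.
Local Notation pC p := (map_poly (intr : int -> algC) p).

(** [z] is at most a simple root of [1 - X^k], because the derivative does not vanish there. *)
Lemma zeta_factor (z : algC) k : (0 < k)%N -> exists2 g : {poly algC},
  1 - 'X^k = ('X - z%:P) ^+ (z ^+ k == 1) * g & g.[z] != 0.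
Proof.
move=> k0; have [zk|zk] := eqVneq (z ^+ k) 1; last first.
  exists (1 - 'X^k); first by rewrite expr0 mul1r.
  by rewrite !hornerE subr_eq0 eq_sym.
have : root (1 - 'X^k) z by rewrite /root !hornerE zk subrr.
move=> /factor_theorem[g e]; exists g; first by rewrite expr1 mulrC.
have z0 : z != 0.
  by apply: contra_eqN zk => /eqP->; rewrite expr0n gtn_eqF // eq_sym oner_eq0.
have := congr1 (fun p => (p^`()).[z]) e.
rewrite derivB derivC derivXn derivM derivXsubC sub0r mulr1 !hornerE subrr mulr0 add0r.
rewrite hornerMn !hornerE => <-.
by rewrite oppr_eq0 mulrn_eq0 negb_or -lt0n k0 expf_neq0.
Qed.

Lemma zeta_prod (z : algC) (s : seq nat) : all (leq 1) s -> exists2 g : {poly algC},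
  \prod_(k <- s) (1 - 'X^k) = ('X - z%:P) ^+ (count (fun k => z ^+ k == 1) s) * g &
  g.[z] != 0.
Proof.
elim: s => [|k s IH] /=; first by exists 1; rewrite ?big_nil ?mulr1 // hornerC oner_eq0.
case/andP=> k0 /IH[g e gz]; have [f e' fz] := zeta_factor z k0.
exists (f * g); last by rewrite hornerM mulf_neq0.
by rewrite big_cons e e' exprD mulrACA.
Qed.

Lemma pC_prod (I : eqType) (s : seq I) (P : pred I) (f : I -> nat) :
  pC (\prod_(i <- s | P i) (1 - 'X^(f i))) = \prod_(k <- [seq f i | i <- s & P i]) (1 - 'X^k).
Proof.
rewrite big_map big_filter rmorph_prod; apply: eq_bigr => i _.
by rewrite rmorphB rmorph1 rmorphXn /= map_polyX.
Qed.

(** By the symmetry the factors on the right belong to the exponents [H + 1 - k], and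
    [z^(H + 1 - k) = 1] exactly when [z^k = 1]. So [1 - X^(H + 1)] gives the right side one more
    zero at [z], while [1 - X^H] is nonzero there. *)
Lemma zeta_vanish (c : {poly int}) (z : algC) H (s : seq nat) :
  all (fun k => 0 < k < H)%N s -> perm_eq [seq (H - k)%N | k <- s] s ->
  (0 < H)%N -> z ^+ H.+1 = 1 -> z != 1 ->
  pC c * \prod_(k <- H :: s) (1 - 'X^k) = \prod_(k <- H :: s) (1 - 'X^(k.+1)) ->
  (pC c).[z] = 0.
Proof.
move=> sH sp H0 zH z1.
have -> : \prod_(k <- H :: s) (1 - 'X^(k.+1)) =
    \prod_(k <- H.+1 :: [seq (H.+1 - k)%N | k <- s]) (1 - 'X^k) :> {poly algC}.
  rewrite !big_cons; congr (_ * _); rewrite -(perm_big _ sp) !big_map.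
  apply: eq_big_seq => k ks; congr (1 - 'X^_).
  by have := allP sH _ ks; lia.
have [|g1 e1 g1z] := @zeta_prod z (H :: s).
  by rewrite /= H0 /=; apply: sub_all sH => k /andP[].
have [|g2 e2 g2z] := @zeta_prod z (H.+1 :: [seq (H.+1 - k)%N | k <- s]).
  by rewrite /=; apply/allP => _ /mapP[k ks ->]; have := allP sH _ ks; lia.
rewrite e1 e2 /= zH eqxx.
have -> : (z ^+ H == 1) = false.
  by apply: contra_neqF z1 => /eqP h; rewrite exprS h mulr1 in zH.
have -> : count (fun k => z ^+ k == 1) [seq (H.+1 - k)%N | k <- s] =
    count (fun k => z ^+ k == 1) s.
  rewrite count_map; apply: eq_in_count => k ks /=.
  have kH : (k <= H.+1)%N by have := allP sH _ ks; lia.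
  have z0 : z != 0.
    by apply: contra_eqN zH => /eqP->; rewrite expr0n eq_sym oner_eq0.
  have e : z ^+ (H.+1 - k) * z ^+ k = 1 by rewrite -exprD subnK.
  by apply/eqP/eqP => h; move: e; rewrite h ?mulr1 ?mul1r.
rewrite add0n add1n exprS => e.
have : pC c * g1 = ('X - z%:P) * g2.
  apply: (mulfI (x := ('X - z%:P) ^+ count (fun k => z ^+ k == 1) s)).
    by rewrite expf_neq0 ?polyXsubC_eq0.
  by rewrite mulrCA e; ring.
move=> /(congr1 (horner^~ z)); rewrite !hornerM !hornerE subrr mul0r => /eqP.
by rewrite mulf_eq0 (negPf g1z) orbF => /eqP.
Qed.

(* Evaluation at a primitive (H+1)-st root of unity. *)
Lemma max_height_le (s t : seq nat) H : all (leq 1) s -> all (leq 1) t ->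
  (forall k, k \in s -> (k <= H)%N) -> H \in s ->
  \prod_(k <- s) (1 - 'X^(k.+1)) * \prod_(k <- t) (1 - 'X^k) =
  \prod_(k <- t) (1 - 'X^(k.+1)) * \prod_(k <- s) (1 - 'X^k) :> {poly algC} ->
  exists2 k, k \in t & (H <= k)%N.
Proof.
move=> s1 t1 sH Hs e; apply/hasP; apply: contraT => /hasPn tH.
have [z pz] := C_prim_root_exists (ltn0Sn H).
have nz k : (0 < k <= H)%N -> (z ^+ k == 1) = false.
  by move=> kH; rewrite -(prim_order_dvd pz) gtnNdvd //; lia.
have h0 : (\prod_(k <- s) (1 - 'X^(k.+1))).[z] = 0.
  apply/eqP; rewrite horner_prod prodf_seq_eq0; apply/hasP; exists H => //=.
  by rewrite !hornerE (prim_expr_order pz) subrr.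
have := congr1 (horner^~ z) e; rewrite !hornerM h0 mul0r => /esym/eqP.
rewrite mulf_eq0 !horner_prod !prodf_seq_eq0 => /orP[]/hasP[k ks] /=;
  rewrite !hornerE subr_eq0 eq_sym nz //.
  by have := tH _ ks; rewrite -ltnNge; lia.
by have := allP s1 _ ks; have := sH _ ks; lia.
Qed.
End Cyclotomic.

Section Vanish.
Variables (r : nat) (A : 'M[int]_r) (d : 'rV[rat]_r) (Ws : seq 'M[rat]_r).
Hypothesis CD : cartan_datum A d Ws.
Local Notation V := 'rV[rat]_r.
Local Notation R := (rootsW Ws).
Local Notation Rp := (posroots Ws).
Local Notation bf := (bform A d).
Local Notation pC p := (map_poly (intr : int -> algC) p).

Variable theta : V.
Hypotheses (thR : theta \in R)
  (thmax : forall a, a \in R -> forall i, a 0 i <= theta 0 i)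
  (Aind : indecomposable A).
Local Notation H := (nht theta).

Lemma bf_le_th b : b \in R -> bf b b <= bf theta theta.
Proof.
move=> bR; have [w wW dw] := root_dom CD bR.
rewrite -(bf_W CD _ _ wW); have nR : b *m w \in R by rewrite (rootWE CD).
have [->//|nt] := eqVneq (b *m w) theta.
have tn : theta != b *m w by rewrite eq_sym.
have [_] := above_len CD nR dw thR (th_ge thmax nR) tn.
by have := root_bf_gt0 CD nR; move: (bf _ _) (bf _ _) => x y; lra.
Qed.

Lemma bf_th_lt b : b \in R -> 0 < bf theta b -> b != theta -> bf theta b < bf theta theta.
Proof.
move=> bR h ne; have ne' : theta != b by rewrite eq_sym.
have t0 := root_bf_gt0 CD thR.
have nn : theta != - b.
  by apply: contraTneq h => ->; rewrite bfNl oppr_gt0 -leNgt (bf_ge0 CD).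
have := root_cauchy CD thR bR ne' nn; have := bf_le_th bR.
move: t0 h; move: (bf _ _) (bf _ _) (bf _ _) => x y z t0 h l1 l2.
rewrite ltNge; apply/negP => l3.
have : x * z <= y ^+ 2 by rewrite expr2; nra.
lra.
Qed.

Lemma orb_theta_vanish (z : algC) : z ^+ H.+1 = 1 -> z != 1 ->
  (pC (\sum_(g <- orb Ws theta) 'X^(ell A d Ws g))).[z] = 0.
Proof.
move=> zH z1; have dt := dom_th CD thR thmax; have thp := dom_pos CD thR dt.
pose B := [seq b <- Rp | 0 < bf theta b & b != theta].
have uB : uniq B by apply/filter_uniq/pos_uniq.
have BP b : (b \in B) = [&& 0 < bf theta b, b != theta & b \in Rp].
  by rewrite mem_filter andbA.
(* The involution [b |-> theta - b] is the source of the symmetry of the heights. *)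
have refl b : b \in B -> theta - b \in B /\ (nht (theta - b) = H - nht b)%N.
  rewrite !BP => /and3P[h ne bp]; have bR := pos_root bp.
  have ne' : theta != b by rewrite eq_sym.
  have tbR : theta - b \in R by apply: (root_diff CD).
  have tb : theta - b \in Rp by rewrite posP tbR (th_ge thmax).
  split; last by rewrite -(th_nht CD thR thmax bp) addnK.
  rewrite tb andbT (bfBr CD) subr_gt0 bf_th_lt //=.
  by rewrite -subr_eq0 addrAC subrr sub0r oppr_eq0 (root_neq0 CD).
have pB : perm_eq [seq b <- Rp | 0 < bf theta b] (theta :: B).
  apply: uniq_perm; first exact/filter_uniq/pos_uniq.
    by rewrite /= uB andbT BP eqxx /= andbF.
  move=> b; rewrite inE BP mem_filter.
  by have [->|] := eqVneq b theta; rewrite ?(root_bf_gt0 CD) ?thp //.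
apply: (zeta_vanish (s := [seq nht b | b <- B])) zH z1 _ => //.
- apply/allP => _ /mapP[b bB ->]; have [tB e] := refl _ bB.
  move: bB tB; rewrite !BP => /and3P[_ _ bp] /and3P[_ _ tp].
  have := nht_gt0 CD bp; have := nht_gt0 CD tp; rewrite e; clear; lia.
- have -> : [seq (H - k)%N | k <- [seq nht b | b <- B]] =
      [seq nht b | b <- [seq theta - b | b <- B]].
    by rewrite -!map_comp; apply/eq_in_map => b /refl[_ e]; rewrite /= e.
  apply: perm_map; apply: uniq_perm => //.
    by rewrite map_inj_uniq // => u v /addrI/oppr_inj.
  move=> b; apply/mapP/idP => [[c /refl[cB _] ->]//|bB].
  exists (theta - b); first by case: (refl _ bB).
  by rewrite opprB addrC subrK.
- exact: (nht_gt0 CD thp).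
have := congr1 (map_poly (intr : int -> algC)) (orb_height CD dt).
rewrite rmorphM /= (pC_prod Rp _ (@nht r)) (pC_prod Rp _ (fun b => (nht b).+1)) => e.
change (nht theta :: [seq nht b | b <- B]) with [seq nht b | b <- theta :: B].
have pB' := perm_map (@nht r) pB; rewrite -!(perm_big _ pB') e !big_map.
by [].
Qed.
End Vanish.

(** * The dual root system *)

Section Dual.
Variables (r : nat) (A : 'M[int]_r) (d : 'rV[rat]_r) (Ws : seq 'M[rat]_r).
Hypothesis CD : cartan_datum A d Ws.
Local Notation V := 'rV[rat]_r.
Local Notation a_ i := (simple_root i).
Local Notation R := (rootsW Ws).
Local Notation Rp := (posroots Ws).
Local Notation bf := (bform A d).
Local Notation cp := (spair A).
Local Notation dom := (dominant A).

Definition dA : 'M[int]_r := A^T.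
Definition dd : 'rV[rat]_r := \row_i (d 0 i)^-1.
Local Notation D := (diag_mx d).
(** The form identifies [alpha_i] with [d_i alpha_i^vee], so [v *m D] holds the coordinates of [v]
    in the simple coroots, and [conjD w] is [w] written in these. *)
Definition conjD (w : 'M[rat]_r) : 'M[rat]_r := invmx D *m w *m D.
Definition dW := map conjD Ws.

Lemma d_neq0 i : d 0 i != 0. Proof. by rewrite gt_eqF // (symm_gt0 CD). Qed.

Lemma D_unit : D \in unitmx.
Proof.
by rewrite unitmxE det_diag unitfE; apply/prodf_neq0 => i _; apply: d_neq0.
Qed.

Lemma mulD (v : V) i : (v *m D) 0 i = v 0 i * d 0 i.
Proof. by rewrite mul_mx_diag mxE. Qed.

Lemma cp_dual i (v : V) : spair dA i (v *m D) = d 0 i * cp i v.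
Proof.
rewrite !cpE mulr_sumr; apply: eq_bigr => j _; rewrite mulD mxE.
by rewrite -mulrA (symmC CD j i); ring.
Qed.

Lemma simple_D i : (a_ i : V) *m D = d 0 i *: a_ i.
Proof.
apply/rowP => j; rewrite mulD [RHS]mxE !simpleE.
by have [->|_] := eqVneq i j; rewrite ?mul1r ?mulr1 ?mul0r ?mulr0.
Qed.

Lemma sref_dual i : D *m sref dA i = sref A i *m D.
Proof.
apply: mx_ext => v; rewrite !mulmxA !srefE cp_dual mulmxBl -scalemxAl simple_D.
by rewrite scalerA mulrC.
Qed.

Lemma conjD_word s : conjD (wordmx A s) = wordmx dA s.
Proof.
rewrite /conjD; have uD := D_unit; elim: s => [|i s IH] /=.
  by rewrite mulmx1 mulVmx.
rewrite -IH !mulmxA; congr (_ *m _ *m _).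
by apply: (can_inj (mulmxK uD)); rewrite mulmxKV // -mulmxA -sref_dual mulKmx.
Qed.

Lemma bf_dual (u v : V) : bform dA dd (u *m D) (v *m D) = bf u v.
Proof.
apply: eq_bigr => i _; rewrite cp_dual mulD mxE.
by rewrite -!mulrA [_^-1 * _]mulrA mulVf ?d_neq0 // mul1r.
Qed.

Lemma conjD_inj : injective conjD.
Proof.
move=> u v; rewrite /conjD => /(congr1 (fun M => D *m M *m invmx D)).
by rewrite !mulmxA mulmxV ?D_unit // !mul1mx !mulmxK // D_unit.
Qed.

Lemma mulDconj (v : V) w : v *m D *m conjD w = v *m w *m D.
Proof. by rewrite /conjD !mulmxA mulmxK // D_unit. Qed.

Lemma cartan_dual : cartan_datum dA dd dW.
Proof.
split.
- by move=> i; rewrite mxE (cartan_diag CD).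
- by move=> i j ij; rewrite mxE (cartan_offdiag CD) // eq_sym.
- by move=> i j; rewrite !mxE (cartan_sym0 CD).
- by move=> i; rewrite mxE invr_gt0 (symm_gt0 CD).
- move=> i j; rewrite !mxE; have := symmC CD i j.
  have := d_neq0 i; have := d_neq0 j; move: (d 0 i) (d 0 j) => x y y0 x0 e.
  apply: (mulfI x0); apply: (mulfI y0).
  have -> : y * (x * (x^-1 * (A j i)%:~R)) = y * (A j i)%:~R by rewrite mulVKf.
  by rewrite -e mulrCA mulVKf.
- move=> v v0; have -> : v = (v *m invmx D) *m D by rewrite mulmxKV // D_unit.
  rewrite -bfE bf_dual (bf_gt0 CD) //; apply: contra v0 => /eqP e.
  by rewrite -(mulmxKV D_unit v) e mul0mx.
- by rewrite (map_inj_uniq conjD_inj) (weyl_uniq CD).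
move=> M; split=> [/mapP[w wW ->]|[s <-]].
  by have [s <-] := inWs CD wW; exists s; rewrite conjD_word.
by rewrite -conjD_word map_f // (word_in CD).
Qed.

Lemma indec_dual : indecomposable A -> indecomposable dA.
Proof.
move=> h S S0 ST; have [i [j [iS jS ij]]] := h S S0 ST.
by exists i, j; split=> //; rewrite mxE -(cartan_sym0 CD).
Qed.

Definition coroot (g : V) : V := (2 / bf g g) *: (g *m D).
Local Notation cor := coroot.

Lemma cor_W g w : w \in Ws -> cor g *m conjD w = cor (g *m w).
Proof. by move=> wW; rewrite /coroot (bf_W CD) // -scalemxAl mulDconj. Qed.

Lemma cor_simple i : cor (a_ i) = a_ i.
Proof.
rewrite /coroot bf_simple (cp_simple2 CD) simple_D scalerA.
have -> : 2 / (d 0 i * 2) * d 0 i = 1 by field; rewrite d_neq0.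
by rewrite scale1r.
Qed.

Lemma corN g : cor (- g) = - cor g.
Proof. by rewrite /coroot bfNl (bfNr CD) opprK mulNmx scalerN. Qed.

Lemma cor_coef g : g \in R -> 0 < 2 / bf g g.
Proof. by move=> gR; rewrite divr_gt0 // (root_bf_gt0 CD). Qed.

Lemma nnegZD (v : V) c : 0 < c -> nneg (c *: (v *m D)) = nneg v.
Proof.
move=> c0; apply: eq_forallb => i; rewrite mxE mulD pmulr_rge0 // pmulr_lge0 //.
exact: (symm_gt0 CD).
Qed.

Lemma nneg_cor g : g \in R -> nneg (cor g) = nneg g.
Proof. by move=> gR; apply: nnegZD; apply: cor_coef. Qed.

Lemma cor_root x : reflect (exists2 g, g \in R & x = cor g) (x \in rootsW dW).
Proof.
apply: (iffP (rootsP _ _)) => [[i [_ /mapP[w wW ->] ->]]|[g /rootsP[i [w wW ->]] ->]].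
  exists (a_ i *m w); first by rewrite (rootWE CD) // (simple_root_in CD).
  by rewrite -cor_W // cor_simple.
by exists i, (conjD w); rewrite ?map_f // -cor_W // cor_simple.
Qed.

Lemma cor_in g : g \in R -> cor g \in rootsW dW.
Proof. by move=> gR; apply/cor_root; exists g. Qed.

Lemma cor_inj g e : g \in R -> e \in R -> cor g = cor e -> g = e.
Proof.
move=> gR eR h; have cg := cor_coef gR; have ce := cor_coef eR.
have h2 : g = ((2 / bf g g)^-1 * (2 / bf e e)) *: e.
  apply: (can_inj (mulmxK D_unit)); rewrite -scalemxAl -scalerA -/(cor e) -h /coroot.
  by rewrite scalerA mulVf ?scale1r // gt_eqF.
have [//|e2] := root_prop CD gR eR h2; exfalso.
have c0 : 0 < (2 / bf g g)^-1 * (2 / bf e e) by rewrite mulr_gt0 ?invr_gt0.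
move: h2; rewrite {1}e2 => /eqP; rewrite -scaleN1r -subr_eq0 -scalerBl scaler_eq0.
rewrite (negPf (root_neq0 CD eR)) orbF; apply/negP; rewrite lt_eqF //.
by rewrite subr_lt0 (lt_trans _ c0) // ltrN10.
Qed.

Lemma perm_pos_cor : perm_eq (posroots dW) [seq cor b | b <- Rp].
Proof.
apply: uniq_perm; rewrite ?pos_uniq //.
  by rewrite map_inj_in_uniq ?pos_uniq // => u v /pos_root uR /pos_root vR; apply: cor_inj.
move=> x; rewrite posP; apply/andP/mapP => [[/cor_root[g gR ->]]|[b bp ->]].
  by rewrite nneg_cor // => ng; exists g; rewrite // posP gR.
have bR := pos_root bp; split; first exact: cor_in.
by rewrite nneg_cor // (pos_nneg bp).
Qed.

Lemma bf_cor g e : bform dA dd (cor g) (cor e) = (2 / bf g g) * (2 / bf e e) * bf g e.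
Proof. by rewrite /coroot bfZl (bfZr cartan_dual) bf_dual mulrA. Qed.

Lemma bf_cor2 g : g \in R -> bform dA dd (cor g) (cor g) = 4 / bf g g.
Proof.
by move=> /(root_bf_gt0 CD)/gt_eqF/negbT h; rewrite bf_cor; field.
Qed.

Lemma dom_cor g : g \in R -> dominant dA (cor g) = dom g.
Proof.
move=> gR; apply: eq_forallb => i; rewrite cpZ cp_dual.
by rewrite pmulr_rge0 ?cor_coef // pmulr_rge0 // (symm_gt0 CD).
Qed.

Lemma ell_cor g : g \in R -> ell dA dd dW (cor g) = ell A d Ws g.
Proof.
move=> gR; rewrite /ell (permP perm_pos_cor) count_map; apply: eq_in_count => b bp /=.
have bR := pos_root bp.
by rewrite bf_cor pmulr_rlt0 // mulr_gt0 // cor_coef.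
Qed.

Lemma nv_conj w : w \in Ws -> ninv dW (conjD w) = ninv Ws w.
Proof.
move=> wW; rewrite /ninv (permP perm_pos_cor) count_map; apply: eq_in_count => b bp /=.
have bR : b *m w \in R by rewrite (rootWE CD) // pos_root.
by rewrite cor_W // -corN nneg_cor // (rootNE CD).
Qed.

Lemma perm_orb_cor n : n \in R -> perm_eq (orb dW (cor n)) [seq cor g | g <- orb Ws n].
Proof.
move=> nR; apply: uniq_perm; rewrite ?orb_uniq //.
  rewrite map_inj_in_uniq ?orb_uniq // => u v /(orb_root CD nR) uR /(orb_root CD nR) vR.
  exact: cor_inj.
move=> x; apply/orbP/mapP => [[_ /mapP[w wW ->] ->]|[_ /orbP[w wW ->] ->]].
  by exists (n *m w); rewrite ?cor_W //; apply/orbP; exists w.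
by exists (conjD w); rewrite ?map_f // cor_W.
Qed.

Lemma orb_cor_sum n : n \in R ->
  \sum_(g <- orb dW (cor n)) 'X^(ell dA dd dW g) =
  \sum_(g <- orb Ws n) 'X^(ell A d Ws g) :> {poly int}.
Proof.
move=> nR; rewrite (perm_big _ (perm_orb_cor nR)) big_map; apply: eq_big_seq => g gO.
by rewrite ell_cor // (orb_root CD nR).
Qed.

End Dual.

(** * Palindromicity *)

Section Final.
Variables (r : nat) (A : 'M[int]_r) (d : 'rV[rat]_r) (Ws : seq 'M[rat]_r).
Hypothesis CD : cartan_datum A d Ws.
Local Notation V := 'rV[rat]_r.
Local Notation a_ i := (simple_root i).
Local Notation R := (rootsW Ws).
Local Notation Rp := (posroots Ws).
Local Notation bf := (bform A d).
Local Notation dom := (dominant A).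
Local Notation pC p := (map_poly (intr : int -> algC) p).
Local Notation cor := (coroot A d).
Local Notation dWs := (dW d Ws).
Local Notation Rp' := (posroots dWs).

Variable theta : V.
Hypotheses (thR : theta \in R)
  (thmax : forall a, a \in R -> forall i, a 0 i <= theta 0 i)
  (Aind : indecomposable A).
Local Notation H := (nht theta).
Local Notation M0 := (qmult A Ws theta 0).
Local Notation Y := (Theta_sum A Ws theta).

(** The two root systems share the Weyl group and its length function, hence the Poincare
    polynomial. *)
Lemma poincare_dual :
  \prod_(b <- Rp) (1 - 'X^((nht b).+1)) * \prod_(b <- Rp') (1 - 'X^(nht b)) =
  \prod_(b <- Rp') (1 - 'X^((nht b).+1)) * \prod_(b <- Rp) (1 - 'X^(nht b)) :> {poly int}.
Proof.
rewrite -(poincare_height CD) -(poincare_height (cartan_dual CD)).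
have -> : \sum_(w <- dWs) 'X^(ninv dWs w) = \sum_(w <- Ws) 'X^(ninv Ws w) :> {poly int}.
  by rewrite big_map; apply: eq_big_seq => w wW; rewrite (nv_conj CD).
by rewrite mulrAC.
Qed.

Lemma heights_gt0 (A' : 'M[int]_r) d' Ws' : cartan_datum A' d' Ws' ->
  all (leq 1) [seq nht b | b <- posroots Ws'].
Proof. by move=> CD'; apply/allP => _ /mapP[b bp ->]; apply: (nht_gt0 CD'). Qed.

Section TwoLengths.
Variable n : V.
Hypotheses (nR : n \in R) (dn : dom n) (nt : n != theta).

(** [cor n] and [cor theta] are comparable dominant roots of the dual system. The upper one is the
    longer, and passing to coroots reverses lengths, so it is [cor n]; every coroot lies below its
    dominant conjugate. *)
Lemma cor_max x : x \in rootsW dWs -> nneg (cor n - x).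
Proof.
have CD' := cartan_dual CD; have dt := dom_th CD thR thmax.
have tn : nneg (cor n - cor theta).
  have tn : theta != n by rewrite eq_sym.
  have [_ l] := above_len CD nR dn thR (th_ge thmax nR) tn.
  have ne : cor n != cor theta by apply: contra nt => /eqP/(cor_inj CD nR thR)->.
  have [h|h] := dom_comparable CD' (indec_dual CD Aind) (cor_in CD nR) (cor_in CD thR)
    (etrans (dom_cor CD nR) dn) (etrans (dom_cor CD thR) dt) ne.
    exact: pos_nneg h.
  exfalso; have ne' : cor theta != cor n by rewrite eq_sym.
  have [_] := above_len CD' (cor_in CD nR) (etrans (dom_cor CD nR) dn) (cor_in CD thR)
    (pos_nneg h) ne'.
  rewrite !(bf_cor2 CD) //; have n0 := root_bf_gt0 CD nR; have t0 := root_bf_gt0 CD thR.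
  move: l n0 t0; move: (bf _ _) (bf _ _) => u v l u0 v0.
  rewrite ler_pdivlMr // mulrA mulrAC ler_pdivrMr //; lra.
move=> /(cor_root CD)[g gR ->]; have [w wW dw] := root_dom CD gR.
have gwR : g *m w \in R by rewrite (rootWE CD).
have wV := WsV CD wW.
have h : nneg (cor (g *m w) - cor g).
  rewrite -{2}(WK CD g wW) -(cor_W CD _ wV); apply: (dom_le CD').
    by rewrite (dom_cor CD).
  exact: map_f.
have [e|ne] := eqVneq (g *m w) theta.
  by rewrite e in h; rewrite -(subrK (cor theta) (cor n)) -addrA nnegD.
by rewrite (dom_two CD thR thmax Aind gwR nR dw dn ne nt) in h.
Qed.

Lemma cor_max_coord x : x \in rootsW dWs -> forall i, x 0 i <= cor n 0 i.
Proof.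
by move=> /cor_max/nnegP h i; have := h i; rewrite mxE [X in _ + X]mxE subr_ge0.
Qed.

(** Comparing the two expressions of the Poincare polynomial by [max_height_le], in both directions,
    shows that the largest heights agree. *)
Lemma nht_cor : nht (cor n) = H.
Proof.
have CD' := cartan_dual CD; have nR' := cor_in CD nR.
have tp : theta \in Rp := dom_pos CD thR (dom_th CD thR thmax).
have np : cor n \in Rp' := dom_pos CD' nR' (dom_th CD' nR' cor_max_coord).
have := congr1 (map_poly (intr : int -> algC)) poincare_dual.
rewrite !rmorphM /= !pC_prod !filter_predT !big_map => e.
have b1 := heights_gt0 CD; have b2 := heights_gt0 CD'.
apply/eqP; rewrite eqn_leq; apply/andP; split.
  have [||_ /mapP[b bp ->] h] := max_height_le b2 b1 _ (map_f _ np).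
  - by move=> _ /mapP[b bp ->]; apply: (nht_le CD' nR' cor_max_coord bp).
  - by rewrite !big_map e.
  by apply: leq_trans h _; apply: (nht_le CD thR thmax bp).
have [||_ /mapP[b bp ->] h] := max_height_le b1 b2 _ (map_f _ tp).
- by move=> _ /mapP[b bp ->]; apply: (nht_le CD thR thmax bp).
- by rewrite !big_map e.
by apply: leq_trans h _; apply: (nht_le CD' nR' cor_max_coord bp).
Qed.

Lemma orb_short_vanish (z : algC) : z ^+ H.+1 = 1 -> z != 1 ->
  (pC (\sum_(g <- orb Ws n) 'X^(ell A d Ws g))).[z] = 0.
Proof.
move=> zH z1; rewrite -(orb_cor_sum CD nR).
apply: (orb_theta_vanish (cartan_dual CD) (cor_in CD nR) cor_max_coord) => //.
by rewrite nht_cor.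
Qed.
End TwoLengths.

Lemma Theta_sum_vanish (z : algC) : z ^+ H.+1 = 1 -> z != 1 -> (pC Y).[z] = 0.
Proof.
move=> zH z1; have h := orb_theta_vanish CD thR thmax zH z1.
have [[n [nR dn nt]]|none] :=
    classic (exists n, [/\ n \in R, dom n & n != theta]); last first.
  rewrite (Theta_sum_simply_laced CD thR thmax Aind) // => n nR dn; apply/eqP/negPn/negP => nt.
  by apply: none; exists n.
rewrite (Theta_sum_two_lengths CD thR thmax Aind nR dn nt) rmorphD !rmorphM /= hornerD !hornerM h.
by rewrite (orb_short_vanish nR dn nt zH z1) !mulr0 addr0.
Qed.

Lemma heights_simple : count (fun b : V => nht b == 1%N) Rp = r.
Proof.
rewrite -size_filter -[RHS]card_ord cardE -(size_map (fun i : 'I_r => a_ i : V)).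
apply: perm_size; apply: uniq_perm; first exact/filter_uniq/pos_uniq.
  rewrite map_inj_uniq ?enum_uniq // => i j /rowP/(_ j); rewrite !simpleE eqxx.
  by case: eqP => // _ /eqP; rewrite eq_sym oner_eq0.
move=> b; rewrite mem_filter; apply/andP/mapP => [[/eqP b1 bp]|[i _ ->]].
  by have [i e] := nht1_simple CD bp b1; exists i; rewrite ?mem_enum.
by rewrite nht_simple (pos_simple CD).
Qed.

(* [M0rev] is [q^h M0(1/q)]. *)
Definition M0rev : {poly int} := r%:R * 'X^(H.+1) +
  \sum_(b <- Rp) ('X^(H.+1 - nht b) - 'X^((H.+1 - nht b).+1)).

Lemma Theta_sum_M0rev : 'X * ('X - 1) * Y = 'X^(H.+1) * M0 - M0rev.
Proof.
rewrite (Theta_sumE CD thR thmax Aind) (M0E CD thR thmax Aind) /M0rev [in RHS]mulrDr.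
rewrite [_ * r%:R]mulrC opprD addrACA subrr add0r !mulr_sumr -sumrB.
apply: eq_big_seq => b bp; have b1 := nht_gt0 CD bp; have bH := nht_le CD thR thmax bp.
have [e he] : {e | (H - nht b)%N = e} by exists (H - nht b)%N.
have -> : (H.+1 - nht b = e.+1)%N by clear -bH he; lia.
rewrite he exprD !exprS; move: 'X ('X^_) ('X^H) ('X^e) => x w v u; ring.
Qed.

Lemma size_leD (p q : {poly int}) m : (size p <= m)%N -> (size q <= m)%N ->
  (size (p + q)%R <= m)%N.
Proof. by move=> hp hq; rewrite (leq_trans (size_polyD _ _)) // geq_max hp. Qed.

Lemma size_leB (p q : {poly int}) m : (size p <= m)%N -> (size q <= m)%N ->
  (size (p - q)%R <= m)%N.
Proof. by move=> hp hq; rewrite size_leD // size_polyN. Qed.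

Lemma size_le_sum (I : eqType) (s : seq I) (F : I -> {poly int}) m :
  (forall i, i \in s -> (size (F i) <= m)%N) -> (size (\sum_(i <- s) F i)%R <= m)%N.
Proof.
move=> h; rewrite big_seq; apply: (big_ind (fun p : {poly int} => (size p <= m)%N)) => //.
  by rewrite size_poly0.
by move=> p q; apply: size_leD.
Qed.

Lemma size_M0_rev : (size (M0 - M0rev)%R <= H.+2)%N.
Proof.
have sX k : (k <= H.+1)%N -> (size ('X^k : {poly int}) <= H.+2)%N.
  by move=> kH; rewrite size_polyXn.
have sn : (size (r%:R : {poly int}) <= 1)%N by rewrite -polyC_natr size_polyC_leq1.
apply: size_leB; first rewrite (M0E CD thR thmax Aind).
  apply: size_leD; first exact: leq_trans sn _.
  apply: size_le_sum => b bp; have bH := nht_le CD thR thmax bp.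
  rewrite mulrBl mul1r -exprS; apply: size_leB; apply: sX; clear -bH; lia.
apply: size_leD; last first.
  by apply: size_le_sum => b bp; have b1 := nht_gt0 CD bp; apply: size_leB; apply: sX; clear -b1; lia.
by rewrite -polyC_natr mul_polyC (leq_trans (size_scale_leq _ _)) // sX.
Qed.

(** At 0 only the roots of height 1 count in [M0], and there are [r] of them, which cancels its
    constant [r]. *)
Lemma M0_rev_at0 : (M0 - M0rev).[0] = 0.
Proof.
rewrite (M0E CD thR thmax Aind) /M0rev !hornerE !horner_sum.
rewrite expr0n /= mulr0 add0r [X in _ - X]big_seq [X in _ - X]big1 ?subr0; last first.
  move=> b bp; have bH := nht_le CD thR thmax bp.
  rewrite !hornerE !expr0n subn_eq0 leqNgt ltnS bH /=.
  by rewrite subrr.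
rewrite (eq_big_seq (fun b => - (if nht b == 1%N then 1 else 0))) => [|b bp].
  rewrite sumrN -big_mkcond big_const_seq heights_simple iter_addr_0.
  by rewrite -polyC_natr hornerC subrr.
rewrite !hornerE expr0n; have := nht_gt0 CD bp; case: (nht b) => // -[|k] _ /=.
  by rewrite mulr1.
by rewrite mulr0 oppr0.
Qed.

Lemma M0_palindromic : M0 = M0rev.
Proof.
apply/eqP; rewrite -subr_eq0; apply/eqP.
have inj : injective (map_poly (intr : int -> algC)).
  by apply: map_inj_poly => //; exact: intr_inj.
apply: inj; rewrite rmorph0; apply/eqP; apply: contraT => P0.
have [z pz] := C_prim_root_exists (ltn0Sn H).
have z1 := prim_expr_order pz.
have z0 : z != 0.
  by apply: contra_eqN z1 => /eqP->; rewrite expr0n eq_sym oner_eq0.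
(* These are [H + 2] distinct roots of a polynomial of degree at most [H + 1]. At [z^i = 1] the
   vanishing comes from the factor [X - 1], at the other powers from [Theta_sum_vanish]. *)
pose rs := 0 :: [seq z ^+ i | i <- iota 0 H.+1].
have allr : all (root (pC (M0 - M0rev))) rs.
  apply/allP => x; rewrite inE => /orP[/eqP->|/mapP[i _ ->]].
    by rewrite /root horner_coef0 coef_map -horner_coef0 M0_rev_at0.
  have := congr1 (fun p => (pC p).[z ^+ i]) Theta_sum_M0rev.
  rewrite /root !(rmorphB, rmorphM, rmorphXn) /= !map_polyX rmorph1.
  rewrite !hornerE exprAC z1 expr1n mul1r => <-; rewrite !mulf_eq0.
  have [->|zi] := eqVneq (z ^+ i) 1; first by rewrite subrr eqxx orbT.
  by rewrite Theta_sum_vanish ?eqxx ?orbT // exprAC z1 expr1n.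
have uniqr : uniq rs.
  rewrite cons_uniq map_inj_in_uniq ?iota_uniq ?andbT => [|i j].
    by apply/mapP => -[i _] /esym/eqP; rewrite expf_eq0 (negPf z0) andbF.
  rewrite !mem_iota !add0n => /andP[_ iH] /andP[_ jH] /eqP.
  by rewrite (eq_prim_root_expr pz) !modn_small // => /eqP.
have := max_poly_roots P0 allr uniqr; rewrite /= size_map size_iota.
rewrite size_map_inj_poly //; last exact: intr_inj.
by rewrite ltnNge size_M0_rev.
Qed.

Lemma mulX_Theta_sum : 'X * Y = M0 * \sum_(k < H.+1) 'X^k.
Proof.
have X1 : 'X - 1 != 0 :> {poly int} by rewrite -polyC1 polyXsubC_eq0.
apply: (mulfI X1); rewrite mulrA [('X - 1) * 'X]mulrC Theta_sum_M0rev -M0_palindromic.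
by rewrite mulrCA -subrX1 mulrBr mulr1 mulrC.
Qed.

Lemma sum_all (c : V -> {poly int}) :
  \sum_(mu <- undup (0 :: R)) c mu = c 0 + \sum_(mu <- R) c mu.
Proof.
have n0 : 0 \notin R by apply/negP => /(root_neq0 CD); rewrite eqxx.
by rewrite /= (negPf n0) big_cons undup_id // root_uniq.
Qed.
End Final.

Theorem theorem2p2 (r : nat) (A : 'M[int]_r) (Ws : seq 'M[rat]_r)
    (theta : 'rV[rat]_r) (h : nat) :
  (0 < r)%N -> is_finite_cartan A -> indecomposable A ->
  uniq Ws -> (forall M, M \in Ws <-> inW A M) ->
  theta \in rootsW Ws ->
  (forall a, a \in rootsW Ws -> forall i, a 0 i <= theta 0 i) ->
  (h%:R : rat) = ht theta + 1 ->
  let m0 := qmult A Ws theta 0 in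
  'X * (\sum_(mu <- undup (0 :: rootsW Ws)) qmult A Ws theta mu)
    = 'X * (m0 * (m0 - r%:R + 1)) + m0 * \sum_(k < h) 'X^k
  /\
  'X * (\sum_(mu <- undup (0 :: rootsW Ws))
          (if mu == 0 then r%:R else 1) * qmult A Ws theta mu)
    = 'X * (m0 * m0) + m0 * \sum_(k < h) 'X^k.
Proof.
move=> _ [A2 A0 As [d [d0 ds dp]]] Aind uW WP thR thmax hh m0.
have CD : cartan_datum A d Ws by split.
have thp := dom_pos CD thR (dom_th CD thR thmax).
have -> : h = (nht theta).+1.
  by apply/eqP; rewrite -(eqr_nat rat) hh -(pos_nht CD thp) natr1.
have e := mulX_Theta_sum CD thR thmax Aind; have eM := sum_Mt CD thR thmax Aind.
rewrite -/m0 in e eM; rewrite !(sum_all CD) -e eM -/m0; split; first by ring.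
rewrite eqxx -/m0.
have -> : \sum_(mu <- rootsW Ws) (if mu == 0 then r%:R else 1) * qmult A Ws theta mu =
    \sum_(mu <- rootsW Ws) qmult A Ws theta mu.
  apply: eq_big_seq => mu /(root_neq0 CD)/negPf->.
  by rewrite mul1r.
by rewrite eM; ring.
Qed.
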